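(* Let $X$ be a finite virtual birack, $S$ a finite $X$-shadow, and $G$ an abelian group with the structure of a $\mathbb{Z}[X,S]$-module, where $\mathbb{Z}[X,S]$ is the virtual birack shadow algebra. If $L$ and $L'$ are virtually isotopic oriented virtual links, then $$\Phi^{M,G}_{X,S}(L)=\Phi^{M,G}_{X,S}(L')$$ as multisets of isomorphism classes of modules, and (when $G$ is finite, so that the polynomials are defined) $$\Phi^{G}_{X,S}(L)=\Phi^{G}_{X,S}(L').$$
   Context: **Virtual links.** A virtual link diagram is an oriented link diagram in the plane (a planar 4-valent graph) each of whose double points is either a classical crossing (with over/under information) or a virtual crossing (no over/under information). Virtual links are equivalence classes of such diagrams under planar isotopy, the classical Reidemeister moves I, II, III, the virtual analogues vI, vII, vIII (the same moves with all crossings virtual), and the mixed move v (an arc having two consecutive virtual crossings may be moved past a classical crossing). Equivalent diagrams are called virtually isotopic. A semiarc is a portion of the diagram between consecutive crossing points, classical or virtual (a component without crossings is one semiarc). A region is a connected component of the complement of the diagram in the plane. The writhe of a component is the sum of the signs of the classical crossings of that component with itself; the writhe vector of a diagram with $c$ components is the vector in $\mathbb{Z}^c$ of writhes of the components. **Virtual biracks.** Let $\Delta(x)=(x,x)$. A virtual birack structure on a set $X$ is a pair of invertible maps $B,V:X\times X\to X\times X$, with components $B=(B_1,B_2)$, $V=(V_1,V_2)$, such that: (i) there exist unique invertible maps $S,vS:X\times X\to X\times X$ with $S(B_1(x,y),x)=(B_2(x,y),y)$ and $vS(V_1(x,y),x)=(V_2(x,y),y)$ for all $x,y\in X$; (ii)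 the four component maps $(S^{\pm1}\circ\Delta)_1,(S^{\pm1}\circ\Delta)_2:X\to X$ are bijections; (iii) $V^2=\mathrm{Id}_{X\times X}$ and $(vS\circ\Delta)_1=(vS\circ\Delta)_2$; (iv) writing $I=\mathrm{Id}_X$, $(B\times I)(I\times B)(B\times I)=(I\times B)(B\times I)(I\times B)$, $(V\times I)(I\times V)(V\times I)=(I\times V)(V\times I)(I\times V)$, and $(B\times I)(I\times V)(V\times I)=(I\times V)(V\times I)(I\times B)$. (The sideways map $S$ here is unrelated to the shadow $S$ below.) Write $B(x,y)=(y^x,x_y)$ and $V(x,y)=(y^{\widetilde{x}},x_{\widetilde{y}})$. Put $\alpha=\left((S^{-1}\circ\Delta)_2\right)^{-1}$ and $\pi=(S^{-1}\circ\Delta)_1\circ\alpha$ (the kink map). The birack rank $N$ of $X$ is the smallest positive integer with $\pi^N=\mathrm{Id}_X$. **Labelings.** An $X$-labeling of a diagram assigns an element of $X$ to each semiarc so that at each crossing, drawn with both strands oriented upward: at a positive crossing (the strand from lower left to upper right is over), if the lower left and lower right labels are $x,y$, then the upper left and upper right labels are $y^x$ and $x_y$; at a negative crossing (the strand from lower right to upper left is over), if the upper left and upper right labels are $x,y$, then the lower left and lower right labels are $y^x$ and $x_y$; at a virtual crossing, if the lower left and lower right labels are $x,y$, then the upper left and upper right labels are $y^{\widetilde{x}}$ and $x_{\widetilde{y}}$. **Shadows.** An $X$-shadow is a set $S$ with a map $\cdot:S\times X\to S$ such that $A\mapsto A\cdot x$ is a bijection for every $x\in X$ (its inverse is written $A\mapsto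 A\cdot^{-1}x$) and $(A\cdot y_x)\cdot x^y=(A\cdot y_{\widetilde{x}})\cdot x^{\widetilde{y}}=(A\cdot x)\cdot y$ for all $x,y\in X$, $A\in S$. An $X,S$-labeling of a diagram is an $X$-labeling together with an assignment of an element of $S$ to each region such that, at each semiarc labeled $x$, if the region to its right (facing in the direction of orientation) is labeled $A$, the region to its left is labeled $A\cdot x$. **Virtual birack shadow algebra.** $\mathbb{Z}[X,S]$ is the quotient of the polynomial algebra $\mathbb{Z}[v_{A,x,y}^{\pm1},t_{A,x,y}^{\pm1},s_{A,x,y},r_{A,x,y}^{\pm1}]$ ($A\in S$, $x,y\in X$) by the ideal $I$ generated by the following elements, for all $A\in S$, $x,y,z\in X$, where $x_{yz}$ means $(x_y)_z$: - $v_{A,y^{\widetilde{x}},x_{\widetilde{y}}}-v_{A,x,y}$ - $v_{A\cdot y_{\widetilde{z}},x,z^{\widetilde{y}}}v_{A,y,z}-v_{A\cdot(x_{\widetilde{y}})_{\widetilde{z}},y^{\widetilde{x}},z^{\widetilde{x_{\widetilde{y}}}}}v_{A,x_{\widetilde{y}},z}$ - $v_{A\cdot(x_{\widetilde{y}})_{\widetilde{z}},y^{\widetilde{x}},z^{\widetilde{x_{\widetilde{y}}}}}v_{A,x_{\widetilde{z^{\widetilde{y}}}},y_{\widetilde{z}}}-v_{A\cdot z,x,y}v_{A,y,z}$ - $v_{A\cdot z,x,y}v_{A,x_{\widetilde{y}},z}-v_{A\cdot y_{\widetilde{z}},x,z^{\widetilde{y}}}v_{A,x_{\widetilde{z^{\widetilde{y}}}},y_{\widetilde{z}}}$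 - $v_{A\cdot y_z,x,z^y}v_{A,x_{\widetilde{z^y}},y_z}-v_{A\cdot z,x,y}v_{A,x_{\widetilde{y}},z}$ - $v_{A,x_{\widetilde{z^y}},y_z}r_{A,y,z}-r_{A\cdot(x_{\widetilde{y}})_{\widetilde{z}},y^{\widetilde{x}},z^{\widetilde{x_{\widetilde{y}}}}}v_{A\cdot z,x,y}$ - $v_{A\cdot y_z,x,z^y}t_{A,y,z}-t_{A\cdot(x_{\widetilde{y}})_{\widetilde{z}},y^{\widetilde{x}},z^{\widetilde{x_{\widetilde{y}}}}}v_{A,x_{\widetilde{y}},z}$ - $v_{A\cdot y_z,x,z^y}s_{A,y,z}-s_{A\cdot(x_{\widetilde{y}})_{\widetilde{z}},y^{\widetilde{x}},z^{\widetilde{x_{\widetilde{y}}}}}v_{A\cdot z,x,y}$ - $r_{A,x_{z^y},y_z}r_{A\cdot y_z,x,z^y}-r_{A,x_y,z}r_{A\cdot z,x,y}$ - $t_{A,x_{z^y},y_z}r_{A,y,z}-r_{A\cdot x_{yz},y^x,z^{x_y}}t_{A\cdot z,x,y}$ - $s_{A,x_{z^y},y_z}r_{A\cdot y_z,x,z^y}-r_{A\cdot x_{yz},y^x,z^{x_y}}s_{A\cdot z,x,y}$ - $t_{A\cdot y_z,x,z^y}t_{A,y,z}-t_{A\cdot x_{yz},y^x,z^{x_y}}t_{A,x_y,z}$ - $t_{A\cdot y_z,x,z^y}s_{A,y,z}-s_{A\cdot x_{yz},y^x,z^{x_y}}t_{A\cdot z,x,y}$ - $s_{A\cdot y_z,x,z^y}-t_{A\cdot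 x_{yz},y^x,z^{x_y}}s_{A,x_y,z}r_{A\cdot z,x,y}-s_{A\cdot x_{yz},y^x,z^{x_y}}s_{A\cdot z,x,y}$ - $1-\prod_{k=0}^{N-1}\left(t_{A\cdot^{-1}\alpha(\pi^k(x)),\pi^k(x),\alpha(\pi^k(x))}\,r_{A\cdot^{-1}\alpha(\pi^k(x)),\pi^k(x),\alpha(\pi^k(x))}+s_{A\cdot^{-1}\alpha(\pi^k(x)),\pi^k(x),\alpha(\pi^k(x))}\right)$ A $\mathbb{Z}[X,S]$-module (virtual shadow module) is a representation of this algebra: an abelian group $G$ with automorphisms $v_{A,x,y},t_{A,x,y},r_{A,x,y}$ and endomorphisms $s_{A,x,y}$ (commuting, as the algebra is commutative) such that every generator of $I$ acts as zero. **Bead relations and $\mathbb{Z}[f]$.** Let $f$ be an $X,S$-labeling of a diagram. $\mathbb{Z}[f]$ is the $\mathbb{Z}[X,S]$-module generated by one element (''bead'') for each semiarc, with the following relations at each crossing, drawn with both strands oriented upward, where $A$ is the label of the region immediately to the right of the crossing: - positive crossing with lower left/right labels $x,y$, lower left/right beads $a,b$, upper left/right beads $c,d$: $c=t_{A,x,y}b+s_{A,x,y}a$, $d=r_{A,x,y}a$; - negative crossing with upper left/right labels $x,y$, upper left/right beads $a,b$, lower left/right beads $c,d$: $c=t_{A,x,y}b+s_{A,x,y}a$, $d=r_{A,x,y}a$; - virtual crossing with lower left/right labels $x,y$, lower left/right beads $a,b$, upper left/right beads $c,d$: $c=v_{A,x,y}b$, $d=v_{A,x,y}^{-1}a$. $\mathrm{Hom}_G(\mathbb{Z}[f],G)$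 denotes the module of $\mathbb{Z}[X,S]$-module homomorphisms $\mathbb{Z}[f]\to G$, i.e. of assignments of elements of $G$ to the semiarcs satisfying all the bead relations. **Invariants.** For a virtual link $L$ with $c$ components, computed from any given diagram, and $\mathbf{w}\in(\mathbb{Z}_N)^c$, let $(L,\mathbf{w})$ be a diagram of $L$ whose writhe vector reduces to $\mathbf{w}$ modulo $N$ (obtained from the given diagram by adding or removing kinks), and let $\mathcal{L}((L,\mathbf{w}),X,S)$ be its set of $X,S$-labelings. The virtual shadow module multiset is the multiset $$\Phi^{M,G}_{X,S}(L)=\left\{\mathrm{Hom}_G(\mathbb{Z}[f],G): f\in\mathcal{L}((L,\mathbf{w}),X,S),\ \mathbf{w}\in(\mathbb{Z}_N)^c\right\}$$ (members taken up to isomorphism), and the virtual shadow module polynomial is $$\Phi^{G}_{X,S}(L)=\sum_{\mathbf{w}\in(\mathbb{Z}_N)^c}\ \sum_{f\in\mathcal{L}((L,\mathbf{w}),X,S)}u^{|\mathrm{Hom}_G(\mathbb{Z}[f],G)|}.$$ *)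

(* Defs.v *)
From HB Require Import structures.
From Stdlib Require Import Relations.
From mathcomp Require Import all_boot all_order all_algebra all_fingroup.
From mathcomp Require Import finmap boolp classical_sets functions cardinality.

Set Implicit Arguments.
Unset Strict Implicit.
Unset Printing Implicit Defensive.

Import Order.TTheory GRing.Theory Num.Theory.
Local Open Scope ring_scope.

Section BirackAxioms.

Variable X : Type.
Implicit Types F : X * X -> X * X.

Definition on_left F (p : X * X * X) : X * X * X := (F p.1, p.2).
Definition on_right F (p : X * X * X) : X * X * X :=
  let q := F (p.1.2, p.2) in (p.1.1, q.1, q.2).

Definition sideways F S : Prop :=
  forall x y, S ((F (x, y)).1, x) = ((F (x, y)).2, y).

Definition unique_sideways F S : Prop :=
  [/\ bijective S, sideways F S &
      forall S', bijective S' -> sideways F S' -> S' =1 S].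

End BirackAxioms.

Record virtual_birack := VirtualBirack {
  vb_car :> finType;
  vbB : vb_car * vb_car -> vb_car * vb_car;
  vbV : vb_car * vb_car -> vb_car * vb_car;
  vbS : vb_car * vb_car -> vb_car * vb_car;
  vbvS : vb_car * vb_car -> vb_car * vb_car;
  vbB_bij : bijective vbB;
  vbV_bij : bijective vbV;
  vbS_sideways : unique_sideways vbB vbS;
  vbvS_sideways : unique_sideways vbV vbvS;
  vbS_diag1 : bijective (fun x => (vbS (x, x)).1);
  vbS_diag2 : bijective (fun x => (vbS (x, x)).2);
  vbSV_diag1 : bijective (fun x => (finv vbS (x, x)).1);
  vbSV_diag2 : bijective (fun x => (finv vbS (x, x)).2);
  vbV_invol : forall p, vbV (vbV p) = p;
  vbvS_diag : forall x, (vbvS (x, x)).1 = (vbvS (x, x)).2;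
  vbB_braid : forall p, on_left vbB (on_right vbB (on_left vbB p))
                        = on_right vbB (on_left vbB (on_right vbB p));
  vbV_braid : forall p, on_left vbV (on_right vbV (on_left vbV p))
                        = on_right vbV (on_left vbV (on_right vbV p));
  vbBV_mixed : forall p, on_left vbB (on_right vbV (on_left vbV p))
                         = on_right vbV (on_left vbV (on_right vbB p)) }.

(* [up y x], [dn x y], [vup y x], [vdn x y] are y^x, x_y and their virtual
   (tilde) counterparts: B (x, y) = (y^x, x_y). *)
Definition up (X : virtual_birack) (y x : X) : X := (vbB (x, y)).1.
Definition dn (X : virtual_birack) (x y : X) : X := (vbB (x, y)).2.
Definition vup (X : virtual_birack) (y x : X) : X := (vbV (x, y)).1.
Definition vdn (X : virtual_birack) (x y : X) : X := (vbV (x, y)).2.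

Section Kinks.

Variable X : virtual_birack.

Definition kink_alpha : X -> X := finv (fun x => (finv (@vbS X) (x, x)).2).
Definition kink_map (x : X) : X :=
  (finv (@vbS X) (kink_alpha x, kink_alpha x)).1.

Lemma kink_map_inj : injective kink_map.
Proof.
have /bij_inj i1 := vbSV_diag1 X; have /bij_inj i2 := vbSV_diag2 X.
by move=> x y /i1 /(finv_inj i2).
Qed.

Lemma birack_rank_exists :
  exists n, (0 < n)%N && [forall x, iter n kink_map x == x].
Proof.
exists #[perm kink_map_inj]%g; rewrite order_gt0; apply/forallP => x.
rewrite -[X in _ == X]perm1 -(expg_order (perm kink_map_inj)) permX.
by apply/eqP; apply: eq_iter => y; rewrite permE.
Qed.

Definition birack_rank : nat := ex_minn birack_rank_exists.

End Kinks.

Record shadow (X : virtual_birack) := Shadow {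
  sh_car :> finType;
  sh_act : sh_car -> X -> sh_car;
  sh_act_bij : forall x, bijective (fun A => sh_act A x);
  sh_act_B : forall A x y,
    sh_act (sh_act A (dn y x)) (up x y) = sh_act (sh_act A x) y;
  sh_act_V : forall A x y,
    sh_act (sh_act A (vdn y x)) (vup x y) = sh_act (sh_act A x) y }.

Definition sh_actV (X : virtual_birack) (S : shadow X) (A : S) (x : X) : S :=
  finv (fun C => sh_act C x) A.

Declare Scope shadow_scope.
Delimit Scope shadow_scope with sh.
Notation "A · x" := (sh_act A x)
  (at level 40, left associativity) : shadow_scope.
Notation "A ·^-1 x" := (sh_actV A x)
  (at level 40, left associativity) : shadow_scope.

Inductive generator := GenV | GenT | GenS | GenR.

Section AlgebraRelations.

Local Open Scope shadow_scope.

Variables (X : virtual_birack) (S : shadow X) (M : zmodType).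
Variable act : generator -> S -> X -> X -> M -> M.

Let v := act GenV.
Let t := act GenT.
Let s := act GenS.
Let r := act GenR.

Definition kink_factor (A : S) (x : X) (m : M) : M :=
  let a := kink_alpha x in
  t (A ·^-1 a) x a (r (A ·^-1 a) x a m) + s (A ·^-1 a) x a m.

(* Each generator of the ideal, as an operator on M, is zero. *)
Definition virtual_relations : Prop := forall A x y z m,
  [/\ v A (vup y x) (vdn x y) m - v A x y m = 0,
      v (A · vdn y z) x (vup z y) (v A y z m)
        - v (A · vdn (vdn x y) z) (vup y x) (vup z (vdn x y))
            (v A (vdn x y) z m) = 0,
      v (A · vdn (vdn x y) z) (vup y x) (vup z (vdn x y))
          (v A (vdn x (vup z y)) (vdn y z) m)
        - v (A · z) x y (v A y z m) = 0 &
      v (A · z) x y (v A (vdn x y) z m)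
        - v (A · vdn y z) x (vup z y)
            (v A (vdn x (vup z y)) (vdn y z) m) = 0].

Definition mixed_relations : Prop := forall A x y z m,
  [/\ v (A · dn y z) x (up z y) (v A (vdn x (up z y)) (dn y z) m)
        - v (A · z) x y (v A (vdn x y) z m) = 0,
      v A (vdn x (up z y)) (dn y z) (r A y z m)
        - r (A · vdn (vdn x y) z) (vup y x) (vup z (vdn x y))
            (v (A · z) x y m) = 0,
      v (A · dn y z) x (up z y) (t A y z m)
        - t (A · vdn (vdn x y) z) (vup y x) (vup z (vdn x y))
            (v A (vdn x y) z m) = 0 &
      v (A · dn y z) x (up z y) (s A y z m)
        - s (A · vdn (vdn x y) z) (vup y x) (vup z (vdn x y))
            (v (A · z) x y m) = 0].

Definition classical_relations : Prop := forall A x y z m,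
  [/\ r A (dn x (up z y)) (dn y z) (r (A · dn y z) x (up z y) m)
        - r A (dn x y) z (r (A · z) x y m) = 0,
      t A (dn x (up z y)) (dn y z) (r A y z m)
        - r (A · dn (dn x y) z) (up y x) (up z (dn x y))
            (t (A · z) x y m) = 0 &
      s A (dn x (up z y)) (dn y z) (r (A · dn y z) x (up z y) m)
        - r (A · dn (dn x y) z) (up y x) (up z (dn x y))
            (s (A · z) x y m) = 0] /\
  [/\ t (A · dn y z) x (up z y) (t A y z m)
        - t (A · dn (dn x y) z) (up y x) (up z (dn x y))
            (t A (dn x y) z m) = 0,
      t (A · dn y z) x (up z y) (s A y z m)
        - s (A · dn (dn x y) z) (up y x) (up z (dn x y))
            (t (A · z) x y m) = 0 &
      s (A · dn y z) x (up z y) m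
        - t (A · dn (dn x y) z) (up y x) (up z (dn x y))
            (s A (dn x y) z (r (A · z) x y m))
        - s (A · dn (dn x y) z) (up y x) (up z (dn x y))
            (s (A · z) x y m) = 0].

Definition kink_relation : Prop := forall A x m,
  m - foldr (fun k => kink_factor A (iter k (@kink_map X) x)) m
            (iota 0 (birack_rank X)) = 0.

End AlgebraRelations.

Record shadow_module (X : virtual_birack) (S : shadow X) := ShadowModule {
  sm_car :> zmodType;
  sm_act : generator -> S -> X -> X -> sm_car -> sm_car;
  sm_act_additive : forall o A x y, zmod_morphism (sm_act o A x y);
  sm_act_comm : forall o A x y o' A' x' y' m,
    sm_act o A x y (sm_act o' A' x' y' m)
    = sm_act o' A' x' y' (sm_act o A x y m);
  sm_v_bij : forall A x y, bijective (sm_act GenV A x y);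
  sm_t_bij : forall A x y, bijective (sm_act GenT A x y);
  sm_r_bij : forall A x y, bijective (sm_act GenR A x y);
  sm_virtual : virtual_relations sm_act;
  sm_mixed : mixed_relations sm_act;
  sm_classical : classical_relations sm_act;
  sm_kink : kink_relation sm_act }.

Definition module_iso (X : virtual_birack) (S : shadow X)
    (M M' : shadow_module S) : Prop :=
  exists phi : M -> M', [/\ bijective phi, zmod_morphism phi &
    forall o A x y m, phi (sm_act o A x y m) = sm_act o A x y (phi m)].

(* A multiset of isomorphism classes of modules, as its multiplicity
   function; [card_module] is 0 on infinite modules. *)
Definition module_multiset (X : virtual_birack) (S : shadow X) :=
  shadow_module S -> nat.

Definition card_module (X : virtual_birack) (S : shadow X)
  (M : shadow_module S) : nat := #|` fset_set [set: M]%classic|%fset.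

(* Plane diagrams are presented by generic height functions.  Reading upwards,
   the diagram is a sequence of slices, each containing a single event at some
   position i (i strands pass to its left): a local minimum, a local maximum,
   or a double point of strands i and i.+1.  A minimum records the direction
   of its left branch ([true] is upward) and the number of its component. *)

(* [OverLR]: the strand from lower left to upper right is the over strand,
   whatever the directions of the strands; [OverRL]: the other one is. *)
Inductive double_point := OverLR | OverRL | Virtual.

Definition mirror (k : double_point) : double_point :=
  match k with OverLR => OverRL | OverRL => OverLR | Virtual => Virtual end.

Definition is_virtual (k : double_point) : bool :=
  if k is Virtual then true else false.

Inductive event (c : nat) :=
  Min of bool & 'I_c | Max | Cross of double_point.

Arguments Max {c}.
Arguments Cross {c}.

Definition slice (c : nat) : Type := nat * event c.
Definition word (c : nat) : Type := seq (slice c).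
Definition strand_row (c : nat) : Type := seq (bool * 'I_c).

Definition fits c (R : strand_row c) (e : slice c) : bool :=
  match e.2, drop e.1 R with
  | Min _ _, _ => (e.1 <= size R)%N
  | Max, (b, k) :: (b', k') :: _ => (b' == ~~ b) && (k' == k)
  | Cross _, _ :: _ :: _ => true
  | _, _ => false
  end.

Definition after c (R : strand_row c) (e : slice c) : strand_row c :=
  take e.1 R ++
  match e.2, drop e.1 R with
  | Min b k, R' => [:: (b, k), (~~ b, k) & R']
  | Max, _ :: _ :: R' => R'
  | Cross _, p :: q :: R' => [:: q, p & R']
  | _, R' => R'
  end.

Definition row c (w : word c) (l : nat) : strand_row c :=
  foldl (@after c) [::] (take l w).

(* Points where the strands meet the levels between slices, and the gaps these
   points leave on each level. *)
Definition point c (w : word c) : finType :=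
  {l : 'I_(size w).+1 & 'I_(size (row w l))}.
Definition gap c (w : word c) : finType :=
  {l : 'I_(size w).+1 & 'I_(size (row w l)).+1}.

Definition point_at c (w : word c) (p : point w) : nat * nat :=
  (tag p : nat, tagged p : nat).
Definition gap_at c (w : word c) (a : gap w) : nat * nat :=
  (tag a : nat, tagged a : nat).

Definition strand c (w : word c) (p : point w) : bool * 'I_c :=
  tnth (in_tuple (row w (tag p))) (tagged p).

Definition arc_step c (w : word c) (p q : point w) : bool :=
  let: (l, i) := point_at p in let: (l', j) := point_at q in
  [|| (l' == l.+1) &&
      match onth w l with
      | Some (k, Min _ _) => j == (if (i < k)%N then i else i.+2)
      | Some (k, Max) => i == (if (j < k)%N then j else j.+2)
      | Some (k, Cross _) => [&& j == i, i != k & i != k.+1]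
      | None => false
      end,
      [&& l' == l, j == i.+1 &
          if onth w l is Some (k, Max) then i == k else false] |
      [&& l' == l, j == i.+1, (0 < l)%N &
          if onth w l.-1 is Some (k, Min _ _) then i == k else false]].

Definition through_step c (w : word c) (p q : point w) : bool :=
  let: (l, i) := point_at p in let: (l', j) := point_at q in
  (l' == l.+1) &&
  if onth w l is Some (k, Cross _)
  then ((i == k) && (j == k.+1)) || ((i == k.+1) && (j == k)) else false.

Definition gap_step c (w : word c) (a b : gap w) : bool :=
  let: (l, i) := gap_at a in let: (l', j) := gap_at b in
  (l' == l.+1) &&
  match onth w l with
  | Some (k, Min _ _) => ((i <= k)%N && (j == i)) || ((k <= i)%N && (j == i.+2))
  | Some (k, Max) => ((j <= k)%N && (i == j)) || ((k <= j)%N && (i == j.+2))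
  | Some (k, Cross _) => (j == i) && (i != k.+1)
  | None => false
  end.

Section Classes.

Variables (T : finType) (e : rel T).

Definition sym_step : rel T := [rel x y | e x y || e y x].

Lemma sym_step_connect : connect_sym sym_step.
Proof. by apply: sym_connect_sym => x y; apply: orbC. Qed.

(* The quotient of T by the equivalence relation generated by e. *)
Definition classes : finType := {x : T | roots sym_step x}.

Definition class_of (x : T) : classes :=
  exist _ (fingraph.root sym_step x) (roots_root sym_step_connect x).

End Classes.

Definition semiarc c (w : word c) : finType := classes (@arc_step c w).
Definition region c (w : word c) : finType := classes (@gap_step c w).

Definition arc_of c (w : word c) (p : point w) : semiarc w :=
  class_of (@arc_step c w) p.
Definition region_of c (w : word c) (a : gap w) : region w :=
  class_of (@gap_step c w) a.

Definition same_component c (w : word c) : rel (point w) :=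
  connect (sym_step (fun p q => arc_step p q || through_step p q)).

Definition link_diagram c (w : word c) : Prop :=
  [/\ forall l e, onth w l = Some e -> fits (row w l) e,
      row w (size w) = [::],
      forall k : 'I_c, exists p : point w, (strand p).2 = k &
      forall p q : point w, (strand p).2 = (strand q).2 <-> same_component p q].

(* Oriented virtual link diagrams with components numbered by 'I_c. *)
Record diagram (c : nat) := Diagram {
  slices :> word c;
  slices_ok : link_diagram slices }.

Inductive crossing_type := Positive | Negative | VirtualCrossing.

(* The type of a double point, given the directions (upward or not) of its
   strands leaving from the lower left and from the lower right. *)
Definition crossing_type_of (k : double_point) (b b' : bool) : crossing_type :=
  match k with
  | OverLR => if b == b' then Positive else Negative
  | OverRL => if b == b' then Negative else Positive
  | Virtual => VirtualCrossing
  end.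

Definition local_writhe c (k : 'I_c) (R : strand_row c) (e : slice c) : int :=
  match e.2, drop e.1 R with
  | Cross x, (b, i) :: (b', j) :: _ =>
      if (i == k) && (j == k) then
        match crossing_type_of x b b' with
        | Positive => 1
        | Negative => -1
        | VirtualCrossing => 0
        end
      else 0
  | _, _ => 0
  end.

Definition writhe c (w : word c) (k : 'I_c) : int :=
  \sum_(l < size w) local_writhe k (row w l) (tnth (in_tuple w) l).

(* Given the directions of the two strands at a double point and its corners
   bl, br, tl, tr (bottom/top, left/right), the corners ll, lr, ul, ur once
   the picture is rotated so that both strands point upward. *)
Definition rotate_upward T (b b' : bool) (bl br tl tr : T) : T * T * T * T :=
  match b, b' with
  | true, true => (bl, br, tl, tr)
  | true, false => (tl, bl, tr, br)
  | false, true => (br, tr, bl, tl)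
  | false, false => (tr, tl, br, bl)
  end.

(* Coordinates of the gap to the right of the rotated picture. *)
Definition right_of_crossing (b b' : bool) (l i : nat) : nat * nat :=
  match b, b' with
  | true, true => (l, i.+2)
  | true, false => (l, i.+1)
  | false, true => (l.+1, i.+1)
  | false, false => (l, i)
  end.

(* w has a crossing of type k which, drawn with both strands upward, has lower
   left, lower right, upper left, upper right points ll, lr, ul, ur and the
   gap A immediately to its right. *)
Definition crossing_at c (w : word c) (k : crossing_type)
    (ll lr ul ur : point w) (A : gap w) : Prop :=
  exists l i x (bl br tl tr : point w),
  let b := (strand bl).1 in let b' := (strand br).1 in
  [/\ onth w l = Some (i, Cross x),
      [/\ point_at bl = (l, i), point_at br = (l, i.+1),
          point_at tl = (l.+1, i) & point_at tr = (l.+1, i.+1)],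
      k = crossing_type_of x b b',
      (ll, lr, ul, ur) = rotate_upward b b' bl br tl tr &
      gap_at A = right_of_crossing b b' l i].

Section Moves.

Variable c : nat.
Implicit Types (i j : nat) (e : event c) (a b d : double_point).

Definition ins e : nat := if e is Min _ _ then 0 else 2.
Definition outs e : nat := if e is Max then 0 else 2.

Inductive planar_move : word c -> word c -> Prop :=
| PlanarExchange i j e e' : (i + ins e <= j)%N ->
    planar_move [:: (j, e'); (i, e)] [:: (i, e); (j - ins e + outs e, e')%N]
| PlanarZigzagL i o k :
    planar_move [:: (i.+1, Min o k); (i, Max)] [::]
| PlanarZigzagR i o k :
    planar_move [:: (i, Min o k); (i.+1, Max)] [::]
| PlanarSlideMin i o k a :
    planar_move [:: (i, Min o k); (i.+1, Cross a)]
                [:: (i.+1, Min o k); (i, Cross (mirror a))]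
| PlanarSlideMax i a :
    planar_move [:: (i.+1, Cross a); (i, Max)]
                [:: (i, Cross (mirror a)); (i.+1, Max)].

Inductive kink_move (a : double_point) : word c -> word c -> Prop :=
| KinkR i o k :
    kink_move a [:: (i.+1, Min o k); (i, Cross a); (i.+1, Max)] [::]
| KinkL i o k :
    kink_move a [:: (i, Min o k); (i.+1, Cross a); (i, Max)] [::].

(* Strands 1, 2, 3 (from the left at the bottom) cross at a (1 and 2), b (1 and
   3), d (2 and 3).  Three classical crossings must not be cyclic; a single
   virtual crossing is forbidden, and two always share an arc. *)
Definition triangle_ok a b d : bool :=
  match a, b, d with
  | OverLR, OverRL, OverLR | OverRL, OverLR, OverRL => false
  | _, _, _ =>
      (is_virtual a + is_virtual b + is_virtual d != 1)%N
  end.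

Inductive reidemeister_move : word c -> word c -> Prop :=
| MoveI a u u' : kink_move a u u' -> reidemeister_move u u'
| MoveII i a :
    reidemeister_move [:: (i, Cross a); (i, Cross (mirror a))] [::]
| MoveIII i a b d : triangle_ok a b d ->
    reidemeister_move [:: (i, Cross a); (i.+1, Cross b); (i, Cross d)]
                      [:: (i.+1, Cross d); (i, Cross b); (i.+1, Cross a)].

Definition applied (P : word c -> word c -> Prop) (D D' : diagram c) : Prop :=
  exists u v w w' : word c,
    [/\ P w w', slices D = u ++ w ++ v & slices D' = u ++ w' ++ v].

Definition numbered_isotopic : diagram c -> diagram c -> Prop :=
  clos_refl_sym_trans _ (applied (fun w w' =>
    planar_move w w' \/ reidemeister_move w w')).

Definition kink_equivalent : diagram c -> diagram c -> Prop :=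
  clos_refl_sym_trans _ (applied (fun w w' =>
    planar_move w w' \/ (exists2 a, ~~ is_virtual a & kink_move a w w'))).

End Moves.

Definition renumber_event c c' (g : 'I_c -> 'I_c') (e : event c) : event c' :=
  match e with Min o k => Min o (g k) | Max => Max | Cross a => Cross a end.

Definition renumber c c' (g : 'I_c -> 'I_c') (w : word c) : word c' :=
  [seq (e.1, renumber_event g e.2) | e <- w].

Definition virtually_isotopic c c' (D : diagram c) (D' : diagram c') : Prop :=
  exists (g : 'I_c -> 'I_c') (D1 : diagram c'),
    [/\ bijective g, slices D1 = renumber g D & numbered_isotopic D1 D'].

Section Labelings.

Local Open Scope shadow_scope.

Variables (X : virtual_birack) (S : shadow X) (c : nat) (w : word c).

Definition labeling : finType :=
  ({ffun semiarc w -> X} * {ffun region w -> S})%type.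

Implicit Type f : labeling.

Definition arc_label f (p : point w) : X := f.1 (arc_of p).
Definition region_label f (a : gap w) : S := f.2 (region_of a).

Definition birack_labeling f : Prop :=
  forall k ll lr ul ur A, @crossing_at c w k ll lr ul ur A ->
  let x := arc_label f in
  match k with
  | Positive => (x ul, x ur) = (up (x lr) (x ll), dn (x ll) (x lr))
  | Negative => (x ll, x lr) = (up (x ur) (x ul), dn (x ul) (x ur))
  | VirtualCrossing => (x ul, x ur) = (vup (x lr) (x ll), vdn (x ll) (x lr))
  end.

Definition shadow_labeling f : Prop :=
  forall (p : point w) (a b : gap w),
  gap_at a = point_at p -> gap_at b = ((point_at p).1, (point_at p).2.+1) ->
  if (strand p).1
  then region_label f a = region_label f b · arc_label f p
  else region_label f b = region_label f a · arc_label f p.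

Definition is_labeling f : bool := `[< birack_labeling f /\ shadow_labeling f >].

Variables (G : shadow_module S) (f : labeling).

(* The homomorphisms from the module of beads Z[f] to G, as assignments of
   elements of G to the semiarcs that satisfy the bead relations.  At a virtual
   crossing, d = v^-1 a is written v d = a. *)
Definition bead_relations (h : {ffun semiarc w -> G}) : Prop :=
  forall k ll lr ul ur A, @crossing_at c w k ll lr ul ur A ->
  let g p := h (arc_of p) in
  let at_ o p q := sm_act o (region_label f A) (arc_label f p) (arc_label f q) in
  match k with
  | Positive => g ul = at_ GenT ll lr (g lr) + at_ GenS ll lr (g ll)
                /\ g ur = at_ GenR ll lr (g ll)
  | Negative => g ll = at_ GenT ul ur (g ur) + at_ GenS ul ur (g ul)
                /\ g lr = at_ GenR ul ur (g ul)
  | VirtualCrossing => g ul = at_ GenV ll lr (g lr)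
                /\ at_ GenV ll lr (g ur) = g ll
  end.

Definition hom_pred : {pred {ffun semiarc w -> G}} :=
  fun h => `[< bead_relations h >].

Lemma hom_predP h : reflect (bead_relations h) (h \in hom_pred).
Proof. exact: asboolP. Qed.

Lemma sm_act0 o A x y : sm_act o A x y (0 : G) = 0.
Proof. by rewrite -{1}[0](subrr (0 : G)) sm_act_additive subrr. Qed.

Lemma hom_zmod_closed : zmod_closed hom_pred.
Proof.
split=> [|g h /hom_predP gP /hom_predP hP]; apply/hom_predP.
  by move=> k ll lr ul ur A _; case: k => /=; rewrite !ffunE !sm_act0 ?addr0.
move=> k ll lr ul ur A crA; move: (gP _ _ _ _ _ _ crA) (hP _ _ _ _ _ _ crA).
by case: k {crA} => /= -[g1 g2] [h1 h2];
  rewrite !ffunE !sm_act_additive g1 h1 ?g2 ?h2 // opprD addrACA.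
Qed.

HB.instance Definition _ :=
  GRing.isZmodClosed.Build _ hom_pred hom_zmod_closed.

Record hom := Hom { hom_val :> {ffun semiarc w -> G}; _ : hom_val \in hom_pred }.

HB.instance Definition _ := [isSub for hom_val].
HB.instance Definition _ := [Choice of hom by <:].
HB.instance Definition _ := [SubChoice_isSubZmodule of hom by <:].

Lemma sm_actD o A x y (m n : G) :
  sm_act o A x y (m + n) = sm_act o A x y m + sm_act o A x y n.
Proof.
have actN n' : sm_act o A x y (- n' : G) = - sm_act o A x y n'.
  by rewrite -[- n']sub0r sm_act_additive sm_act0 sub0r.
by rewrite -[n in LHS]opprK sm_act_additive actN opprK.
Qed.

Lemma pointwise_hom (F : G -> G) :
    (forall m n, F (m + n) = F m + F n) ->
    (forall o A x y m, F (sm_act o A x y m) = sm_act o A x y (F m)) ->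
  forall h : hom, [ffun a => F (h a)] \in hom_pred.
Proof.
move=> FD FC [h /= /hom_predP hP]; apply/hom_predP => k ll lr ul ur A crA.
move: (hP _ _ _ _ _ _ crA).
by case: k {crA} => /= -[h1 h2]; rewrite !ffunE -!FC h1 ?h2 ?FD.
Qed.

Definition hom_act (o : generator) (A : S) (x y : X) (h : hom) : hom :=
  Hom (pointwise_hom (@sm_actD o A x y) (fun o' A' x' y' m =>
    sm_act_comm o A x y o' A' x' y' m) h).

Lemma hom_actE o A x y (h : hom) a :
  hom_act o A x y h a = sm_act o A x y (h a).
Proof. by rewrite ffunE. Qed.

Lemma hom_valB (g h : hom) a : (g - h) a = g a - h a.
Proof. by rewrite [hom_val _](raddfB (val : hom -> _)) !ffunE. Qed.

Lemma hom_valD (g h : hom) a : (g + h) a = g a + h a.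
Proof. by rewrite [hom_val _](raddfD (val : hom -> _)) !ffunE. Qed.

Lemma hom_val0 a : (0 : hom) a = 0.
Proof. by rewrite [hom_val _](raddf0 (val : hom -> _)) ffunE. Qed.

Lemma homP (g h : hom) : (forall a, g a = h a) -> g = h.
Proof. by move=> gh; apply: val_inj; apply/ffunP. Qed.

Lemma hom_act_additive o A x y : zmod_morphism (hom_act o A x y).
Proof.
by move=> g h; apply: homP => a; rewrite !(hom_actE, hom_valB) sm_act_additive.
Qed.

Lemma hom_act_comm o A x y o' A' x' y' h :
  hom_act o A x y (hom_act o' A' x' y' h)
  = hom_act o' A' x' y' (hom_act o A x y h).
Proof. by apply: homP => a; rewrite !hom_actE sm_act_comm. Qed.

Lemma hom_act_bij o A x y :
  bijective (@sm_act X S G o A x y) -> bijective (hom_act o A x y).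
Proof.
case=> F FK KF.
have FD m n : F (m + n) = F m + F n.
  by apply: (can_inj FK); rewrite KF sm_actD !KF.
have FC o' A' x' y' m : F (sm_act o' A' x' y' m) = sm_act o' A' x' y' (F m).
  by apply: (can_inj FK); rewrite KF sm_act_comm KF.
exists (fun h => Hom (pointwise_hom FD FC h)) => h; apply: homP => a.
  by rewrite /= !ffunE FK.
by rewrite hom_actE /= ffunE KF.
Qed.

Lemma hom_virtual : virtual_relations hom_act.
Proof.
move=> A x y z h; split; apply: homP => a; rewrite !(hom_valB, hom_actE, hom_val0);
  by case: (sm_virtual A x y z (h a)).
Qed.

Lemma hom_mixed : mixed_relations hom_act.
Proof.
move=> A x y z h; split; apply: homP => a; rewrite !(hom_valB, hom_actE, hom_val0);
  by case: (sm_mixed A x y z (h a)).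
Qed.

Lemma hom_classical : classical_relations hom_act.
Proof.
move=> A x y z h; split; split; apply: homP => a;
  rewrite !(hom_valB, hom_actE, hom_val0);
  by case: (sm_classical A x y z (h a)) => -[? ? ?] [].
Qed.

Lemma hom_kink_factor A x (h : hom) a :
  (kink_factor hom_act A x h : hom) a = kink_factor (@sm_act X S G) A x (h a).
Proof. by rewrite hom_valD !hom_actE. Qed.

Lemma hom_kink : kink_relation hom_act.
Proof.
move=> A x h; apply: homP => a; rewrite hom_valB hom_val0 -[RHS](sm_kink A x (h a)).
congr (_ - _); elim: (iota _ _) => // k ks IH.
by rewrite [LHS]hom_kink_factor IH.
Qed.

Definition hom_module : shadow_module S :=
  ShadowModule hom_act_additive hom_act_comm
    (fun A x y => hom_act_bij (sm_v_bij G A x y))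
    (fun A x y => hom_act_bij (sm_t_bij G A x y))
    (fun A x y => hom_act_bij (sm_r_bij G A x y))
    hom_virtual hom_mixed hom_classical hom_kink.

End Labelings.

Section Invariants.

Variables (X : virtual_birack) (S : shadow X) (c : nat).

(* (Z_N)^c, for N the birack rank; 'I_N is Z_N also when N = 1. *)
Definition writhe_vector : finType := {ffun 'I_c -> 'I_(birack_rank X)}.

(* A choice of diagrams (L, w), for every writhe vector w modulo N, obtained
   from D by adding or removing kinks. *)
Definition framings (D : diagram c) (E : writhe_vector -> diagram c) : Prop :=
  forall u : writhe_vector, kink_equivalent D (E u) /\
    forall k, (writhe (E u) k = (u k : nat) %[mod birack_rank X])%Z.

Variable G : shadow_module S.

Definition shadow_module_multiset (E : writhe_vector -> diagram c) :
    module_multiset S := fun M =>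
  (\sum_(u : writhe_vector)
     #|[pred f : labeling S (E u) |
         is_labeling f && `[< module_iso (hom_module G f) M >]]|)%N.

Definition shadow_module_polynomial (E : writhe_vector -> diagram c) :
    {poly int} :=
  \sum_(u : writhe_vector) \sum_(f : labeling S (E u) | is_labeling f)
    'X^(card_module (hom_module G f)).

End Invariants.

(* Main.v *)
From HB Require Import structures.
From Stdlib Require Import Relations.
From mathcomp Require Import all_boot all_order all_algebra.
From mathcomp Require Import zify ring.
From mathcomp Require Import finmap boolp classical_sets functions cardinality.
Require Import Defs.

(** Cut a diagram along horizontal levels.  A labeling with beads puts on every
    strand that a level meets the region on its right, a label and a bead, and the
    conditions at the crossings become relations between consecutive levels.  In
    this way a diagram turns into a word of elementary pieces, and its labelings
    with beads turn into the chains of states along this word that begin and end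
    with the empty state ([reads_ex], [reads_closed_chain], [closed_chain_reads]).

    If two words relate the same states, and if their chains are determined by the
    two end states, then replacing the one by the other inside a longer word gives
    a bijection between closed chains ([equi_local]).  This bijection does not mix
    the beads with the labels under them, and it commutes with all operations on
    beads that are compatible with the algebra, among which are subtraction and
    the action of the generators.  So it matches the labelings of two diagrams,
    and for matched labelings it is an isomorphism between the modules of
    homomorphisms ([matched_iso]).  As both invariants are determined by the
    number of labelings whose module has a given isomorphism-invariant property,
    they agree as soon as the words of the two diagrams are related by such
    replacements ([count_eq]).

    The planar moves and the second and third Reidemeister moves are replacements
    of this kind.  For upward strands and a few crossing types, the third move is
    what the axioms of biracks and shadows and the relations of the algebra say
    ([braid_positive], [braid_virtual], [braid_mixed]).  All other types and
    directions follow ([braid_all]): moving a crossing to the other side of the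
    equation, or reversing a strand, amounts to solving the same equation for
    other unknowns, and the sideways maps make this possible.

    A kink is not trivial; it changes its strand by the kink map.  To compare
    diagrams with different writhes, words may contain marks, which act on a
    strand as a positive kink.  The third move, applied to the loop of a kink,
    lets marks slide through all crossings, and N marks cancel, on labels by the
    definition of the rank N and on beads by the last relation of the algebra.
    Hence only the number of marks on each component modulo N matters
    ([marks_by_component]), and all moves preserve closed chains once the number
    of marks plus the writhe of each component is kept modulo N ([equi_move]).
    Two framings with the same writhes modulo N need no marks at all
    ([isotopic_framings_equi]). *)

Set Implicit Arguments.
Unset Strict Implicit.
Unset Printing Implicit Defensive.

Import Order.TTheory GRing.Theory Num.Theory.

(** * Labels around a crossing *)

Local Open Scope ring_scope.
Local Open Scope shadow_scope.

Section Sideways.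

Variable X : virtual_birack.

Lemma vbSE x y : vbS (@up X y x, x) = (dn x y, y).
Proof. by have [_ ->] := vbS_sideways X. Qed.

Lemma vbvSE x y : vbvS (@vup X y x, x) = (vdn x y, y).
Proof. by have [_ ->] := vbvS_sideways X. Qed.

Lemma up_inj x : injective (fun y => @up X y x).
Proof. by move=> y y' /= e; have := vbSE x y; rewrite e vbSE => -[]. Qed.

Lemma dn_inj y : injective (fun x => @dn X x y).
Proof.
have [/bij_inj inj _ _] := vbS_sideways X.
by move=> x x' /= e; have := vbSE x y; rewrite e -vbSE => /inj[].
Qed.

Lemma vup_inj x : injective (fun y => @vup X y x).
Proof. by move=> y y' /= e; have := vbvSE x y; rewrite e vbvSE => -[]. Qed.

Lemma vdn_inj y : injective (fun x => @vdn X x y).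
Proof.
have [/bij_inj inj _ _] := vbvS_sideways X.
by move=> x x' /= e; have := vbvSE x y; rewrite e -vbvSE => /inj[].
Qed.

Lemma vup_vdn x y : vup (@vdn X x y) (vup y x) = x /\ vdn (@vup X y x) (vdn x y) = y.
Proof.
have := vbV_invol (x, y); rewrite /vup /vdn.
by case: (vbV (x, y)) => a b /= ->.
Qed.

(** The strand that loops back to the right of its own crossing carries the
    label kink_alpha x inside the loop. *)
Lemma dn_kink_alpha x : @dn X x (kink_alpha x) = kink_alpha x /\
  up (kink_alpha x) x = kink_map x.
Proof.
have [/bij_inj inj _ _] := vbS_sideways X.
have /bij_inj i2 := vbSV_diag2 X.
set y := kink_alpha x.
have e2 : (finv (@vbS X) (y, y)).2 = x by rewrite [LHS](f_finv i2).
have e1 : (finv (@vbS X) (y, y)).1 = kink_map x by [].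
have eS : vbS (kink_map x, x) = (y, y).
  by rewrite -[RHS](f_finv inj); congr vbS; rewrite [RHS]surjective_pairing e2.
have [z ez] : exists z, up z x = kink_map x.
  by exists (finv (fun y => up y x) (kink_map x)); rewrite [LHS](f_finv (@up_inj x)).
by move: eS; rewrite -ez vbSE => -[e3 e4]; split; rewrite -e4 // e3.
Qed.

Lemma kink_alpha_uniq x y : @dn X x y = y -> y = kink_alpha x.
Proof.
have [/bij_inj inj _ _] := vbS_sideways X.
have /bij_inj i2 := vbSV_diag2 X.
move=> e; have eS := vbSE x y; rewrite e in eS.
have eF : finv (@vbS X) (y, y) = (up y x, x) by rewrite -eS finv_f.
by rewrite -[LHS](finv_f i2) eF.
Qed.

(** The virtual sideways map sends the diagonal to itself, bijectively because
    X is finite. So a virtual kink returns the label that entered it. *)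
Lemma virtual_kink x :
  exists y, [/\ @vdn X x y = y, vup y x = x & forall z, vdn x z = z -> z = y].
Proof.
have [/bij_inj inj _ _] := vbvS_sideways X.
(* The virtual sideways map sends (z, z) to (del z, del z). *)
pose del z := (@vbvS X (z, z)).1.
have delE z : @vbvS X (z, z) = (del z, del z).
  by rewrite {2}/del vbvS_diag /del; case: (vbvS _).
have del_inj : injective del by move=> z z' e; have := delE z; rewrite e -delE => /inj[].
have key z : vdn x z = z -> vup z x = x /\ z = del x.
  move=> e; have := vbvSE x z; rewrite e -[z in RHS](f_finv del_inj) -delE => /inj[e1 e2].
  by rewrite e1 -e2; split=> //; rewrite e2 f_finv.
have [y ey] : exists y, vup y x = x.
  by exists (finv (fun y => vup y x) x); rewrite [LHS](f_finv (@vup_inj x)).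
have := vbvSE x y; rewrite ey delE => -[e1 e2].
by exists y; split=> // [|z /key[_ ->]] //; rewrite -e1 e2.
Qed.

Lemma virtual_kink_left p q q' : @vup X p q = q -> vdn q p = q' -> q' = p.
Proof.
move=> e <-; have := vbvSE q p; rewrite e => eS.
by have := vbvS_diag q; rewrite eS.
Qed.

Lemma virtual_kink_left_ex p : exists2 q, @vup X p q = q & vdn q p = p.
Proof.
have [/bij_inj inj _ _] := vbvS_sideways X.
have [y ey] : exists y, vdn y p = p.
  by exists (finv (fun y => vdn y p) p); rewrite [LHS](f_finv (@vdn_inj p)).
have [z [e1 e2 u]] := virtual_kink y; have ez := u _ ey.
by exists y => //; rewrite ez.
Qed.

Lemma up_braid x y z :
  [/\ up (up z (@dn X x y)) (up y x) = up (up z y) x,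
      dn (up y x) (up z (dn x y)) = up (dn y z) (dn x (up z y))
    & dn (dn x y) z = dn (dn x (up z y)) (dn y z)].
Proof.
have := vbB_braid (x, y, z); rewrite /on_left /on_right /= => -[h l3].
by split; [have := congr1 fst h | have := congr1 snd h |].
Qed.

Lemma vup_braid x y z :
  [/\ vup (vup z (@vdn X x y)) (vup y x) = vup (vup z y) x,
      vdn (vup y x) (vup z (vdn x y)) = vup (vdn y z) (vdn x (vup z y))
    & vdn (vdn x y) z = vdn (vdn x (vup z y)) (vdn y z)].
Proof.
have := vbV_braid (x, y, z); rewrite /on_left /on_right /= => -[h l3].
by split; [have := congr1 fst h | have := congr1 snd h |].
Qed.

Lemma mixed_braid x y z :
  [/\ up (vup z (@vdn X x y)) (vup y x) = vup (up z y) x,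
      dn (vup y x) (vup z (vdn x y)) = vup (dn y z) (vdn x (up z y))
    & vdn (vdn x y) z = vdn (vdn x (up z y)) (dn y z)].
Proof.
have := vbBV_mixed (x, y, z); rewrite /on_left /on_right /= => -[h l3].
by split; [have := congr1 fst h | have := congr1 snd h |].
Qed.

End Sideways.

(** * Crossings of upward strands *)

Section Edges.

Variables (X : virtual_birack) (S : shadow X) (G : shadow_module S).

(** The region on the left of a strand is determined by the one on its right.
    As the region is recorded on the right of the strand itself, and not on the
    right of the page, turning a picture upside down does not change the data
    of its strands. *)
Definition edge : Type := (S * X * G)%type.
Implicit Types e f : edge.

Definition right_region e : S := let: (A, _, _) := e in A.
Definition edge_label e : X := let: (_, x, _) := e in x.
Definition bead e : G := let: (_, _, g) := e in g.
Definition left_region e : S := right_region e · edge_label e.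

#[local] Arguments right_region !e /.
#[local] Arguments edge_label !e /.
#[local] Arguments bead !e /.

Local Notation act o A x y := (@sm_act X S G o A x y).

Lemma act_inj A : injective (fun C : S => C · A).
Proof. by apply/bij_inj/sh_act_bij. Qed.

Lemma sm_actVK (A : S) (x : X) : (A ·^-1 x) · x = A.
Proof. by rewrite [LHS](f_finv (@act_inj x)). Qed.

Lemma sm_v_inj A x y : injective (act GenV A x y).
Proof. exact/bij_inj/sm_v_bij. Qed.
Lemma sm_t_inj A x y : injective (act GenT A x y).
Proof. exact/bij_inj/sm_t_bij. Qed.
Lemma sm_r_inj A x y : injective (act GenR A x y).
Proof. exact/bij_inj/sm_r_bij. Qed.
Lemma sm_v_surj A x y g : exists g', act GenV A x y g' = g.
Proof. by have [k _ kK] := sm_v_bij G A x y; exists (k g). Qed.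
Lemma sm_t_surj A x y g : exists g', act GenT A x y g' = g.
Proof. by have [k _ kK] := sm_t_bij G A x y; exists (k g). Qed.
Lemma sm_r_surj A x y g : exists g', act GenR A x y g' = g.
Proof. by have [k _ kK] := sm_r_bij G A x y; exists (k g). Qed.

(** The corners of a crossing of two upward strands are listed in the order
    bottom left, bottom right, top left, top right. *)
Definition positive_crossing e1 e2 e3 e4 : Prop :=
  let A := right_region e2 in let x := edge_label e1 in let y := edge_label e2 in
  [/\ [/\ right_region e1 = left_region e2, right_region e4 = A
         & right_region e3 = left_region e4],
      edge_label e3 = up y x /\ edge_label e4 = dn x y &
      bead e3 = act GenT A x y (bead e2) + act GenS A x y (bead e1)
      /\ bead e4 = act GenR A x y (bead e1)].

(** The bead relation d = v^-1 a is stated without the inverse. *)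
Definition virtual_crossing e1 e2 e3 e4 : Prop :=
  let A := right_region e2 in let x := edge_label e1 in let y := edge_label e2 in
  [/\ [/\ right_region e1 = left_region e2, right_region e4 = A
         & right_region e3 = left_region e4],
      edge_label e3 = vup y x /\ edge_label e4 = vdn x y &
      bead e3 = act GenV A x y (bead e2)
      /\ act GenV A x y (bead e4) = bead e1].

(** The conditions at a negative crossing are those at a positive one read from
    the top to the bottom. *)
Definition upward_crossing d e1 e2 e3 e4 : Prop :=
  match d with
  | OverLR => positive_crossing e1 e2 e3 e4
  | OverRL => positive_crossing e3 e4 e1 e2
  | Virtual => virtual_crossing e1 e2 e3 e4
  end.

Local Notation T := upward_crossing.

Lemma positive_left e1 e2 e3 e4 :
  positive_crossing e1 e2 e3 e4 -> left_region e1 = left_region e3.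
Proof.
move: e1 e2 e3 e4 => [[A1 x1] g1] [[A2 x2] g2] [[A3 x3] g3] [[A4 x4] g4] /=.
rewrite /positive_crossing /left_region /= => -[[-> -> ->] [-> ->] _].
by rewrite sh_act_B.
Qed.

Lemma virtual_left e1 e2 e3 e4 :
  virtual_crossing e1 e2 e3 e4 -> left_region e1 = left_region e3.
Proof.
move: e1 e2 e3 e4 => [[A1 x1] g1] [[A2 x2] g2] [[A3 x3] g3] [[A4 x4] g4] /=.
rewrite /virtual_crossing /left_region /= => -[[-> -> ->] [-> ->] _].
by rewrite sh_act_V.
Qed.

Lemma virtual_crossingC e1 e2 e3 e4 :
  virtual_crossing e1 e2 e3 e4 -> virtual_crossing e3 e4 e1 e2.
Proof.
move: e1 e2 e3 e4 => [[A1 x1] g1] [[A2 x2] g2] [[A3 x3] g3] [[A4 x4] g4] /=.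
rewrite /virtual_crossing /left_region /= => -[[-> -> ->] [-> ->] [-> e]].
have [ex ey] := vup_vdn x1 x2.
have ev A m : act GenV A (vup x2 x1) (vdn x1 x2) m = act GenV A x1 x2 m.
  by have [/eqP + _ _ _] := sm_virtual A x1 x2 x1 m; rewrite subr_eq0 => /eqP.
by rewrite !ev e ex ey.
Qed.

Lemma crossing_regions d e1 e2 e3 e4 : T d e1 e2 e3 e4 ->
  [/\ right_region e1 = left_region e2, right_region e3 = left_region e4,
      left_region e1 = left_region e3 & right_region e2 = right_region e4].
Proof.
case: d => /= c; last 1 first.
- by have := virtual_left c; case: c => -[-> -> ->].
- by have := positive_left c; case: c => -[-> -> ->].
- by have := positive_left c; case: c => -[-> -> ->].
Qed.

Lemma crossing_mirror d e1 e2 e3 e4 :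
  T (mirror d) e3 e4 e1 e2 <-> T d e1 e2 e3 e4.
Proof. by case: d => //=; split; apply: virtual_crossingC. Qed.

Lemma edge_ext e f : right_region e = right_region f ->
  edge_label e = edge_label f -> bead e = bead f -> e = f.
Proof.
by case: e f => [[A x] g] [[B y] h]; rewrite /right_region /edge_label /bead /= => -> -> ->.
Qed.

(** For a negative crossing this needs the inverses of the birack map and of
    the actions of t and r. *)
Lemma crossing_up d e1 e2 : right_region e1 = left_region e2 ->
  exists e3 e4, T d e1 e2 e3 e4.
Proof.
move: e1 e2 => [[A1 x1] g1] [[A x2] g2]; rewrite /left_region /= => ->.
case: d => /=.
- exists (A · dn x1 x2, up x2 x1, act GenT A x1 x2 g2 + act GenS A x1 x2 g1).
  by exists (A, dn x1 x2, act GenR A x1 x2 g1).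
- have [k _ kK] := vbB_bij X; case ek: (k (x1, x2)) => [x3 x4].
  have eB : vbB (x3, x4) = (x1, x2) by rewrite -ek kK.
  have [g3 e3] := sm_r_surj A x3 x4 g2.
  have [g4 e4] := sm_t_surj A x3 x4 (g1 - act GenS A x3 x4 g3).
  exists (A · x4, x3, g3), (A, x4, g4).
  rewrite /positive_crossing /left_region /right_region /edge_label /bead /=.
  by rewrite /up /dn eB e3 e4 subrK.
- have [g4 e4] := sm_v_surj A x1 x2 g1.
  by exists (A · vdn x1 x2, vup x2 x1, act GenV A x1 x2 g2), (A, vdn x1 x2, g4).
Qed.

Lemma crossing_fun d e1 e2 e3 e4 f3 f4 :
  T d e1 e2 e3 e4 -> T d e1 e2 f3 f4 -> e3 = f3 /\ e4 = f4.
Proof.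
case: d => /=.
- case=> -[a1 a2 a3] [b1 b2] [c1 c2] [[a1' a2' a3'] [b1' b2'] [c1' c2']].
  have e : e4 = f4 by apply: edge_ext; congruence.
  by split=> //; subst f4; apply: edge_ext; congruence.
- case=> -[a1 a2 a3] [b1 b2] [c1 c2] [[a1' a2' a3'] [b1' b2'] [c1' c2']].
  have eA : right_region e4 = right_region f4 by congruence.
  have [ex ey] : edge_label e3 = edge_label f3 /\ edge_label e4 = edge_label f4.
    have /bij_inj inj := vbB_bij X.
    suff /inj[-> ->] : vbB (edge_label e3, edge_label e4)
                       = vbB (edge_label f3, edge_label f4) by [].
    move: b1 b2 b1' b2'; rewrite /up /dn.
    by case: (vbB _) => [? ?]; case: (vbB _) => [? ?] /= -> -> -> ->.
  have eg3 : bead e3 = bead f3.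
    by rewrite eA ex ey in c2; apply: (sm_r_inj (etrans (esym c2) c2')).
  have eg4 : bead e4 = bead f4.
    by rewrite eA ex ey eg3 c1' in c1; have /addIr/sm_t_inj := c1.
  have e : e4 = f4 by apply: edge_ext.
  by split=> //; subst f4; apply: edge_ext; congruence.
- case=> -[a1 a2 a3] [b1 b2] [c1 c2] [[a1' a2' a3'] [b1' b2'] [c1' c2']].
  have e : e4 = f4.
    apply: edge_ext; try congruence.
    by have := etrans c2 (esym c2') => /sm_v_inj.
  by split=> //; subst f4; apply: edge_ext; congruence.
Qed.

Lemma crossing_inj d e1 e2 e3 e4 f1 f2 :
  T d e1 e2 e3 e4 -> T d f1 f2 e3 e4 -> e1 = f1 /\ e2 = f2.
Proof. by move=> /crossing_mirror a /crossing_mirror; apply: crossing_fun. Qed.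

Lemma crossing_down d e3 e4 : right_region e3 = left_region e4 ->
  exists e1 e2, T d e1 e2 e3 e4.
Proof.
by move=> /(crossing_up (mirror d))[e1 [e2 /crossing_mirror c]]; exists e1, e2.
Qed.

Lemma inj_surj (Y : finType) (k : Y -> Y) y : injective k -> exists z, k z = y.
Proof. by move=> inj; exists (finv k y); rewrite f_finv. Qed.

(** Sideways invertibility: a crossing can be solved from its two left corners,
    and from its two right ones in the next lemma. This is what a reversed
    strand needs. *)
Lemma crossing_left d e1 e3 : left_region e1 = left_region e3 ->
  exists e2 e4, T d e1 e2 e3 e4.
Proof.
have pos f1 f3 : left_region f1 = left_region f3 ->
    exists f2 f4, positive_crossing f1 f2 f3 f4.
  move: f1 f3 => [[A1 x1] g1] [[A3 x3] g3]; rewrite /left_region /= => eL.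
  have [x2 ex] := inj_surj x3 (@up_inj X x1).
  pose A := A1 ·^-1 x2; have eA : A · x2 = A1 := sm_actVK A1 x2.
  have [g2 eg] := sm_t_surj A x1 x2 (g3 - act GenS A x1 x2 g1).
  exists (A, x2, g2), (A, dn x1 x2, act GenR A x1 x2 g1).
  rewrite /positive_crossing /left_region /right_region /edge_label /bead /=.
  rewrite eg subrK eA ex; split=> //; split=> //.
  by apply: (@act_inj x3); rewrite -eL -ex sh_act_B eA.
case: d => /= [/pos //|/esym /pos[f2 [f4 c]]|]; first by exists f4, f2.
move: e1 e3 => [[A1 x1] g1] [[A3 x3] g3]; rewrite /left_region /= => eL.
have [x2 ex] := inj_surj x3 (@vup_inj X x1).
pose A := A1 ·^-1 x2; have eA : A · x2 = A1 := sm_actVK A1 x2.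
have [g2 eg] := sm_v_surj A x1 x2 g3; have [g4 eg4] := sm_v_surj A x1 x2 g1.
exists (A, x2, g2), (A, vdn x1 x2, g4).
rewrite /virtual_crossing /left_region /right_region /edge_label /bead /=.
rewrite eg eg4 eA ex; split=> //; split=> //.
by apply: (@act_inj x3); rewrite -eL -ex sh_act_V eA.
Qed.

Lemma crossing_right d e2 e4 : right_region e2 = right_region e4 ->
  exists e1 e3, T d e1 e2 e3 e4.
Proof.
have pos f2 f4 : right_region f2 = right_region f4 ->
    exists f1 f3, positive_crossing f1 f2 f3 f4.
  move: f2 f4 => [[A x2] g2] [[A4 x4] g4]; rewrite /= => <- {A4}.
  have [x1 ex] := inj_surj x4 (@dn_inj X x2).
  have [g1 eg] := sm_r_surj A x1 x2 g4.
  exists (A · x2, x1, g1), (A · x4, up x2 x1, act GenT A x1 x2 g2 + act GenS A x1 x2 g1).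
  rewrite /positive_crossing /left_region /right_region /edge_label /bead /=.
  by rewrite ex eg.
case: d => /= [/pos //|/esym /pos[f2 [f4 c]]|]; first by exists f4, f2.
move: e2 e4 => [[A x2] g2] [[A4 x4] g4]; rewrite /= => <- {A4}.
have [x1 ex] := inj_surj x4 (@vdn_inj X x2).
exists (A · x2, x1, act GenV A x1 x2 g4), (A · x4, vup x2 x1, act GenV A x1 x2 g2).
rewrite /virtual_crossing /left_region /right_region /edge_label /bead /=.
by rewrite ex.
Qed.

Lemma crossing_left_uniq d e1 e2 e3 e4 f2 f4 :
  T d e1 e2 e3 e4 -> T d e1 f2 e3 f4 -> e2 = f2 /\ e4 = f4.
Proof.
have pos p1 p2 p3 p4 q2 q4 : positive_crossing p1 p2 p3 p4 ->
    positive_crossing p1 q2 p3 q4 -> p2 = q2 /\ p4 = q4.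
  case=> -[a1 a2 a3] [b1 b2] [c1 c2] [[a1' a2' a3'] [b1' b2'] [c1' c2']].
  have ex : edge_label p2 = edge_label q2 := up_inj (etrans (esym b1) b1').
  have eA : right_region p2 = right_region q2.
    apply: (@act_inj (edge_label p2)) => /=.
    by rewrite -[LHS]a1 a1' /left_region ex.
  have ep : p2 = q2.
    apply: edge_ext => //; rewrite c1 eA ex in c1'.
    by have /addIr/sm_t_inj := c1'.
  by split=> //; subst q2; apply: edge_ext; congruence.
case: d => /=; [exact: pos | by move=> /pos H /H[-> ->]|].
case=> -[a1 a2 a3] [b1 b2] [c1 c2] [[a1' a2' a3'] [b1' b2'] [c1' c2']].
have ex : edge_label e2 = edge_label f2 := vup_inj (etrans (esym b1) b1').
have eA : right_region e2 = right_region f2.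
  apply: (@act_inj (edge_label e2)) => /=.
  by rewrite -[LHS]a1 a1' /left_region ex.
have e : e2 = f2.
  by apply: edge_ext => //; rewrite c1 eA ex in c1'; move: c1' => /sm_v_inj.
split=> //; subst f2; apply: edge_ext; try congruence.
by move: (etrans c2 (esym c2')) => /sm_v_inj.
Qed.

Lemma crossing_right_uniq d e1 e2 e3 e4 f1 f3 :
  T d e1 e2 e3 e4 -> T d f1 e2 f3 e4 -> e1 = f1 /\ e3 = f3.
Proof.
have pos p1 p2 p3 p4 q1 q3 : positive_crossing p1 p2 p3 p4 ->
    positive_crossing q1 p2 q3 p4 -> p1 = q1 /\ p3 = q3.
  case=> -[a1 a2 a3] [b1 b2] [c1 c2] [[a1' a2' a3'] [b1' b2'] [c1' c2']].
  have ex : edge_label p1 = edge_label q1 := dn_inj (etrans (esym b2) b2').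
  have e1' : p1 = q1.
    apply: edge_ext => //; first by congruence.
    by rewrite c2 ex in c2'; move: c2' => /sm_r_inj.
  by split=> //; subst q1; apply: edge_ext; congruence.
case: d => /=; [exact: pos | by move=> /pos H /H[-> ->]|].
case=> -[a1 a2 a3] [b1 b2] [c1 c2] [[a1' a2' a3'] [b1' b2'] [c1' c2']].
have ex : edge_label e1 = edge_label f1 := vdn_inj (etrans (esym b2) b2').
have e : e1 = f1 by apply: edge_ext; congruence.
by split=> //; subst f1; apply: edge_ext; congruence.
Qed.

End Edges.

Arguments right_region {X S G} !e /.
Arguments edge_label {X S G} !e /.
Arguments bead {X S G} !e /.

(** * Strands of arbitrary directions and the braid relations *)

Section Crossings.

Variables (X : virtual_birack) (S : shadow X) (G : shadow_module S).
Local Notation edge := (edge G).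
Implicit Types e f : edge.
Local Notation act o A x y := (@sm_act X S G o A x y).

(** Reversing the first strand of a crossing exchanges the roles of the two
    ends of the second strand, and conversely: this is what rotating the
    picture until both strands point upward amounts to. *)
Definition crossing (d : double_point) (b b' : bool) e1 e2 e3 e4 : Prop :=
  let: (f2, f3) := if b then (e2, e3) else (e3, e2) in
  let: (f1, f4) := if b' then (e1, e4) else (e4, e1) in
  upward_crossing d f1 f2 f3 f4.

(** The regions on the left and on the right of the page, for a strand of
    either direction. *)
Definition page_left (b : bool) e : S :=
  if b then left_region e else right_region e.
Definition page_right (b : bool) e : S :=
  if b then right_region e else left_region e.

Lemma page_left_neg b e : page_left (~~ b) e = page_right b e.
Proof. by case: b. Qed.

Lemma page_right_neg b e : page_right (~~ b) e = page_left b e.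
Proof. by case: b. Qed.

Lemma crossing_pages d b b' e1 e2 e3 e4 : crossing d b b' e1 e2 e3 e4 ->
  [/\ page_right b e1 = page_left b' e2, page_right b' e3 = page_left b e4,
      page_left b e1 = page_left b' e3 & page_right b' e2 = page_right b e4].
Proof. by case: b; case: b' => /= /crossing_regions[]. Qed.

Lemma crossing_turn d b b' e1 e2 e3 e4 :
  crossing (mirror d) b' b e3 e4 e1 e2 <-> crossing d b b' e1 e2 e3 e4.
Proof. by case: b; case: b'; apply: crossing_mirror. Qed.

(** A crossing turned clockwise by a quarter. Together with [crossing_turn] it
    reduces all questions about sides of a crossing to questions about its
    bottom. *)
Lemma crossing_quarter d b b' e1 e2 e3 e4 :
  crossing (mirror d) b' (~~ b) e2 e4 e1 e3 <-> crossing d b b' e1 e2 e3 e4.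
Proof. by case: b; case: b'; apply: crossing_mirror. Qed.

Lemma crossing_ex d b b' e1 e2 : page_right b e1 = page_left b' e2 ->
  exists e3 e4, crossing d b b' e1 e2 e3 e4.
Proof.
case: b; case: b' => /= h.
- exact: crossing_up.
- by have [f [f' c]] := crossing_right d (esym h); exists f', f.
- by have [f [f' c]] := crossing_left d h; exists f, f'.
- by have [f [f' c]] := crossing_down d (esym h); exists f', f.
Qed.

Lemma crossing_det d b b' e1 e2 e3 e4 f3 f4 : crossing d b b' e1 e2 e3 e4 ->
  crossing d b b' e1 e2 f3 f4 -> e3 = f3 /\ e4 = f4.
Proof.
case: b; case: b' => /= c c'.
- exact: crossing_fun c c'.
- by have [-> ->] := crossing_right_uniq c c'.
- by have [-> ->] := crossing_left_uniq c c'.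
- by have [-> ->] := crossing_inj c c'.
Qed.

Lemma crossing_codet d b b' e1 e2 e3 e4 f1 f2 : crossing d b b' e1 e2 e3 e4 ->
  crossing d b b' f1 f2 e3 e4 -> e1 = f1 /\ e2 = f2.
Proof. by move=> /crossing_turn c /crossing_turn; apply: crossing_det. Qed.

Lemma crossing_coex d b b' e3 e4 : page_right b' e3 = page_left b e4 ->
  exists e1 e2, crossing d b b' e1 e2 e3 e4.
Proof.
by move=> /(crossing_ex (mirror d))[e1 [e2 /crossing_turn c]]; exists e1, e2.
Qed.

Lemma crossing_side d b b' e1 e3 : page_left b e1 = page_left b' e3 ->
  exists e2 e4, crossing d b b' e1 e2 e3 e4.
Proof.
rewrite -[b in page_left b e1]negbK page_left_neg => /esym h.
have [e2 [e4 c]] : exists e2 e4, crossing (mirror d) b' (~~ b) e2 e4 e1 e3.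
  by apply: crossing_coex; rewrite h.
by exists e2, e4; apply/crossing_quarter.
Qed.

Lemma crossing_side_det d b b' e1 e2 e3 e4 f2 f4 : crossing d b b' e1 e2 e3 e4 ->
  crossing d b b' e1 f2 e3 f4 -> e2 = f2 /\ e4 = f4.
Proof. by move=> /crossing_quarter c /crossing_quarter /(crossing_codet c). Qed.

(** The two sides of the third Reidemeister move: the strands, numbered from
    the left at the bottom, carry e1, e2, e3 at the bottom, and f1, f2, f3 are
    the edges at the top from the left; a, b, d are the crossings of strands 1
    and 2, 1 and 3, 2 and 3. *)
Definition left_triangle a b d t1 t2 t3 e1 e2 e3 f1 f2 f3 : Prop :=
  exists m n k, [/\ crossing a t1 t2 e1 e2 m n, crossing b t1 t3 n e3 k f3
                  & crossing d t2 t3 m k f1 f2].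

Definition right_triangle a b d t1 t2 t3 e1 e2 e3 f1 f2 f3 : Prop :=
  exists m n k, [/\ crossing d t2 t3 e2 e3 m n, crossing b t1 t3 e1 m f1 k
                  & crossing a t1 t2 k n f2 f3].

Definition braid a b d t1 t2 t3 : Prop := forall e1 e2 e3 f1 f2 f3,
  left_triangle a b d t1 t2 t3 e1 e2 e3 f1 f2 f3 <->
  right_triangle a b d t1 t2 t3 e1 e2 e3 f1 f2 f3.

Lemma right_triangle_det a b d t1 t2 t3 e1 e2 e3 f1 f2 f3 g1 g2 g3 :
  right_triangle a b d t1 t2 t3 e1 e2 e3 f1 f2 f3 ->
  right_triangle a b d t1 t2 t3 e1 e2 e3 g1 g2 g3 ->
  [/\ f1 = g1, f2 = g2 & f3 = g3].
Proof.
move=> [m [n [k [c1 c2 c3]]]] [m' [n' [k' [c1' c2' c3']]]].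
have [em en] := crossing_det c1 c1'; subst m' n'.
have [ef ek] := crossing_det c2 c2'; subst g1 k'.
by have [-> ->] := crossing_det c3 c3'.
Qed.

(** Both sides are functions of the three edges at the bottom, so that one
    implication suffices. *)
Lemma braid_half a b d t1 t2 t3 :
  (forall e1 e2 e3 f1 f2 f3, left_triangle a b d t1 t2 t3 e1 e2 e3 f1 f2 f3 ->
     right_triangle a b d t1 t2 t3 e1 e2 e3 f1 f2 f3) ->
  braid a b d t1 t2 t3.
Proof.
move=> H e1 e2 e3 f1 f2 f3; split=> [/H //|R].
have [m [n [k [c1 c2 c3]]]] := R.
have [p1 p2 p3 p4] := crossing_pages c1; have [q1 q2 q3 q4] := crossing_pages c2.
have [m' [n' d1]] : exists m' n', crossing a t1 t2 e1 e2 m' n'.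
  by apply: crossing_ex; rewrite q1.
have [r1 r2 r3 r4] := crossing_pages d1.
have [k' [g3 d2]] : exists k' g3, crossing b t1 t3 n' e3 k' g3.
  by apply: crossing_ex; rewrite -r4.
have [s1 s2 s3 s4] := crossing_pages d2.
have [g1 [g2 d3]] : exists g1 g2, crossing d t2 t3 m' k' g1 g2.
  by apply: crossing_ex; rewrite r2.
have L : left_triangle a b d t1 t2 t3 e1 e2 e3 g1 g2 g3 by exists m', n', k'.
by have [-> -> ->] := right_triangle_det R (H _ _ _ _ _ _ L).
Qed.

(** Read as an equation between braid words, a move of type (a, b, d) may be
    multiplied by the inverse of d on both ends: this moves the crossing d to
    the other side. *)
Lemma braid_rotate a b d : braid a b d true true true ->
  braid b a (mirror d) true true true.
Proof.
move=> B; apply: braid_half => e1 e2 e3 f1 f2 f3 [m [n [k [c1 c2 c3]]]].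
have [p1 p2 p3 p4] := crossing_pages c1; have [q1 q2 q3 q4] := crossing_pages c2.
have [m' [n' d1]] : exists m' n', crossing (mirror d) true true e2 e3 m' n'.
  by apply: crossing_ex; rewrite p4.
have /B[p [q [r [x1 x2 x3]]]] : right_triangle a b d true true true e1 m' n' m k f3.
  by exists e2, e3, n; split=> //; apply/(@crossing_turn _ true true).
have [ef1 ef2] := crossing_codet x3 (iffLR (@crossing_turn _ true true _ _ _ _) c3).
by subst; exists m', n', q.
Qed.

(** The same for the crossing a. *)
Lemma braid_corotate a b d : braid a b d true true true ->
  braid (mirror a) d b true true true.
Proof.
move=> B; apply: braid_half => e1 e2 e3 f1 f2 f3 [m [n [k [c1 c2 c3]]]].
have [p1 p2 p3 p4] := crossing_pages c2; have [q1 q2 q3 q4] := crossing_pages c3.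
have [F2 [F3 d1]] : exists F2 F3, crossing a true true f2 f3 F2 F3.
  by apply: crossing_ex; rewrite -q4.
have /B[P [Q [K [x1 x2 x3]]]] : right_triangle a b d true true true m n e3 f1 F2 F3.
  by exists k, f3, f2.
have [eP eQ] := crossing_det (iffLR (@crossing_turn _ true true _ _ _ _) c1) x1.
subst; exists K, F3, F2; split=> //.
by apply/(@crossing_turn _ true true).
Qed.

(** The right side can always be computed from the bottom, so only the results
    have to be compared. *)
Lemma braid_compare a b d :
  (forall e1 e2 e3 m n k f1 f2 f3 m' n' k' g1 g2 g3,
     upward_crossing a e1 e2 m n -> upward_crossing b n e3 k f3 ->
     upward_crossing d m k f1 f2 -> upward_crossing d e2 e3 m' n' ->
     upward_crossing b e1 m' g1 k' -> upward_crossing a k' n' g2 g3 ->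
     [/\ f1 = g1, f2 = g2 & f3 = g3]) ->
  braid a b d true true true.
Proof.
move=> H; apply: braid_half => e1 e2 e3 f1 f2 f3 [m [n [k [c1 c2 c3]]]].
have [p1 p2 p3 p4] := crossing_pages c1; have [q1 q2 q3 q4] := crossing_pages c2.
have [m' [n' d1]] : exists m' n', crossing d true true e2 e3 m' n'.
  by apply: crossing_ex; rewrite p4.
have [r1 r2 r3 r4] := crossing_pages d1.
have [g1 [k' d2]] : exists g1 k', crossing b true true e1 m' g1 k'.
  by apply: crossing_ex; rewrite p1.
have [s1 s2 s3 s4] := crossing_pages d2.
have [g2 [g3 d3]] : exists g2 g3, crossing a true true k' n' g2 g3.
  by apply: crossing_ex; rewrite -s4.
by exists m', n', k'; have [-> -> ->] := H _ _ _ _ _ _ _ _ _ _ _ _ _ _ _ c1 c2 c3 d1 d2 d3.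
Qed.

(** Comparing the coefficients of the bottom beads in the three top beads gives
    the relations between t, s and r. *)
Lemma braid_positive : braid OverLR OverLR OverLR true true true.
Proof.
apply: braid_compare.
move=> [[A1 x] a] [[A2 y] b] [[A z] c] [[? ?] ?] [[? ?] ?] [[? ?] ?].
move=> [[? ?] ?] [[? ?] ?] [[? ?] ?] [[? ?] ?] [[? ?] ?] [[? ?] ?].
move=> [[? ?] ?] [[? ?] ?] [[? ?] ?].
rewrite /= /positive_crossing /left_region /=.
do 6! (move=> -[[? ? ?] [? ?] [? ?]]); subst.
have [l1 l2 l3] := up_braid x y z.
have R m := @sm_classical _ _ G A x y z m.
split; apply: edge_ext; rewrite /= -?l1 -?l2 -?l3 //.
- by rewrite l2 l3 sh_act_B.
- have [_ [/subr0_eq t1 _ _]] := R c; have [_ [_ /subr0_eq t2 _]] := R b.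
  have [_ [_ _]] := R a; rewrite -addrA -opprD => /subr0_eq t3.
  by rewrite !sm_actD t1 t2 t3 -!addrA; congr (_ + _); rewrite addrCA.
- have [[_ /subr0_eq t2 /subr0_eq t3] _] := R b.
  have [[_ _ /subr0_eq t4] _] := R a.
  by rewrite !sm_actD t2 t4.
- by have [[/subr0_eq <- _ _] _] := R a.
Qed.

Lemma braid_virtual : braid Virtual Virtual Virtual true true true.
Proof.
apply: braid_compare.
move=> [[A1 x] a] [[A2 y] b] [[A z] c] [[? ?] ?] [[? ?] ?] [[? ?] ?].
move=> [[? ?] ?] [[? ?] ?] [[? ?] ?] [[? ?] ?] [[? ?] ?] [[? ?] ?].
move=> [[? ?] ?] [[? ?] ?] [[? ?] ?].
rewrite /= /virtual_crossing /left_region /=.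
do 6! (move=> -[[? ? ?] [? ?] [? ?]]); subst.
have [l1 l2 l3] := vup_braid x y z.
have R m := @sm_virtual _ _ G A x y z m.
split; apply: edge_ext; rewrite /= -?l1 -?l2 -?l3 //.
- by rewrite l2 l3 sh_act_V.
- by have [_ /subr0_eq t _ _] := R c.
- apply: (@sm_v_inj _ _ G (A · vdn (vdn x y) z) (vup y x) (vup z (vdn x y))).
  by rewrite (fun m => subr0_eq (let: And4 _ _ h _ := R m in h)); congruence.
- apply: (@sm_v_inj _ _ G A (vdn x y) z); apply: (@sm_v_inj _ _ G (A · z) x y).
  by rewrite [RHS](fun m => subr0_eq (let: And4 _ _ _ h := R m in h)); congruence.
Qed.

Lemma braid_mixed : braid Virtual Virtual OverLR true true true.
Proof.
apply: braid_compare.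
move=> [[A1 x] a] [[A2 y] b] [[A z] c] [[? ?] ?] [[? ?] ?] [[? ?] ?].
move=> [[? ?] ?] [[? ?] ?] [[? ?] ?] [[? ?] ?] [[? ?] ?] [[? ?] ?].
move=> [[? ?] ?] [[? ?] ?] [[? ?] ?].
rewrite /= /virtual_crossing /positive_crossing /left_region /=.
do 6! (move=> -[[? ? ?] [? ?] [? ?]]); subst.
have [l1 l2 l3] := mixed_braid x y z.
have R m := @sm_mixed _ _ G A x y z m.
split; apply: edge_ext; rewrite /= -?l1 -?l2 -?l3 //.
- by rewrite l2 l3 sh_act_V.
- have [_ _ /subr0_eq t _] := R c; have [_ _ _ /subr0_eq t'] := R b.
  by rewrite !sm_actD t t'.
- by have [_ /subr0_eq t _ _] := R b.
- apply: (@sm_v_inj _ _ G A (vdn x y) z); apply: (@sm_v_inj _ _ G (A · z) x y).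
  by rewrite -[RHS](fun m => subr0_eq (let: And4 h _ _ _ := R m in h)); congruence.
Qed.

(** The two rotations generate all admissible types from the three types for
    which the equation is an axiom. *)
Lemma braid_upward a b d : triangle_ok a b d -> braid a b d true true true.
Proof.
have [p v m] := And3 braid_positive braid_virtual braid_mixed.
(* Two virtual crossings and a classical one: m, m1, m2, m3, n2, n3. Three
   classical crossings: p, p1, p2, p3, p4, p5. *)
have m1 := braid_rotate m; have m2 := braid_corotate m; have m3 := braid_rotate m2.
have n2 := braid_corotate m1; have n3 := braid_rotate n2.
have p1 := braid_rotate p; have p2 := braid_corotate p; have p3 := braid_rotate p2.
have p4 := braid_corotate p1; have p5 := braid_corotate p3.
by case: a; case: b; case: d.
Qed.

End Crossings.

(** * Reversing strands *)

Section Orientations.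

Variables (X : virtual_birack) (S : shadow X) (G : shadow_module S).
Local Notation edge := (edge G).
Implicit Types e f : edge.
Local Notation act o A x y := (@sm_act X S G o A x y).
Local Notation crossing := (@crossing X S G).
Local Notation braid := (@braid X S G).

(** Reversing strand 1 exchanges the two ends of strands 2 and 3 at their
    crossings with it, so that their own crossing moves from one side of strand
    1 to the other: the equation turns into itself, read backwards. *)
Lemma braid_flip1 a b d t2 t3 : braid a b d true t2 t3 -> braid a b d false t2 t3.
Proof.
move=> B; apply: braid_half => e1 e2 e3 f1 f2 f3 [m [n [k [c1 c2 c3]]]].
have [p1 p2 p3 p4] := crossing_pages c1; have [q1 q2 q3 q4] := crossing_pages c2.
have [m' [n' d1]] : exists m' n', crossing d t2 t3 e2 e3 m' n'.
  by apply: crossing_ex; rewrite p4.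
have /B[p [r [q [x1 x2 x3]]]] : left_triangle a b d true t2 t3 e1 m k m' n' f3.
  by exists e2, n, e3.
have [ep er] := crossing_det c3 x1; subst p r.
by exists m', n', q.
Qed.

Lemma braid_flip3 a b d t1 t2 : braid a b d t1 t2 true -> braid a b d t1 t2 false.
Proof.
move=> B; apply: braid_half => e1 e2 e3 f1 f2 f3 [m [n [k [c1 c2 c3]]]].
have [p1 p2 p3 p4] := crossing_pages c2; have [q1 q2 q3 q4] := crossing_pages c3.
have [E1 [E2 d1]] : exists E1 E2, crossing a t1 t2 E1 E2 f2 f3.
  by apply: crossing_coex; rewrite -q4.
have /B[M [N [K [x1 x2 x3]]]] : left_triangle a b d t1 t2 true E1 E2 e3 f1 m n.
  by exists f2, f3, k.
have [eK eN] := crossing_codet c1 x3; subst K N.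
by exists M, E2, E1.
Qed.

(** Reversing the middle strand exchanges the ends of strands 1 and 3 at their
    crossings with it, which does not respect the bottom of the triangle: the
    crossing of strands 1 and 3 has to be found sideways. *)
Lemma braid_flip2 a b d t1 t3 : braid a b d t1 true t3 -> braid a b d t1 false t3.
Proof.
move=> B; apply: braid_half => e1 e2 e3 f1 f2 f3 [m [n [k [c1 c2 c3]]]].
have [p1 p2 p3 p4] := crossing_pages c1; have [q1 q2 q3 q4] := crossing_pages c3.
have [r [p d1]] : exists r p, crossing b t1 t3 e1 r f1 p.
  by apply: crossing_side; rewrite p3 q3.
have /B[M [N [K [x1 x2 x3]]]] : left_triangle a b d t1 true t3 n e2 r k f2 p.
  by exists m, e1, f1.
have [eM eK] := crossing_side_det c2 x2; subst M K.
by exists r, N, p.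
Qed.

Lemma braid_all a b d t1 t2 t3 : triangle_ok a b d -> braid a b d t1 t2 t3.
Proof.
move=> /(@braid_upward _ _ G) B.
have {}B : braid a b d t1 true true by case: t1 => //; apply: braid_flip1.
have {}B : braid a b d t1 t2 true by case: t2 => //; apply: braid_flip2.
by case: t3 => //; apply: braid_flip3.
Qed.

(** * Kinks *)

(** The effect on a strand of a positive kink whose loop lies on its right. *)
Definition kink e : edge :=
  (right_region e, kink_map (edge_label e),
   kink_factor (@sm_act X S G) (right_region e) (edge_label e) (bead e)).

Definition kink_loop e : edge :=
  let: (A, x, g) := e in let y := kink_alpha x in
  (A ·^-1 y, y, act GenR (A ·^-1 y) x y g).

Lemma kink_crossing e :
  upward_crossing OverLR e (kink_loop e) (kink e) (kink_loop e).
Proof.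
case: e => -[A x] g; have [ea ek] := dn_kink_alpha x.
by rewrite /= /positive_crossing /left_region /= ea ek sm_actVK.
Qed.

Lemma kink_crossing_uniq e f k :
  upward_crossing OverLR e f k f -> f = kink_loop e /\ k = kink e.
Proof.
move=> c; have {c} [c ef] : upward_crossing OverLR e f k f /\ f = kink_loop e.
  split=> //; move: e f k c => [[A x] g] [[B y] h] [[C z] i].
  rewrite /= /positive_crossing /left_region /= => -[[-> _ _] [_ /esym ey] [_ ->]].
  have -> := kink_alpha_uniq ey.
  have -> : (B · kink_alpha x) ·^-1 kink_alpha x = B :> S.
    by rewrite /sh_actV (finv_f (@act_inj _ S (kink_alpha x))).
  by [].
by split=> //; subst f; have [_ /esym] := crossing_fun c (kink_crossing e);
   have [] := crossing_fun c (kink_crossing e).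
Qed.

Lemma kink_factorD A x (g h : G) :
  kink_factor (@sm_act X S G) A x (g + h)
  = kink_factor (@sm_act X S G) A x g + kink_factor (@sm_act X S G) A x h.
Proof. by rewrite /kink_factor !sm_actD addrACA. Qed.

Lemma kink_factor_act A x o B y z (g : G) :
  kink_factor (@sm_act X S G) A x (act o B y z g)
  = act o B y z (kink_factor (@sm_act X S G) A x g).
Proof.
by rewrite /kink_factor sm_actD !(sm_act_comm _ _ _ _ o B y z).
Qed.

(** All operators on the module commute, so that the order of the factors in
    the last relation of the algebra does not matter. *)
Lemma kink_factorC A x B y (g : G) :
  kink_factor (@sm_act X S G) A x (kink_factor (@sm_act X S G) B y g)
  = kink_factor (@sm_act X S G) B y (kink_factor (@sm_act X S G) A x g).
Proof. by rewrite {2 3}/kink_factor kink_factorD !kink_factor_act. Qed.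

Local Notation N := (birack_rank X).

Lemma birack_rank_gt0 : (0 < N)%N.
Proof. by rewrite /birack_rank; case: ex_minnP => n /andP[]. Qed.

Lemma iter_kink_map (x : X) : iter N (@kink_map X) x = x.
Proof. by rewrite /birack_rank; case: ex_minnP => n /andP[_ /forallP/(_ x)/eqP]. Qed.

Lemma iter_kinkE n A x g : iter n kink (A, x, g) =
  (A, iter n (@kink_map X) x,
   foldr (fun k => kink_factor (@sm_act X S G) A (iter k (@kink_map X) x)) g (iota 0 n)).
Proof.
elim: n => // n IH; have -> : iota 0 n.+1 = iota 0 n ++ [:: n].
  by rewrite -addn1 iotaD add0n.
rewrite foldr_cat iterS IH /kink /=; congr (_, _, _).
elim: (iota 0 n) => //= k s <-.
by rewrite kink_factorC.
Qed.

(** On labels this is the definition of the rank, on beads the last relation of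
    the algebra. *)
Lemma iter_kink e : iter N kink e = e.
Proof.
case: e => -[A x] g; rewrite iter_kinkE iter_kink_map; congr (_, _, _).
by apply/esym/subr0_eq/sm_kink.
Qed.

Lemma iter_kink_mod m n e : m = n %[mod N] -> iter m kink e = iter n kink e.
Proof.
have H k : iter k kink e = iter (k %% N)%N kink e.
  rewrite {1}(divn_eq k N) addnC iterD; congr (iter _ _ _).
  by elim: (k %/ N)%N => // q IH; rewrite mulSn iterD IH iter_kink.
by move=> E; rewrite H E -H.
Qed.

Lemma iter_kinkK e : iter N.-1 kink (kink e) = e.
Proof. by rewrite -iterSr prednK ?birack_rank_gt0 // iter_kink. Qed.

Lemma kink_iterK e : kink (iter N.-1 kink e) = e.
Proof. by rewrite -iterS prednK ?birack_rank_gt0 // iter_kink. Qed.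

Lemma kink_inj : injective kink.
Proof. exact: can_inj iter_kinkK. Qed.

Lemma left_region_kink e : left_region (kink e) = left_region e.
Proof. by have [_ _ -> _] := crossing_regions (kink_crossing e). Qed.

Lemma page_left_kink b n e : page_left b (iter n kink e) = page_left b e.
Proof. by case: b; elim: n => //= n <-; rewrite ?left_region_kink. Qed.

Lemma page_right_kink b n e : page_right b (iter n kink e) = page_right b e.
Proof. by case: b; elim: n => //= n <-; rewrite ?left_region_kink. Qed.

(** A kink on either strand can be pushed through any crossing: this is the
    third Reidemeister move, applied to the loop of the kink and the other
    strand. *)
Lemma crossing_kink1 d e1 e2 e3 e4 : upward_crossing d e1 e2 e3 e4 ->
  upward_crossing d (kink e1) e2 e3 (kink e4).
Proof.
move=> c; have [p1 p2 p3 p4] := crossing_regions c.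
have kc := kink_crossing e1; have [q1 q2 q3 q4] := crossing_regions kc.
have [z [y c1]] : exists z y, upward_crossing d (kink_loop e1) z e2 y.
  by apply: crossing_left; rewrite -q1.
have [r1 r2 r3 r4] := crossing_regions c1.
have [f [h kc']] : exists f h, upward_crossing OverLR e4 y f h.
  by apply: crossing_up; rewrite -p4.
have /(braid_all true true true (_ : triangle_ok OverLR d d)) :
    right_triangle OverLR d d true true true e1 (kink_loop e1) z e3 f h.
  by exists e2, y, e4.
case; first by case: (d).
move=> m [n [k [x1 x2 x3]]].
have [em en] := crossing_fun x1 kc; subst m n.
have [ek eh] := crossing_fun x2 c1; subst k h.
by have [_ ef] := kink_crossing_uniq kc'; subst f.
Qed.

Lemma crossing_kink2 d e1 e2 e3 e4 : upward_crossing d e1 e2 e3 e4 ->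
  upward_crossing d e1 (kink e2) (kink e3) e4.
Proof.
move=> c; have [p1 p2 p3 p4] := crossing_regions c.
have kc := kink_crossing e2; have [q1 q2 q3 q4] := crossing_regions kc.
have [y [f c1]] : exists y f, upward_crossing d e4 (kink_loop e2) y f.
  by apply: crossing_up; rewrite -p4.
have [r1 r2 r3 r4] := crossing_regions c1.
have [h [g kc']] : exists h g, upward_crossing OverLR e3 y h g.
  by apply: crossing_up; rewrite p2.
have /(braid_all true true true (_ : triangle_ok d d OverLR)) :
    left_triangle d d OverLR true true true e1 e2 (kink_loop e2) h g f.
  by exists e3, e4, y.
case; first by case: (d).
move=> m [n [k [x1 x2 x3]]].
have [em en] := crossing_fun x1 kc; subst m n.
have [ek ey] := crossing_right_uniq x3 c1; subst k g.
by have [_ eh] := kink_crossing_uniq kc'; subst h.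
Qed.

Lemma crossing_iter_kink1 n d b b' e1 e2 e3 e4 : crossing d b b' e1 e2 e3 e4 ->
  crossing d b b' (iter n kink e1) e2 e3 (iter n kink e4).
Proof.
elim: n => // n IH /IH; rewrite !iterS.
by case: b {IH}; case: b' => /=; do ?[apply: crossing_kink1 | apply: crossing_kink2].
Qed.

Lemma crossing_iter_kink2 n d b b' e1 e2 e3 e4 : crossing d b b' e1 e2 e3 e4 ->
  crossing d b b' e1 (iter n kink e2) (iter n kink e3) e4.
Proof.
elim: n => // n IH /IH; rewrite !iterS.
by case: b {IH}; case: b' => /=; do ?[apply: crossing_kink1 | apply: crossing_kink2].
Qed.

(** The power of the kink map that a kink with the given double point amounts
    to. The inverse of the kink map is its power with exponent N.-1. *)
Definition kink_weight (a : double_point) : nat :=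
  match a with OverLR => 1 | OverRL => N.-1 | Virtual => 0 end.

(** The right corners of a crossing may be prescribed, so every edge bounds the
    loop of some kink. *)
Lemma kink_loop_right e : exists x, e = kink_loop x.
Proof.
have [x [k c]] := @crossing_right X S G OverLR e e erefl.
by exists x; have [] := kink_crossing_uniq c.
Qed.

Lemma kink_loop_inj : injective kink_loop.
Proof.
move=> x y E; have c := kink_crossing x; rewrite E in c.
by have [] := crossing_right_uniq c (kink_crossing y).
Qed.

Lemma right_kink_ex a e : exists l,
  upward_crossing a e l (iter (kink_weight a) kink e) l.
Proof.
case: a => /=; first by exists (kink_loop e); apply: (kink_crossing e).
  exists (kink_loop (iter N.-1 kink e)).
  by have := kink_crossing (iter N.-1 kink e); rewrite kink_iterK.
case: e => -[A x] g; have [y [ey ex _]] := virtual_kink x.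
have [h eh] := sm_v_surj (A ·^-1 y) x y g.
exists (A ·^-1 y, y, h).
by rewrite /virtual_crossing /left_region /= ex ey sm_actVK.
Qed.

Lemma right_kink_uniq a e l k l' k' : upward_crossing a e l k l ->
  upward_crossing a e l' k' l' -> l = l' /\ k = k'.
Proof.
case: a => [/kink_crossing_uniq[-> ->] /kink_crossing_uniq[-> ->] // | |] /=.
  by move=> /kink_crossing_uniq[-> E] /kink_crossing_uniq[-> /esym]; rewrite E => /kink_inj->.
move=> c c'; suff E : l = l' by subst l'; have [_ ->] := crossing_right_uniq (d := Virtual) c c'.
case: c c' => -[a1 a2 a3] [b1 b2] [c1 c2] [[a1' a2' a3'] [b1' b2'] [c1' c2']].
have [y [_ _ u]] := virtual_kink (edge_label e).
have ey : edge_label l = edge_label l' by rewrite (u _ (esym b2)) (u _ (esym b2')).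
have eA : right_region l = right_region l'.
  by apply: (@act_inj _ S (edge_label l)); rewrite -[LHS]a1 a1' /left_region ey.
apply: edge_ext => //; rewrite -eA -ey -c2 in c2'.
by move: c2' => /sm_v_inj ->.
Qed.

(** The loop of a right kink is an arbitrary edge. Pushing the kink through its
    own crossing yields a crossing in which the loop is the strand that passes:
    a kink with its loop on the left has the same effect as one with its loop
    on the right. *)
Lemma left_kink_ex a e : exists l,
  upward_crossing a l e l (iter (kink_weight a) kink e).
Proof.
have pos f : exists l, positive_crossing l f l (kink f).
  have [x ex] := kink_loop_right f.
  by exists (kink x); have /crossing_kink1 := kink_crossing x; rewrite -ex.
case: a => //=.
  by have [l] := pos (iter N.-1 kink e); rewrite kink_iterK; exists l.
case: e => -[A x] g; have [y ey ex] := virtual_kink_left_ex x.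
exists (A · x, y, sm_act GenV A y x g).
by rewrite /virtual_crossing /left_region /= ex ey.
Qed.

(** Undoing the kink on the loop turns a left kink back into a right one. *)
Lemma left_kink_uniq a e l k l' k' : upward_crossing a l e l k ->
  upward_crossing a l' e l' k' -> l = l' /\ k = k'.
Proof.
have pos f f' m : positive_crossing m f m f' ->
    exists2 x, f = kink_loop x & m = kink x /\ f' = kink f.
  move=> /(@crossing_iter_kink1 N.-1 OverLR true true) /=.
  rewrite -{2}(kink_iterK m); set x := iter _ _ _ => c.
  have [-> E] := crossing_left_uniq (d := OverLR) c (kink_crossing x).
  exists x => //; split; first by rewrite kink_iterK.
  by rewrite -E kink_iterK.
case: a => /=.
- by move=> /pos[x -> [-> ->]] /pos[x' /kink_loop_inj-> [-> ->]].
- move=> /pos[x -> [-> E]] /pos[x' -> [-> E']].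
  by move: E'; rewrite E => /kink_inj/kink_loop_inj->.
move=> c c'; suff E : l = l' by subst l'; have [_ ->] := crossing_fun (d := Virtual) c c'.
case: c c' => -[a1 a2 a3] [b1 b2] [c1 c2] [[a1' a2' a3'] [b1' b2'] [c1' c2']].
have ex : edge_label l = edge_label l'.
  apply: (@vdn_inj _ (edge_label e)) => /=.
  by rewrite (virtual_kink_left (esym b1) erefl) (virtual_kink_left (esym b1') erefl).
apply: edge_ext => //; first by rewrite a1.
by rewrite c1 c1' ex.
Qed.

(** The effect of n kinks on a strand, read from the bottom to the top of the
    page. On a downward strand this is the inverse of what happens along the
    strand. *)
Definition pass (b : bool) (n : nat) e : edge :=
  iter (if b then n else n * N.-1)%N kink e.

(** Turned upside down, a kink on a downward strand becomes one on an upward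
    strand, with the loop on the other side. *)
Lemma kinkR_ex a b e : exists l,
  crossing a b b e l (pass b (kink_weight a) e) l.
Proof.
case: b; first exact: right_kink_ex.
have [l c] := left_kink_ex a (pass false (kink_weight a) e).
exists l => /=; move: c; rewrite /pass -iterD -mulnS prednK ?birack_rank_gt0 //.
by rewrite (@iter_kink_mod (_ * N) 0) // modnMl mod0n.
Qed.

Lemma kinkL_ex a b e : exists l,
  crossing a b b l e l (pass b (kink_weight a) e).
Proof.
case: b; first exact: left_kink_ex.
have [l c] := right_kink_ex a (pass false (kink_weight a) e).
exists l => /=; move: c; rewrite /pass -iterD -mulnS prednK ?birack_rank_gt0 //.
by rewrite (@iter_kink_mod (_ * N) 0) // modnMl mod0n.
Qed.

Lemma iter_kink_inj n : injective (iter n kink).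
Proof. by elim: n => // n IH e f /= /kink_inj /IH. Qed.

Lemma kinkR_uniq a b e l k l' k' : crossing a b b e l k l ->
  crossing a b b e l' k' l' -> l = l' /\ k = k'.
Proof.
case: b; first exact: right_kink_uniq.
move=> /= c c'; have [m x] := left_kink_ex a k; have [m' x'] := left_kink_ex a k'.
have [el E] := left_kink_uniq c x; have [el' E'] := left_kink_uniq c' x'.
have ek : k = k' by move: E'; rewrite E => /iter_kink_inj.
by split=> //; subst k'; have [] := left_kink_uniq c c'.
Qed.

Lemma kinkL_uniq a b e l k l' k' : crossing a b b l e l k ->
  crossing a b b l' e l' k' -> l = l' /\ k = k'.
Proof.
case: b; first exact: left_kink_uniq.
move=> /= c c'; have [m x] := right_kink_ex a k; have [m' x'] := right_kink_ex a k'.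
have [el E] := right_kink_uniq c x; have [el' E'] := right_kink_uniq c' x'.
have ek : k = k' by move: E'; rewrite E => /iter_kink_inj.
by split=> //; subst k'; have [] := right_kink_uniq c c'.
Qed.

Lemma crossing_pass1 n d b b' e1 e2 e3 e4 : crossing d b b' e1 e2 e3 e4 ->
  crossing d b b' (pass b n e1) e2 e3 (pass b n e4).
Proof. exact: crossing_iter_kink1. Qed.

Lemma crossing_pass2 n d b b' e1 e2 e3 e4 : crossing d b b' e1 e2 e3 e4 ->
  crossing d b b' e1 (pass b' n e2) (pass b' n e3) e4.
Proof. exact: crossing_iter_kink2. Qed.

Lemma passD b m n e : pass b (m + n) e = pass b m (pass b n e).
Proof. by rewrite /pass -iterD; case: b; rewrite ?mulnDl. Qed.

Lemma pass0 b e : pass b 0 e = e. Proof. by case: b. Qed.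

Lemma pass_rank b e : pass b N e = e.
Proof.
rewrite /pass (@iter_kink_mod _ 0) //.
by case: b; rewrite ?modnMr ?modnMl ?modnn mod0n.
Qed.

Lemma pass_neg b e : pass (~~ b) 1 (pass b 1 e) = e.
Proof.
rewrite /pass -iterD (@iter_kink_mod _ 0) // mod0n.
by case: b; rewrite /= mul1n ?addn1 ?add1n prednK ?birack_rank_gt0 // modnn.
Qed.

Lemma page_left_pass b b' n e : page_left b (pass b' n e) = page_left b e.
Proof. exact: page_left_kink. Qed.

Lemma page_right_pass b b' n e : page_right b (pass b' n e) = page_right b e.
Proof. exact: page_right_kink. Qed.

End Orientations.

(** * Chains of states *)

(** The events of a height function, without component numbers, together with
    kink marks: a mark acts on its strand as a positive kink. *)
Inductive piece := PMin of bool | PMax | PCross of double_point | PKink.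
Definition tile : Type := (nat * piece)%type.

Definition shift (n : nat) (w : seq tile) : seq tile := [seq ((n + t.1)%N, t.2) | t <- w].

Section States.

Variables (X : virtual_birack) (S : shadow X) (G : shadow_module S).
Local Notation edge := (edge G).
Local Notation act o A x y := (@sm_act X S G o A x y).

Definition strand_state : Type := (bool * edge)%type.
Definition state : Type := seq strand_state.
Implicit Types (s : strand_state) (σ τ : state) (ss : seq state) (w : seq tile).

Definition sleft s : S := page_left s.1 s.2.
Definition sright s : S := page_right s.1 s.2.

Fixpoint coherent (A : S) σ : Prop :=
  if σ is s :: σ' then sleft s = A /\ coherent (sright s) σ' else True.

Definition event_at_0 (A : S) (p : piece) σ τ : Prop :=
  match p with
  | PMin o => exists2 e, page_left o e = A & τ = [:: (o, e), (~~ o, e) & σ]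
  | PMax => if σ is [:: (b, e), (b', e') & σ'] then
              [/\ page_left b e = A, b' = ~~ b, e' = e & τ = σ']
            else False
  | PCross d =>
      match σ, τ with
      | [:: (b1, e1), (b2, e2) & σ'], [:: (b3, e3), (b4, e4) & τ'] =>
          [/\ page_left b1 e1 = A, b3 = b2, b4 = b1, τ' = σ'
            & crossing d b1 b2 e1 e2 e3 e4]
      | _, _ => False
      end
  | PKink => if σ is (b, e) :: σ' then
               page_left b e = A /\ τ = (b, pass b 1 e) :: σ'
             else False
  end.

Fixpoint event_rel (A : S) (i : nat) (p : piece) σ τ {struct i} : Prop :=
  match i, σ, τ with
  | 0, _, _ => event_at_0 A p σ τ
  | i'.+1, s :: σ', s' :: τ' =>
      [/\ s' = s, sleft s = A & event_rel (sright s) i' p σ' τ']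
  | _, _, _ => False
  end.

Fixpoint chain (A : S) w σ ss : Prop :=
  match w, ss with
  | [::], [::] => True
  | t :: w', τ :: ss' => event_rel A t.1 t.2 σ τ /\ chain A w' τ ss'
  | _, _ => False
  end.

Lemma chain_size A w σ ss : chain A w σ ss -> size ss = size w.
Proof. by elim: w σ ss => [|t w IH] σ [|τ ss] //= [_ /IH ->]. Qed.

Lemma chain_cat A w w' σ ss :
  chain A (w ++ w') σ ss <->
  exists ss1 ss2, [/\ ss = ss1 ++ ss2, chain A w σ ss1 & chain A w' (last σ ss1) ss2].
Proof.
elim: w σ ss => [|t w IH] σ ss /=.
  by split=> [c|[[|? ?] [ss2 [-> //]]]]; exists [::], ss.
case: ss => [|τ ss]; first by split=> // -[[|? ?] [? []]].
split=> [[h /IH[ss1 [ss2 [-> c1 c2]]]]|[[|τ' ss1] [ss2 [//= [-> ->] [h c1] c2]]]].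
  by exists (τ :: ss1), ss2.
by split=> //; apply/IH; exists ss1, ss2.
Qed.

Definition dirs σ : seq bool := map fst σ.

Definition ok A ds σ := dirs σ = ds /\ coherent A σ.

Definition dirs_after_0 (p : piece) (ds : seq bool) : seq bool :=
  match p, ds with
  | PMin o, _ => [:: o, ~~ o & ds]
  | PMax, [:: _, _ & ds'] => ds'
  | PCross _, [:: b, b' & ds'] => [:: b', b & ds']
  | _, _ => ds
  end.

Fixpoint dirs_after (ds : seq bool) (i : nat) (p : piece) {struct i} : seq bool :=
  match i, ds with
  | 0, _ => dirs_after_0 p ds
  | i'.+1, b :: ds' => b :: dirs_after ds' i' p
  | _, [::] => [::]
  end.

Lemma event_dirs A i p σ τ : event_rel A i p σ τ -> dirs τ = dirs_after (dirs σ) i p.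
Proof.
elim: i A σ τ => [|i IH] A σ τ.
  case: p => [o||d|] /=.
  - by move=> [e _ ->].
  - by case: σ => [|[b e] [|[b' e'] σ]] //= [_ _ _ ->].
  - case: σ => [|[b1 e1] [|[b2 e2] σ]] //; case: τ => [|[b3 e3] [|[b4 e4] τ]] //=.
    by case=> _ -> -> ->.
  - by case: σ => [|[b e] σ] //= [_ ->].
by case: σ τ => [|s σ] [|s' τ] //= [-> _ /IH ->].
Qed.

Lemma chain_dirs A w σ ss : chain A w σ ss ->
  dirs (last σ ss) = foldl (fun ds t => dirs_after ds t.1 t.2) (dirs σ) w.
Proof. by elim: w σ ss => [|t w IH] σ [|τ ss] //= [/event_dirs <- /IH]. Qed.

Lemma event_coherent A i p σ τ : event_rel A i p σ τ -> coherent A σ -> coherent A τ.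
Proof.
elim: i A σ τ => [|i IH] A σ τ.
  case: p => [o||d|] /=.
  - move=> [e eA ->] h; rewrite /= /sleft /sright /= page_left_neg; split=> //.
    by rewrite page_right_neg eA.
  - case: σ => [|[b e] [|[b' e'] σ]] //= [eA -> -> ->] [_ [_]].
    by rewrite /sright /= page_right_neg eA.
  - case: σ => [|[b1 e1] [|[b2 e2] σ]] //; case: τ => [|[b3 e3] [|[b4 e4] τ]] //=.
    case=> <- -> -> -> /crossing_pages[p1 p2 p3 p4]; rewrite /sleft /sright /=.
    by rewrite -p3 -p2 -p4 => -[_ [_ h]].
  - case: σ => [|[b e] σ] //= [<- ->] [_ h] /=.
    by rewrite /sleft /sright /= page_left_pass page_right_pass.
case: σ τ => [|s σ] [|s' τ] //= [-> eA] /IH h [_ /h].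
by split.
Qed.

Lemma chain_coherent A w σ ss : chain A w σ ss -> coherent A σ -> coherent A (last σ ss).
Proof.
by elim: w σ ss => [|t w IH] σ [|τ ss] //= [/event_coherent h /IH h'] /h /h'.
Qed.

(** * Local replacement *)

(** Rigidity makes the replacement of one word by another a bijection between
    chains and not only a relation. *)
Definition rigid A ds w := forall σ ss ss', ok A ds σ ->
  chain A w σ ss -> chain A w σ ss' -> last σ ss = last σ ss' -> ss = ss'.

Definition subsumes A ds w w' := forall σ ss, ok A ds σ ->
  chain A w σ ss -> exists2 ss', chain A w' σ ss' & last σ ss' = last σ ss.

Definition local_equiv ds w w' := forall A,
  [/\ rigid A ds w, rigid A ds w', subsumes A ds w w' & subsumes A ds w' w].

Lemma local_equiv_sym ds w w' : local_equiv ds w w' -> local_equiv ds w' w.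
Proof. by move=> h A; have [] := h A. Qed.

Lemma chain_shift1 A w s σ ss : sleft s = A ->
  chain A (shift 1 w) (s :: σ) ss <->
  exists2 ss', ss = map (cons s) ss' & chain (sright s) w σ ss'.
Proof.
move=> eA; elim: w σ ss => [|t w IH] σ ss /=.
  by case: ss => [|? ?]; [split=> // _; exists [::] | split=> // -[[]]].
case: ss => [|[|s' τ] ss] /=; first by split=> // -[[]].
  by split=> [[]|[[]]].
split=> [[[-> _ h] /IH[ss' -> c]]|[[|τ' ss'] //= [-> -> ->] [h c]]].
  by exists (τ :: ss').
by split=> //; apply/IH; exists ss'.
Qed.

Lemma last_map_cons s σ ss : last (s :: σ) (map (cons s) ss) = s :: last σ ss.
Proof. by elim: ss σ => //= τ ss IH σ. Qed.

(** A strand on the left of all events is carried along, and its right region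
    is the leftmost region of the rest. *)
Lemma local_equiv_shift1 b ds w w' :
  local_equiv ds w w' -> local_equiv (b :: ds) (shift 1 w) (shift 1 w').
Proof.
move=> h A.
have rig v : (forall B, rigid B ds v) -> rigid A (b :: ds) (shift 1 v).
  move=> r [|s σ] ss ss' [] //= -[_ eds] [eA co].
  move=> /(chain_shift1 _ _ _ eA)[t -> c] /(chain_shift1 _ _ _ eA)[t' -> c'].
  rewrite !last_map_cons => -[e]; congr map.
  by apply: (r (sright s) _ _ _ _ c c' e).
have sub v v' : (forall B, subsumes B ds v v') -> subsumes A (b :: ds) (shift 1 v) (shift 1 v').
  move=> r [|s σ] ss [] //= -[_ eds] [eA co] /(chain_shift1 _ _ _ eA)[t -> c].
  have [t' c' e'] := r (sright s) _ _ (conj eds co) c.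
  by exists (map (cons s) t'); [apply/chain_shift1 => //; exists t' | rewrite !last_map_cons e'].
by split; [apply: rig | apply: rig | apply: sub | apply: sub] => B; have [] := h B.
Qed.

Lemma shift0 w : shift 0 w = w.
Proof. by rewrite /shift -[RHS]map_id; apply: eq_map => -[]. Qed.

Lemma local_equiv_shift a ds w w' :
  local_equiv ds w w' -> local_equiv (a ++ ds) (shift (size a) w) (shift (size a) w').
Proof.
move=> h; elim: a => [|b a IH] /=; first by rewrite !shift0.
have E v : shift (size a).+1 v = shift 1 (shift (size a) v).
  by rewrite /shift -map_comp.
by rewrite !E; apply: local_equiv_shift1.
Qed.

(** A minimum creates an edge and a maximum forgets one. Words without minima
    are determined by their bottom, words without maxima by their top. *)
Definition forward (p : piece) := if p is PMin _ then false else true.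
Definition backward (p : piece) := if p is PMax then false else true.

Lemma event_det A i p σ τ τ' : forward p ->
  event_rel A i p σ τ -> event_rel A i p σ τ' -> τ = τ'.
Proof.
move=> fp; elim: i A σ τ τ' => [|i IH] A σ τ τ'.
  case: p fp => [//||d|] _ /=.
  - by case: σ => [|[b e] [|[b' e'] σ]] //= [_ _ _ ->] [_ _ _ ->].
  - case: σ => [|[b1 e1] [|[b2 e2] σ]] //; case: τ => [|[b3 e3] [|[b4 e4] τ]] //=.
    case: τ' => [|[b5 e5] [|[b6 e6] τ']] //= [_ -> -> -> c] [_ -> -> -> c'].
    by have [-> ->] := crossing_det c c'.
  - by case: σ => [|[b e] σ] //= [_ ->] [_ ->].
by case: σ τ τ' => [|s σ] [|t τ] [|t' τ'] //= [-> _ /IH h] [-> _ /h ->].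
Qed.

Lemma pass_inj b n : injective (@pass X S G b n).
Proof. exact: iter_kink_inj. Qed.

Lemma event_codet A i p σ σ' τ : backward p ->
  event_rel A i p σ τ -> event_rel A i p σ' τ -> σ = σ'.
Proof.
move=> fp; elim: i A σ σ' τ => [|i IH] A σ σ' τ.
  case: p fp => [o||d|] // _ /=.
  - by case=> e _ -> [e' _ [_ _]].
  - case: σ => [|[b1 e1] [|[b2 e2] σ]] //; case: τ => [|[b3 e3] [|[b4 e4] τ]] //=.
    case: σ' => [|[b5 e5] [|[b6 e6] σ']] //= [_ -> -> -> c] [_ e1' e2' -> c'].
    by subst; have [-> ->] := crossing_codet c c'.
  - case: σ σ' => [|[b e] σ] [|[b' e'] σ'] //= [_ ->] [_ [-> + ->]].
    by move=> /pass_inj ->.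
case: σ σ' τ => [|s σ] [|s' σ'] [|t τ] //= [-> _ h] [e _ h']; subst s'.
by rewrite (IH _ _ _ _ h h').
Qed.

Lemma forward_chain A w σ ss ss' : all (fun t => forward t.2) w ->
  chain A w σ ss -> chain A w σ ss' -> ss = ss'.
Proof.
elim: w σ ss ss' => [|t w IH] σ; first by case=> [|? ?] [|? ?].
case=> [|τ ss] [|τ' ss'] //= /andP[ft fw] [r c] [r' c'].
by rewrite -(event_det ft r r') in c' *; rewrite (IH _ _ _ fw c c').
Qed.

Lemma forward_rigid A ds w : all (fun t => forward t.2) w -> rigid A ds w.
Proof. by move=> fw σ ss ss' _ c c' _; apply: forward_chain fw c c'. Qed.

Lemma backward_chain A w σ τ ss ss' : all (fun t => backward t.2) w ->
  chain A w σ ss -> chain A w τ ss' -> last σ ss = last τ ss' -> σ = τ /\ ss = ss'.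
Proof.
elim: w σ τ ss ss' => [|t w IH] σ τ [|σ' ss] [|τ' ss'] //= /andP[bt bw].
move=> [r c] [r' c'] e; have [eτ ->] := IH _ _ _ _ bw c c' e; subst τ'.
by rewrite (event_codet bt r r').
Qed.

Lemma backward_rigid A ds w : all (fun t => backward t.2) w -> rigid A ds w.
Proof. by move=> bw σ ss ss' _ c c' e; have [] := backward_chain bw c c' e. Qed.

(** * Pointwise operations on beads *)

(** Operations on pairs of beads that preserve the bead relations over any
    given labels. *)
Definition compatible (u : G -> G -> G) :=
  (forall o A x y g h, act o A x y (u g h) = u (act o A x y g) (act o A x y h)) /\
  (forall g g' h h', u (g + g') (h + h') = u g h + u g' h').

Definition lift_edge (u : G -> G -> G) (e f : edge) : edge :=
  (right_region e, edge_label e, u (bead e) (bead f)).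

Definition edge_key (e : edge) := (right_region e, edge_label e).

Section Lift.

Variable u : G -> G -> G.
Hypothesis cu : compatible u.
Local Notation lift := (lift_edge u).

Lemma lift_positive e1 e2 e3 e4 f1 f2 f3 f4 :
  positive_crossing e1 e2 e3 e4 -> positive_crossing f1 f2 f3 f4 ->
  edge_key e1 = edge_key f1 -> edge_key e2 = edge_key f2 ->
  positive_crossing (lift e1 f1) (lift e2 f2) (lift e3 f3) (lift e4 f4).
Proof.
have [uA uD] := cu.
case=> -[a1 a2 a3] [b1 b2] [c1 c2] [[a1' a2' a3'] [b1' b2'] [c1' c2']].
case=> k1 k1' [k2 k2']; split=> //=.
by rewrite c1 c2 c1' c2' -k1' -k2 -k2' !uA uD.
Qed.

Lemma lift_virtual e1 e2 e3 e4 f1 f2 f3 f4 :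
  virtual_crossing e1 e2 e3 e4 -> virtual_crossing f1 f2 f3 f4 ->
  edge_key e1 = edge_key f1 -> edge_key e2 = edge_key f2 ->
  virtual_crossing (lift e1 f1) (lift e2 f2) (lift e3 f3) (lift e4 f4).
Proof.
have [uA uD] := cu.
case=> -[a1 a2 a3] [b1 b2] [c1 c2] [[a1' a2' a3'] [b1' b2'] [c1' c2']].
case=> k1 k1' [k2 k2']; split=> //=.
by rewrite !uA c1 c1' c2 -c2' -k1' -k2 -k2'.
Qed.

Lemma lift_crossing d b b' e1 e2 e3 e4 f1 f2 f3 f4 :
  crossing d b b' e1 e2 e3 e4 -> crossing d b b' f1 f2 f3 f4 ->
  edge_key e1 = edge_key f1 -> edge_key e2 = edge_key f2 ->
  edge_key e3 = edge_key f3 -> edge_key e4 = edge_key f4 ->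
  crossing d b b' (lift e1 f1) (lift e2 f2) (lift e3 f3) (lift e4 f4).
Proof.
by case: b; case: b'; case: d => /= c c' k1 k2 k3 k4;
  do ?[apply: lift_positive | apply: lift_virtual].
Qed.

Lemma lift_kink e f : edge_key e = edge_key f -> lift (kink e) (kink f) = kink (lift e f).
Proof.
have [uA uD] := cu; case: e f => [[A x] g] [[B y] h] [<- <-].
by rewrite /kink /lift_edge /= /kink_factor !uA !uD.
Qed.

Lemma kink_key e f : edge_key e = edge_key f -> edge_key (kink e) = edge_key (kink f).
Proof. by case: e f => [[A x] g] [[B y] h] [<- <-]. Qed.

Lemma lift_pass b n e f : edge_key e = edge_key f ->
  lift (pass b n e) (pass b n f) = pass b n (lift e f).
Proof.
rewrite /pass; move: (if b then _ else _) => m k.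
suff [] : edge_key (iter m (@kink X S G) e) = edge_key (iter m (@kink X S G) f) /\
  lift (iter m (@kink X S G) e) (iter m (@kink X S G) f) = iter m (@kink X S G) (lift e f) by [].
elim: m => // m [IHk IH]; rewrite !iterS -IH lift_kink //; split=> //.
exact: kink_key.
Qed.

End Lift.

Definition strand_key s := (s.1, edge_key s.2).
Definition keys σ := map strand_key σ.

Definition lift_strand (u : G -> G -> G) (s t : strand_state) : strand_state := (s.1, lift_edge u s.2 t.2).
Definition lift_state u σ τ : state := [seq lift_strand u p.1 p.2 | p <- zip σ τ].
Definition lift_chain u ss tt : seq state := [seq lift_state u p.1 p.2 | p <- zip ss tt].

#[local] Arguments lift_state : simpl never.

Lemma lift_cons u s σ t τ :
  lift_state u (s :: σ) (t :: τ) = lift_strand u s t :: lift_state u σ τ.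
Proof. by []. Qed.

Lemma page_left_lift b u e f : page_left b (lift_edge u e f) = page_left b e.
Proof. by case: b; case: e => [[A x] g]. Qed.

Lemma page_right_lift b u e f : page_right b (lift_edge u e f) = page_right b e.
Proof. by case: b; case: e => [[A x] g]. Qed.

Lemma event_lift u A i p σ τ σ' τ' : compatible u ->
  event_rel A i p σ τ -> event_rel A i p σ' τ' -> keys σ = keys σ' -> keys τ = keys τ' ->
  event_rel A i p (lift_state u σ σ') (lift_state u τ τ').
Proof.
move=> cu; elim: i A σ τ σ' τ' => [|i IH] A σ τ σ' τ'.
  case: p => [o||d|] /=.
  - move=> [e eA ->] [e' _ ->] _ [k _]; exists (lift_edge u e e'); last by [].
    by rewrite page_left_lift.
  - case: σ σ' => [|[b e] [|[b1 e1] σ]] [|[b' e'] [|[b1' e1'] σ']] //=.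
    by move=> [eA -> -> ->] [_ _ -> ->] _ _; rewrite ?lift_cons /lift_strand /= page_left_lift.
  - case: σ => [|[b1 e1] [|[b2 e2] σ]] //; case: τ => [|[b3 e3] [|[b4 e4] τ]] //=.
    case: σ' => [|[c1 f1] [|[c2 f2] σ']] //; case: τ' => [|[c3 f3] [|[c4 f4] τ']] //=.
    move=> [eA -> -> -> c] [_ -> -> -> c'] [? ? ? ? ? ? _] [? ? ? ? ? ? _]; subst.
    rewrite ?lift_cons /lift_strand /= page_left_lift; split=> //.
    by apply: lift_crossing => //; congr (_, _).
  - case: σ σ' => [|[b e] σ] [|[b' e'] σ'] //= [eA ->] [_ ->] [? k1 k2 _] _; subst b'.
    by rewrite ?lift_cons /lift_strand /= page_left_lift -lift_pass //; congr (_, _).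
case: σ τ σ' τ' => [|s σ] [|t τ] [|s' σ'] [|t' τ'] //= [-> eA h] [-> _ h'] [k0 k1 k2 k] [_ _ _ k'].
rewrite ?lift_cons /=; split=> //.
rewrite /sright /lift_strand /= page_right_lift; apply: IH => //.
suff -> : page_right s.1 s.2 = sright s' by [].
rewrite /sright -k0; case: s s' {h h' eA k0} k1 k2 => [b [[B x] g]] [b' [[B' x'] g']] /= -> ->.
by case: b.
Qed.

Lemma chain_lift u A w σ ss σ' ss' : compatible u ->
  chain A w σ ss -> chain A w σ' ss' -> keys σ = keys σ' -> map keys ss = map keys ss' ->
  chain A w (lift_state u σ σ') (lift_chain u ss ss').
Proof.
move=> cu; elim: w σ ss σ' ss' => [|t w IH] σ [|τ ss] σ' [|τ' ss'] //=.
move=> [h c] [h' c'] k [k1 k2]; split; first exact: event_lift.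
exact: IH.
Qed.

Lemma last_lift u σ ss σ' ss' : size ss = size ss' ->
  last (lift_state u σ σ') (lift_chain u ss ss') = lift_state u (last σ ss) (last σ' ss').
Proof. by elim: ss ss' σ σ' => [|τ ss IH] [|τ' ss'] //= σ σ' [/IH]. Qed.

Lemma keys_lift u σ τ : keys σ = keys τ -> keys (lift_state u σ τ) = keys σ.
Proof.
by elim: σ τ => [|s σ IH] [|t τ] //= [_ _ _ /IH ->]; case: s => [b [[B x] g]].
Qed.

Lemma map_keys_lift u ss tt : map keys ss = map keys tt ->
  map keys (lift_chain u ss tt) = map keys ss.
Proof. by elim: ss tt => [|σ ss IH] [|τ tt] //= [k /IH ->]; rewrite keys_lift. Qed.

(** Applying this operation to a chain erases its beads, and so shows what its
    keys determine. *)
Definition zero_op (g h : G) : G := 0.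

Lemma zero_compatible : compatible zero_op.
Proof. by split=> *; rewrite /zero_op ?addr0 // sm_act0. Qed.

Lemma lift_zero σ σ' τ τ' : keys σ = keys τ -> size σ' = size σ -> size τ' = size τ ->
  lift_state zero_op σ σ' = lift_state zero_op τ τ'.
Proof.
elim: σ τ σ' τ' => [|s σ IH] [|t τ] [|s' σ'] [|t' τ'] // [k1 k2 k3 k] [e] [e'].
by rewrite !lift_cons (IH τ σ' τ') // /lift_strand /lift_edge k1 k2 k3.
Qed.

Lemma lift_zero_chain ss tt : map keys ss = map keys tt ->
  lift_chain zero_op ss ss = lift_chain zero_op tt tt.
Proof.
elim: ss tt => [|σ ss IH] [|τ tt] // [k k']; congr (_ :: _); last exact: IH.
exact: lift_zero.
Qed.

Lemma keys_dirs σ τ : keys σ = keys τ -> dirs σ = dirs τ.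
Proof.
move=> k; have E ρ : dirs ρ = map fst (keys ρ) by rewrite -map_comp.
by rewrite !E k.
Qed.

Lemma ok_lift A ds u σ τ : ok A ds σ -> keys σ = keys τ -> ok A ds (lift_state u σ τ).
Proof.
move=> [ed co] k; split; first by rewrite -ed; apply: keys_dirs; apply: keys_lift.
elim: σ τ A co {ed} k => [|s σ IH] [|t τ] //= A [eA co] [_ _ _ k].
rewrite /sleft /sright /= page_left_lift page_right_lift; split=> //.
exact: IH.
Qed.

(** * Equivalence of closed words *)

Definition closed_chain A w ss := chain A w [::] ss /\ last [::] ss = [::].

(** A bijection between labelings with beads that respects the underlying
    labels and every pointwise operation on beads, hence the module structure
    of the beads over each labeling. *)
Record equivalence A w w' (F : seq state -> seq state -> Prop) : Prop := {
  equiv_closed : forall ss ss', F ss ss' -> closed_chain A w ss /\ closed_chain A w' ss';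
  equiv_total : forall ss, closed_chain A w ss -> exists ss', F ss ss';
  equiv_onto : forall ss', closed_chain A w' ss' -> exists ss, F ss ss';
  equiv_fun : forall ss tt tt', F ss tt -> F ss tt' -> tt = tt';
  equiv_inj : forall ss ss' tt, F ss tt -> F ss' tt -> ss = ss';
  equiv_keys : forall ss ss' tt tt', F ss ss' -> F tt tt' ->
    map keys ss = map keys tt <-> map keys ss' = map keys tt';
  equiv_lift : forall u ss ss' tt tt', compatible u -> F ss ss' -> F tt tt' ->
    map keys ss = map keys tt -> F (lift_chain u ss tt) (lift_chain u ss' tt') }.

Definition equi w w' := forall A, exists F, equivalence A w w' F.

Lemma equivalence_sym A w w' F :
  equivalence A w w' F -> equivalence A w' w (fun ss ss' => F ss' ss).
Proof.
move=> [h1 h2 h3 h4 h5 h6 h7]; split.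
- by move=> ss ss' /h1[].
- exact: h3.
- exact: h2.
- by move=> ss tt tt'; apply: h5.
- by move=> ss ss' tt; apply: h4.
- by move=> ss ss' tt tt' a b; rewrite (h6 _ _ _ _ a b).
- by move=> u ss ss' tt tt' cu a b k; apply: h7 => //; apply/(h6 _ _ _ _ a b).
Qed.

Lemma equi_sym w w' : equi w w' -> equi w' w.
Proof. by move=> h A; have [F /equivalence_sym] := h A; eexists; eassumption. Qed.

Lemma equi_trans w w' w'' : equi w w' -> equi w' w'' -> equi w w''.
Proof.
move=> h h' A; have [F [h1 h2 h3 h4 h5 h6 h7]] := h A.
have [F' [k1 k2 k3 k4 k5 k6 k7]] := h' A.
exists (fun ss ss'' => exists2 ss', F ss ss' & F' ss' ss''); split.
- by move=> ss ss'' [ss' /h1[? _] /k1[_ ?]].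
- move=> ss /h2[ss' f]; have [_ /k2[ss'' f']] := h1 _ _ f.
  by exists ss'', ss'.
- move=> ss /k3[ss' f]; have [/h3[ss'' f'] _] := k1 _ _ f.
  by exists ss'', ss'.
- move=> ss tt tt' [x a b] [y c d]; rewrite -(h4 _ _ _ a c) in d.
  exact: k4 b d.
- move=> ss ss' tt [x a b] [y c d]; rewrite (k5 _ _ _ b d) in a.
  exact: h5 a c.
- move=> ss ss' tt tt' [x a b] [y c d].
  by rewrite (h6 _ _ _ _ a c) (k6 _ _ _ _ b d).
- move=> u ss ss' tt tt' cu [x a b] [y c d] k.
  exists (lift_chain u x y); first exact: h7.
  by apply: k7 => //; apply/(h6 _ _ _ _ a c).
Qed.

Lemma lift_chain_cat u ss ss' tt tt' : size ss = size tt ->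
  lift_chain u (ss ++ ss') (tt ++ tt') = lift_chain u ss tt ++ lift_chain u ss' tt'.
Proof. by move=> e; rewrite /lift_chain zip_cat // map_cat. Qed.

Lemma map_keys_last σ ss τ tt : keys σ = keys τ -> map keys ss = map keys tt ->
  keys (last σ ss) = keys (last τ tt).
Proof. by elim: ss σ tt τ => [|σ' ss IH] σ [|τ' tt] τ //= k [k1 k2]; apply: IH. Qed.

Lemma eq_cat2 (T : Type) (a b c d : seq T) : size a = size c ->
  a ++ b = c ++ d -> a = c /\ b = d.
Proof. by elim: a c => [|x a IH] [|y c] //= [/IH h] [-> /h[-> ->]]. Qed.

(** The outer parts of a chain are kept, and the inner part is replaced by the
    only chain with the same ends. *)
Lemma equi_local v w w' v' :
  local_equiv (foldl (fun ds t => dirs_after ds t.1 t.2) [::] v) w w' ->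
  equi (v ++ w ++ v') (v ++ w' ++ v').
Proof.
move=> L A; have [r r' s s'] := L A.
have okl a : chain A v [::] a ->
    ok A (foldl (fun ds t => dirs_after ds t.1 t.2) [::] v) (last [::] a).
  by move=> c; split; [rewrite (chain_dirs c) | apply: (chain_coherent c)].
exists (fun ss ss' => exists a b b' c,
  [/\ ss = a ++ b ++ c /\ ss' = a ++ b' ++ c, chain A v [::] a,
      chain A w (last [::] a) b /\ chain A w' (last [::] a) b',
      last (last [::] a) b' = last (last [::] a) b &
      chain A v' (last (last [::] a) b) c /\ last (last (last [::] a) b) c = [::] ]).
have main y y' a b b' a' e e' : rigid A (foldl (fun ds t => dirs_after ds t.1 t.2) [::] v) y' ->
    chain A v [::] a -> chain A v [::] a' ->
    chain A y (last [::] a) b -> chain A y (last [::] a') e ->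
    chain A y' (last [::] a) b' -> chain A y' (last [::] a') e' ->
    last (last [::] a) b' = last (last [::] a) b ->
    last (last [::] a') e' = last (last [::] a') e ->
    map keys a = map keys a' -> map keys b = map keys e -> map keys b' = map keys e'.
  move=> rig ca ca' cb ce cb' ce' lb le ka kb.
  have kl : keys (last [::] a) = keys (last [::] a') by apply: map_keys_last.
  have kl2 : keys (last (last [::] a) b) = keys (last (last [::] a') e).
    exact: map_keys_last.
  (* Without their beads, the two chains have the same ends: rigidity gives
     equal chains, hence equal keys. *)
  have c1 := chain_lift zero_compatible cb' cb' erefl erefl.
  have c2 := chain_lift zero_compatible ce' ce' erefl erefl.
  have z2 : lift_state zero_op (last [::] a') (last [::] a')
            = lift_state zero_op (last [::] a) (last [::] a).
    exact: lift_zero (esym kl) erefl erefl.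
  have e1 := last_lift zero_op (last [::] a) (last [::] a) (erefl (size b')).
  have e2 := last_lift zero_op (last [::] a') (last [::] a') (erefl (size e')).
  rewrite z2 in c2 e2.
  have E := rig _ _ _ (ok_lift _ (okl _ ca) erefl) c1 c2.
  rewrite e1 e2 lb le (lift_zero kl2 erefl erefl) in E.
  by have := congr1 (map keys) (E erefl); rewrite !map_keys_lift.
split.
- move=> ss ss' [a [b [b' [c [[-> ->] ca [cb cb'] lb [cc lc]]]]]].
  rewrite /closed_chain !chain_cat !last_cat lb; split; split=> //.
    by exists a, (b ++ c); split=> //; apply/chain_cat; exists b, c.
  by exists a, (b' ++ c); split=> //; apply/chain_cat; exists b', c; rewrite lb.
- move=> ss [/chain_cat[a [bc [-> ca /chain_cat[b [c [-> cb cc]]]]]] lc].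
  have [b' cb' lb] := s _ _ (okl _ ca) cb.
  by exists (a ++ b' ++ c), a, b, b', c; rewrite !last_cat in lc.
- move=> ss [/chain_cat[a [bc [-> ca /chain_cat[b' [c [-> cb' cc]]]]]] lc].
  have [b cb lb] := s' _ _ (okl _ ca) cb'.
  exists (a ++ b ++ c), a, b, b', c; rewrite !last_cat in lc.
  by rewrite lb.
- move=> ss tt tt' [a [b [b' [c [[-> ->] ca [cb cb'] lb [cc lc]]]]]].
  move=> [a2 [b2 [b2' [c2 [[E ->] ca2 [cb2 cb2'] lb2 _]]]]].
  have [ea E'] := eq_cat2 (etrans (chain_size ca) (esym (chain_size ca2))) E; subst a2.
  have [eb ec] := eq_cat2 (etrans (chain_size cb) (esym (chain_size cb2))) E'; subst b2 c2.
  by rewrite (r' _ _ _ (okl _ ca) cb' cb2') // lb lb2.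
- move=> tt tt' ss [a [b' [b [c [[-> ->] ca [cb' cb] lb [cc lc]]]]]].
  move=> [a2 [b2' [b2 [c2 [[-> E] ca2 [cb2' cb2] lb2 _]]]]].
  have [ea E'] := eq_cat2 (etrans (chain_size ca) (esym (chain_size ca2))) E; subst a2.
  have [eb ec] := eq_cat2 (etrans (chain_size cb) (esym (chain_size cb2))) E'; subst b2 c2.
  by rewrite (r _ _ _ (okl _ ca) cb' cb2') // -lb -lb2.
- move=> ss ss' tt tt' [a [b [b' [c [[-> ->] ca [cb cb'] lb [cc lc]]]]]].
  move=> [a2 [b2 [b2' [c2 [[-> ->] ca2 [cb2 cb2'] lb2 _]]]]].
  have sa : size (map keys a) = size (map keys a2).
    by rewrite !size_map (chain_size ca) (chain_size ca2).
  rewrite !map_cat; split=> /(eq_cat2 sa)[ka E].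
    have sb : size (map keys b) = size (map keys b2).
      by rewrite !size_map (chain_size cb) (chain_size cb2).
    have [kb ->] := eq_cat2 sb E; rewrite ka.
    by rewrite (main w w' a b b' a2 b2 b2').
  have sb : size (map keys b') = size (map keys b2').
    by rewrite !size_map (chain_size cb') (chain_size cb2').
  have [kb ->] := eq_cat2 sb E; rewrite ka.
  by rewrite (main w' w a b' b a2 b2' b2).
- move=> u ss ss' tt tt' cu [a [b [b' [c [[-> ->] ca [cb cb'] lb [cc lc]]]]]].
  move=> [a2 [b2 [b2' [c2 [[-> ->] ca2 [cb2 cb2'] lb2 [cc2 lc2]]]]]].
  have sa : size a = size a2 by rewrite (chain_size ca) (chain_size ca2).
  have sb : size b = size b2 by rewrite (chain_size cb) (chain_size cb2).
  have sb' : size b' = size b2' by rewrite (chain_size cb') (chain_size cb2').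
  have sc : size c = size c2 by rewrite (chain_size cc) (chain_size cc2).
  rewrite !map_cat => /eq_cat2; rewrite !size_map => /(_ sa)[ka] /eq_cat2.
  rewrite !size_map => /(_ sb)[kb kc].
  have kb' := main w w' a b b' a2 b2 b2' r' ca ca2 cb cb2 cb' cb2' lb lb2 ka kb.
  have kl : keys (last [::] a) = keys (last [::] a2) by apply: map_keys_last.
  have kl2 : keys (last (last [::] a) b) = keys (last (last [::] a2) b2).
    exact: map_keys_last.
  exists (lift_chain u a a2), (lift_chain u b b2), (lift_chain u b' b2'), (lift_chain u c c2).
  have la : last [::] (lift_chain u a a2) = lift_state u (last [::] a) (last [::] a2).
    by rewrite -last_lift.
  rewrite !la !lift_chain_cat // !last_lift // lb lb2 lc lc2; split=> //.
  + exact: (chain_lift cu ca ca2).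
  + by split; apply: chain_lift.
  + by split=> //; apply: chain_lift.
Qed.

End States.

Arguments keys {X S G} σ.

(** * The local moves *)

Local Open Scope nat_scope.
Local Open Scope shadow_scope.

Section LocalMoves.

Variables (X : virtual_birack) (S : shadow X) (G : shadow_module S).
Local Notation edge := (edge G).
Local Notation state := (state G).
Local Notation local_equiv := (@local_equiv X S G).
Local Notation rigid := (@rigid X S G).
Local Notation subsumes := (@subsumes X S G).
Local Notation chain := (@chain X S G).
Local Notation event_rel := (@event_rel X S G).
Implicit Types (s : strand_state G) (σ τ : state) (ss : seq state) (w : seq tile).

Lemma chain2 A t t' σ ss : chain A [:: t; t'] σ ss <->
  exists σ1 σ2, [/\ ss = [:: σ1; σ2], event_rel A t.1 t.2 σ σ1 & event_rel A t'.1 t'.2 σ1 σ2].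
Proof.
split; last by move=> [σ1 [σ2 [-> h h']]].
by case: ss => [|σ1 [|σ2 [|? ?]]] //= [h] // [h'] // _; exists σ1, σ2.
Qed.

Lemma rigid2 A ds t t' :
  (forall σ σ1 σ1' τ, event_rel A t.1 t.2 σ σ1 -> event_rel A t.1 t.2 σ σ1' ->
     event_rel A t'.1 t'.2 σ1 τ -> event_rel A t'.1 t'.2 σ1' τ -> σ1 = σ1') ->
  rigid A ds [:: t; t'].
Proof.
move=> H σ ss ss' _ /chain2[σ1 [σ2 [-> a b]]] /chain2[σ1' [σ2' [-> c d]]] /= e.
by subst σ2'; rewrite (H _ _ _ _ a c b d).
Qed.

Lemma subsumes2 A ds t1 t2 t3 t4 :
  (forall σ σ1 τ, ok A ds σ -> event_rel A t1.1 t1.2 σ σ1 -> event_rel A t2.1 t2.2 σ1 τ ->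
     exists2 σ2, event_rel A t3.1 t3.2 σ σ2 & event_rel A t4.1 t4.2 σ2 τ) ->
  subsumes A ds [:: t1; t2] [:: t3; t4].
Proof.
move=> H σ ss o /chain2[σ1 [τ [-> a b]]]; have [σ2 c d] := H _ _ _ o a b.
by exists [:: σ2; τ] => //; apply/chain2; exists σ2, τ.
Qed.

Definition inputs (p : piece) : nat := match p with PMin _ => 0 | PKink => 1 | _ => 2 end.
Definition outputs (p : piece) : nat := match p with PMax => 0 | PKink => 1 | _ => 2 end.

(** The two events touch different strands, so their relations do not interact;
    only the regions between the strands have to be followed. *)
Lemma exchange_up A p p' k σ σ1 τ :
  event_rel A (inputs p + k) p' σ σ1 -> event_rel A 0 p σ1 τ ->
  exists2 σ2, event_rel A 0 p σ σ2 & event_rel A (outputs p + k) p' σ2 τ.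
Proof.
case: p => [o||d|] /=.
- move=> h [e eA ->]; exists [:: (o, e), (~~ o, e) & σ]; first by exists e.
  rewrite /= /sleft /sright /= page_left_neg page_right_neg eA.
  by split=> //; split.
- case: σ => [|s1 [|s2 σ]]; case: σ1 => [|[b e] [|[b' e'] σ1]] //=; first by case.
  move=> [<- eA [<- eA' h]] [ea q1 q2 ->]; subst b' e'; exists σ => //.
  by move: h; rewrite /sright /= page_right_neg ea.
- case: σ => [|s1 [|s2 σ]]; case: σ1 => [|[b1 e1] [|[b2 e2] σ1]] //=; first by case.
  move=> [<- eA [<- eA' h]].
  case: τ => [|[b3 e3] [|[b4 e4] τ]] //= [ea -> -> -> c].
  exists [:: (b2, e3), (b1, e4) & σ] => //=.
  have [p1 p2 p3 p4] := crossing_pages c.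
  by move: h; rewrite /sleft /sright /= -p3 ea p2 -p4.
- case: σ => [|s1 σ]; case: σ1 => [|[b e] σ1] //= [<- eA h] [ea ->].
  exists ((b, pass b 1 e) :: σ) => //=.
  by move: h; rewrite /sleft /sright /= page_left_pass page_right_pass.
Qed.

Lemma exchange_down A p p' k σ σ2 τ :
  event_rel A 0 p σ σ2 -> event_rel A (outputs p + k) p' σ2 τ ->
  exists2 σ1, event_rel A (inputs p + k) p' σ σ1 & event_rel A 0 p σ1 τ.
Proof.
case: p => [o||d|] /=.
- move=> [e eA ->] /=; case: τ => [|s1 [|s2 τ]]; [by [] | by case | ].
  move=> [-> _ [-> _ h]]; exists τ; last by exists e.
  by move: h; rewrite /sright /= page_right_neg eA.
- case: σ => [|[b e] [|[b' e'] σ]] //= [ea -> -> ->] h.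
  exists [:: (b, e), (~~ b, e) & τ] => //=.
  by rewrite /sleft /sright /= page_left_neg page_right_neg ea; split=> //; split.
- case: σ => [|[b1 e1] [|[b2 e2] σ]] //; case: σ2 => [|[b3 e3] [|[b4 e4] σ2]] //=.
  move=> [ea -> -> -> c]; case: τ => [|s1 [|s2 τ]]; [by [] | by case | ].
  move=> [-> _ [-> _ h]]; have [p1 p2 p3 p4] := crossing_pages c.
  exists [:: (b1, e1), (b2, e2) & τ] => //=.
  by move: h; rewrite /sleft /sright /= -p4 ea p1.
- case: σ => [|[b e] σ] //= [ea ->] /=; case: τ => [|s1 τ] // [-> _ h].
  exists ((b, e) :: τ) => //=.
  by move: h; rewrite /sleft /sright /= page_right_pass.
Qed.

(** Distant events commute. The state between them is determined by the bottom
    on the strands of the second event and by the top on those of the first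
    one, whence the rigidity. *)
Lemma local_exchange p p' k ds :
  local_equiv ds [:: ((inputs p + k)%N, p'); (0, p)]
                 [:: (0, p); ((outputs p + k)%N, p')].
Proof.
move=> A; split.
- apply: rigid2 => σ σ1 σ1' τ a b c d.
  case fp: (forward p'); first exact: event_det fp a b.
  case bp: (backward p); first exact: event_codet bp c d.
  case: p' fp a b => // o _ a b; case: p bp a b c d => //= _.
  case: σ => [|s1 [|s2 σ]]; case: σ1 => [|[b1 e1] [|[b2 e2] σ1]] //=; first by move=> [].
  case: σ1' => [|[b3 e3] [|[b4 e4] σ1']] //=.
  by move=> [q1 _ [q2 _ _]] [q3 _ [q4 _ _]] [_ _ _ r1] [_ _ _ r2]; congruence.
- apply: rigid2 => σ σ1 σ1' τ a b c d.
  case fp: (forward p); first exact: event_det fp a b.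
  case bp: (backward p'); first exact: event_codet bp c d.
  case: p fp a b c d => // o _; case: p' bp => //= _ [e _ ->] [e' _ ->] /=.
  by case: τ => [|s1 τ] // [-> _ _] [[-> _ _]].
- by apply: subsumes2 => σ σ1 τ _; apply: exchange_up.
- by apply: subsumes2 => σ σ2 τ _; apply: exchange_down.
Qed.

Lemma rigid_nil A ds : rigid A ds [::].
Proof. by move=> σ [|? ?] [|? ?]. Qed.

Lemma chain_nil A σ ss : chain A [::] σ ss -> ss = [::].
Proof. by case: ss. Qed.

(** The edge of a minimum is the same on both its branches, so a zigzag repeats
    the edge of its strand. *)
Lemma local_zigzagL o ds : local_equiv (~~ o :: ds) [:: (1, PMin o); (0, PMax)] [::].
Proof.
move=> A; split; [| exact: rigid_nil | | ].
- apply: rigid2 => σ σ1 σ1' τ /=; case: σ => [|[b e] σ] //.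
  case: σ1 => [|s1 σ1] // [-> _ [f _ ->]]; case: σ1' => [|s2 σ1'] // [-> _ [f' _ ->]].
  by case=> _ _ -> _ [_ _ ->].
- move=> [|[b e] σ] ss [] // [eb _] _ /chain2[σ1 [τ [-> /=]]].
  by case: σ1 => [|s1 σ1] // [-> _ [f _ ->]] [_ _ -> ->]; exists [::] => //=; rewrite eb.
- move=> [|[b e] σ] ss [] // [eb _] [eA co] /chain_nil ->; subst b.
  exists [:: [:: (~~ o, e), (o, e), (~~ o, e) & σ]; (~~ o, e) :: σ] => //=.
  split; first by split=> //; exists e => //; rewrite /sright /= page_right_neg.
  by split=> //; split=> //; rewrite negbK.
Qed.

Lemma local_zigzagR o ds : local_equiv (o :: ds) [:: (0, PMin o); (1, PMax)] [::].
Proof.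
move=> A; split; [| exact: rigid_nil | | ].
- apply: rigid2 => σ σ1 σ1' τ /= [f _ ->] [f' _ ->].
  by case: τ => [|s τ] // [-> _ _] [[->]].
- move=> [|[b e] σ] ss [] // [eb _] _ /chain2[σ1 [τ [-> /= [f _ ->] /=]]].
  by case: τ => [|s τ] // [-> _ [_ _ -> ->]]; subst b; exists [::].
- move=> [|[b e] σ] ss [] // [eb _] [eA co] /chain_nil ->; subst b.
  exists [:: [:: (o, e), (~~ o, e), (o, e) & σ]; (o, e) :: σ] => //=.
  split; first by exists e.
  by split=> //; split=> //; split; rewrite ?negbK // page_left_neg.
Qed.

(** Sliding a crossing around a minimum turns it by a quarter. *)
Lemma local_slide_min o a ds :
  local_equiv ds [:: (0, PMin o); (1, PCross a)] [:: (1, PMin o); (0, PCross (mirror a))].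
Proof.
move=> A; split; try exact: backward_rigid.
- apply: subsumes2 => σ σ1 τ [_ co] /= [f fA ->].
  case: σ co => [|[b s] σ] /=; first by case: τ => [|? ?] // _ [_ _ []].
  move=> [eA co]; case: τ => [|u τ] // [-> _].
  case: τ => [|[b3 s'] [|[b4 v] τ]] //= [_ -> -> -> c]; exists [:: (b, s), (o, v), (~~ o, v) & σ].
    split=> //; exists v => //; have [_ _ _ p4] := crossing_pages c.
    by rewrite /sright /= p4 page_right_neg.
  split=> //; have := crossing_quarter a (~~ o) b f s s' v.
  by rewrite negbK => ->.
- apply: subsumes2 => σ σ1 τ _; case: σ => [|[b s] σ] //=; case: σ1 => [|s1 σ1] //.
  move=> [-> eA [v ev ->]]; case: τ => [|[b3 f] [|[b4 s'] τ]] //= [_ -> -> -> c].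
  have [p1 p2 p3 p4] := crossing_pages c.
  have fA : page_left o f = A by rewrite -p3.
  exists [:: (o, f), (~~ o, f), (b, s) & σ]; first by exists f.
  split=> //; split=> //; first by rewrite page_left_neg.
  by have := crossing_quarter a (~~ o) b f s s' v; rewrite negbK => <-.
Qed.

Lemma local_slide_max a ds :
  local_equiv ds [:: (1, PCross a); (0, PMax)] [:: (0, PCross (mirror a)); (1, PMax)].
Proof.
move=> A; split; try exact: forward_rigid.
- apply: subsumes2 => σ σ1 τ [_ co] /=.
  case: σ co => [|[b1 e1] σ] //= [eA co]; case: σ1 => [|s1 σ1] // [-> _].
  case: σ co => [|[b2 e2] [|[b3 e3] σ]] //= [eB _].
  case: σ1 => [|[b4 f] [|[b5 g] σ1]] //= [_ -> -> -> c] [_ eb ef ->]; subst f b3.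
  have [p1 p2 p3 p4] := crossing_pages c.
  have c' : crossing (mirror a) b1 b2 e1 e2 g e3.
    by apply/crossing_quarter; case: (a) c.
  have [q1 q2 q3 q4] := crossing_pages c'.
  exists [:: (b2, g), (b1, e3), (~~ b1, e3) & σ] => //=.
  by split=> //; rewrite /sleft -?q3.
- apply: subsumes2 => σ σ1 τ [_ co] /=.
  case: σ co => [|[b1 e1] [|[b2 e2] σ]] //= [eA [eB _]].
  case: σ1 => [|[b3 e3] [|[b4 e4] σ1]] //= [_ -> -> -> c].
  case: τ => [|s τ] // [-> _].
  case: σ => [|[b5 e5] σ] // [q -> e ->]; subst e5.
  have [q1 q2 q3 q4] := crossing_pages c.
  exists [:: (b1, e1), (~~ b1, e1), (b2, e3) & σ] => //=.
  split=> //; split=> //.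
  by have /crossing_quarter := c; case: (a).
Qed.

Lemma local_twist a b1 b2 ds :
  local_equiv [:: b1, b2 & ds] [:: (0, PCross a); (0, PCross (mirror a))] [::].
Proof.
move=> A; split; try exact: forward_rigid.
- move=> [|[b e] [|[b' e'] σ]] ss [] // _ _ /chain2[σ1 [τ [-> /=]]].
  case: σ1 => [|[b3 e3] [|[b4 e4] σ1]] //= [_ -> -> -> c].
  case: τ => [|[b5 e5] [|[b6 e6] τ]] //= [_ -> -> -> /crossing_turn].
  by move=> c'; have [-> ->] := crossing_codet c c'; exists [::].
- move=> [|[b e] [|[b' e'] σ]] ss [] // _ [eA [eB co]] /chain_nil ->.
  have [e3 [e4 c]] := crossing_ex a (esym eB : page_right b e = page_left b' e').
  have [_ _ p3 _] := crossing_pages c.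
  exists [:: [:: (b', e3), (b, e4) & σ]; [:: (b, e), (b', e') & σ]] => //=.
  split=> //; split=> //; split=> //; first by rewrite -p3.
  exact/crossing_turn.
Qed.

Lemma chain3 A t t' t'' σ ss : chain A [:: t; t'; t''] σ ss <->
  exists σ1 σ2 σ3, [/\ ss = [:: σ1; σ2; σ3], event_rel A t.1 t.2 σ σ1,
    event_rel A t'.1 t'.2 σ1 σ2 & event_rel A t''.1 t''.2 σ2 σ3].
Proof.
split; last by move=> [σ1 [σ2 [σ3 [-> h h' h'']]]].
case: ss => [|σ1 ss] // [h /chain2[σ2 [σ3 [-> h' h'']]]].
by exists σ1, σ2, σ3.
Qed.

Lemma local_triangle a b d ds : triangle_ok a b d ->
  local_equiv ds [:: (0, PCross a); (1, PCross b); (0, PCross d)]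
                 [:: (1, PCross d); (0, PCross b); (1, PCross a)].
Proof.
move=> tok A; split; try exact: forward_rigid.
- move=> σ ss [_ co] /chain3[σ1 [σ2 [σ3 [-> /=]]]].
  case: σ co => [|[t1 e1] [|[t2 e2] σ]] //= [eA [eB co]].
  case: σ1 => [|[t3 m] [|[t4 n] σ1]] //= [_ -> -> -> c1].
  case: σ2 => [|s2 σ2] // [-> _]; case: σ co => [|[t5 e3] σ] // [eC _].
  case: σ2 => [|[t6 k] [|[t7 f3] σ2]] //= [_ -> -> -> c2].
  case: σ3 => [|[t8 f1] [|[t9 f2] σ3]] //= [_ -> -> -> c3].
  have /(braid_all t1 t2 t5 tok)[m' [n' [k' [d1 d2 d3]]]] :
    left_triangle a b d t1 t2 t5 e1 e2 e3 f1 f2 f3 by exists m, n, k.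
  have [p1 p2 p3 p4] := crossing_pages d1; have [q1 q2 q3 q4] := crossing_pages d2.
  have [r1 r2 r3 r4] := crossing_pages d3.
  exists [:: [:: (t1, e1), (t5, m'), (t2, n') & σ]; [:: (t5, f1), (t1, k'), (t2, n') & σ];
             [:: (t5, f1), (t2, f2), (t1, f3) & σ]] => //.
  by rewrite /= /sleft /sright /= -q3 q2.
- move=> σ ss [_ co] /chain3[σ1 [σ2 [σ3 [-> /=]]]].
  case: σ co => [|[t1 e1] σ] //= [eA co]; case: σ1 => [|s1 σ1] // [-> _].
  case: σ co => [|[t2 e2] [|[t5 e3] σ]] //= [eB [eC _]].
  case: σ1 => [|[t3 m] [|[t4 n] σ1]] //= [_ -> -> -> d1].
  case: σ2 => [|[t6 f1] [|[t7 k] σ2]] //= [_ -> -> -> d2].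
  case: σ3 => [|s3 σ3] // [-> _].
  case: σ3 => [|[t8 f2] [|[t9 f3] σ3]] //= [_ -> -> -> d3].
  have /(braid_all t1 t2 t5 tok)[m' [n' [k' [c1 c2 c3]]]] :
    right_triangle a b d t1 t2 t5 e1 e2 e3 f1 f2 f3 by exists m, n, k.
  have [p1 p2 p3 p4] := crossing_pages c1; have [q1 q2 q3 q4] := crossing_pages c2.
  have [r1 r2 r3 r4] := crossing_pages c3.
  exists [:: [:: (t2, m'), (t1, n'), (t5, e3) & σ]; [:: (t2, m'), (t5, k'), (t1, f3) & σ];
             [:: (t5, f1), (t2, f2), (t1, f3) & σ]] => //.
  by rewrite /= /sleft /sright /= -p3 p2.
Qed.

Lemma chain_marks n A b e σ : page_left b e = A ->
  exists2 ss, chain A (nseq n (0, PKink)) ((b, e) :: σ) ss &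
              last ((b, e) :: σ) ss = (b, pass b n e) :: σ.
Proof.
elim: n e => [|n IH] e eA; first by exists [::]; rewrite //= pass0.
have [|ss c l] := IH (pass b 1 e); first by rewrite page_left_pass.
exists (((b, pass b 1 e) :: σ) :: ss) => //=.
by rewrite l -passD addn1.
Qed.

Lemma chain_marks_last n A b e σ ss : page_left b e = A ->
  chain A (nseq n (0, PKink)) ((b, e) :: σ) ss ->
  last ((b, e) :: σ) ss = (b, pass b n e) :: σ.
Proof.
move=> eA c; have [ss' c' <-] := chain_marks n σ eA.
by rewrite (forward_chain _ c c') // all_nseq orbT.
Qed.

Lemma marks_rigid n A ds : rigid A ds (nseq n (0, PKink)).
Proof. by apply: forward_rigid; rewrite all_nseq orbT. Qed.

Lemma local_marks_rank b ds :
  local_equiv (b :: ds) (nseq (birack_rank X) (0, PKink)) [::].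
Proof.
move=> A; split; [exact: marks_rigid | exact: rigid_nil | | ].
- move=> [|[b' e] σ] ss [] // _ [eA _] c; exists [::] => //.
  by rewrite (chain_marks_last eA c) pass_rank.
- move=> [|[b' e] σ] ss [] // _ [eA _] /chain_nil ->.
  by have [ss' c l] := chain_marks (birack_rank X) σ eA; exists ss'; rewrite // l pass_rank.
Qed.

(** The loop of the kink is unknown to both ends of the word, but there is only
    one edge that fits. *)
Lemma local_kinkR a o ds :
  local_equiv (o :: ds) [:: (1, PMin o); (0, PCross a); (1, PMax)]
                        (nseq (kink_weight X a) (0, PKink)).
Proof.
have inv A e σ ss : chain A [:: (1, PMin o); (0, PCross a); (1, PMax)] ((o, e) :: σ) ss ->
    exists q k, crossing a o o e q k q /\
      ss = [:: [:: (o, e), (o, q), (~~ o, q) & σ]; [:: (o, k), (o, q), (~~ o, q) & σ];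
               (o, k) :: σ].
  move=> /chain3[σ1 [σ2 [σ3 [-> /=]]]].
  case: σ1 => [|s1 σ1] // [-> eA [q eq ->]].
  case: σ2 => [|[b3 k] [|[b4 q'] σ2]] //= [_ -> -> -> c].
  case: σ3 => [|s σ3] // [-> _ [_ _ ee ->]]; subst q'.
  by exists q, k.
move=> A; split; [ | exact: marks_rigid | | ].
- move=> [|[b e] σ] ss ss' [] // [-> _] _ /inv[q [k [c ->]]] /inv[q' [k' [c' ->]]] _.
  by have [-> ->] := kinkR_uniq c c'.
- move=> [|[b e] σ] ss [] // [-> _] [eA _] /inv[q [k [c ->]]].
  have [ss' c' l] := chain_marks (kink_weight X a) σ eA.
  exists ss' => //; rewrite l /=; have [q' d] := kinkR_ex a o e.
  by have [_ ->] := kinkR_uniq c d.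
- move=> [|[b e] σ] ss [] // [-> _] [eA _] c; have [q d] := kinkR_ex a o e.
  have [p1 p2 p3 p4] := crossing_pages d.
  set k := pass o (kink_weight X a) e in d p2 p3.
  exists [:: [:: (o, e), (o, q), (~~ o, q) & σ]; [:: (o, k), (o, q), (~~ o, q) & σ];
               (o, k) :: σ]; last by rewrite (chain_marks_last eA c).
  rewrite /= /sleft /sright /=; split; first by split=> //; exists q.
  by split=> //; split=> //; split=> //; rewrite -p3.
Qed.

Lemma local_kinkL a o ds :
  local_equiv (~~ o :: ds) [:: (0, PMin o); (1, PCross a); (0, PMax)]
                        (nseq (kink_weight X a) (0, PKink)).
Proof.
have inv A e σ ss : chain A [:: (0, PMin o); (1, PCross a); (0, PMax)] ((~~ o, e) :: σ) ss ->
    exists q k, crossing a (~~ o) (~~ o) q e q k /\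
      ss = [:: [:: (o, q), (~~ o, q), (~~ o, e) & σ]; [:: (o, q), (~~ o, q), (~~ o, k) & σ];
               (~~ o, k) :: σ].
  move=> /chain3[σ1 [σ2 [σ3 [-> /= [q eq ->]]]]].
  case: σ2 => [|s2 σ2] // [-> _].
  case: σ2 => [|[b3 q'] [|[b4 k] σ2]] //= [_ -> -> -> c] [_ _ ee ->]; subst q'.
  by exists q, k.
move=> A; split; [ | exact: marks_rigid | | ].
- move=> [|[b e] σ] ss ss' [] // [-> _] _ /inv[q [k [c ->]]] /inv[q' [k' [c' ->]]] _.
  by have [-> ->] := kinkL_uniq c c'.
- move=> [|[b e] σ] ss [] // [-> _] [eA _] /inv[q [k [c ->]]].
  have [ss' c' l] := chain_marks (kink_weight X a) σ eA.
  exists ss' => //; rewrite l /=; have [q' d] := kinkL_ex a (~~ o) e.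
  by have [_ ->] := kinkL_uniq c d.
- move=> [|[b e] σ] ss [] // [-> _] [eA _] c; have [q d] := kinkL_ex a (~~ o) e.
  have [p1 p2 p3 p4] := crossing_pages d.
  set k := pass (~~ o) (kink_weight X a) e in d p2 p4.
  have qA : page_left o q = A by rewrite -page_right_neg p1.
  exists [:: [:: (o, q), (~~ o, q), (~~ o, e) & σ]; [:: (o, q), (~~ o, q), (~~ o, k) & σ];
               (~~ o, k) :: σ]; last by rewrite (chain_marks_last eA c).
  rewrite /= /sleft /sright /=; split; first by exists q.
  by split=> //; split=> //; split=> //; rewrite page_left_neg.
Qed.

Lemma local_mark_cross1 a ds :
  local_equiv ds [:: (0, PKink); (0, PCross a)] [:: (0, PCross a); (1, PKink)].
Proof.
move=> A; split; try exact: forward_rigid.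
- apply: subsumes2 => σ σ1 τ _ /=; case: σ => [|[b e] [|[b' e'] σ]] //= [eA ->] //=.
  case: τ => [|[b3 e3] [|[b4 e4] τ]] //= [_ -> -> -> c].
  have [p1 p2 p3 p4] := crossing_pages c; rewrite page_right_pass in p1.
  have [d3 [d4 d]] := crossing_ex a p1.
  have [-> ->] := crossing_det c (crossing_pass1 1 d).
  have [q1 q2 q3 q4] := crossing_pages d.
  exists [:: (b', d3), (b, d4) & σ] => //.
  by split=> //; rewrite /sleft /= -?q3 // ?q2.
- apply: subsumes2 => σ σ1 τ _ /=; case: σ => [|[b e] [|[b' e'] σ]] //.
  case: σ1 => [|[b3 e3] [|[b4 e4] σ1]] //= [eA -> -> -> c].
  case: τ => [|s τ] // [-> _ [_ ->]].
  exists [:: (b, pass b 1 e), (b', e') & σ] => //.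
  by split=> //; [rewrite page_left_pass | apply: crossing_pass1].
Qed.

Lemma local_mark_cross2 a ds :
  local_equiv ds [:: (1, PKink); (0, PCross a)] [:: (0, PCross a); (0, PKink)].
Proof.
move=> A; split; try exact: forward_rigid.
- apply: subsumes2 => σ σ1 τ _ /=; case: σ => [|[b e] σ] //; case: σ1 => [|s1 σ1] // [-> eA].
  case: σ => [|[b' e'] σ] // [_ ->] /=.
  case: τ => [|[b3 e3] [|[b4 e4] τ]] //= [_ -> -> -> c].
  have [p1 p2 p3 p4] := crossing_pages c; rewrite page_left_pass in p1.
  have [d3 [d4 d]] := crossing_ex a p1.
  have [-> ->] := crossing_det c (crossing_pass2 1 d).
  have [q1 q2 q3 q4] := crossing_pages d.
  by exists [:: (b', d3), (b, d4) & σ] => //=; rewrite -q3.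
- apply: subsumes2 => σ σ1 τ _ /=; case: σ => [|[b e] [|[b' e'] σ]] //.
  case: σ1 => [|[b3 e3] [|[b4 e4] σ1]] //= [eA -> -> -> c] [_ ->].
  have [q1 q2 q3 q4] := crossing_pages c.
  exists [:: (b, e), (b', pass b' 1 e') & σ] => //=.
  by split=> //; apply: crossing_pass2.
Qed.

(** In the equation between the two branches, a kink map on one side is its
    inverse on the other, and this is what a mark is there, because the
    branches have opposite directions. *)
Lemma local_mark_max ds :
  local_equiv ds [:: (0, PKink); (0, PMax)] [:: (1, PKink); (0, PMax)].
Proof.
move=> A; split; try exact: forward_rigid.
- apply: subsumes2 => σ σ1 τ [_ co] /=; case: σ co => [|[b e] [|[b' e'] σ]] //= co [eA ->] //.
  move=> [_ -> -> ->]; exists [:: (b, e), (~~ b, e) & σ] => //.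
  split=> //; split; first by rewrite page_left_pass page_left_neg.
  by rewrite pass_neg.
- apply: subsumes2 => σ σ1 τ _ /=; case: σ => [|[b e] σ] //; case: σ1 => [|s1 σ1] // [-> eA].
  case: σ => [|[b' e'] σ] // [_ ->] [_ eb ee ->]; subst b' e.
  exists [:: (b, e'), (~~ b, e') & σ] => //=.
    by split=> //; have := pass_neg (~~ b) e'; rewrite negbK => ->.
  by split=> //; rewrite -eA /sleft /= page_left_pass.
Qed.

Lemma local_mark_min o ds :
  local_equiv ds [:: (0, PMin o); (0, PKink)] [:: (0, PMin o); (1, PKink)].
Proof.
move=> A; split; try exact: backward_rigid.
- apply: subsumes2 => σ σ1 τ [_ co] /= [f fA ->] [_ ->].
  exists [:: (o, pass o 1 f), (~~ o, pass o 1 f) & σ].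
    by exists (pass o 1 f); rewrite ?page_left_pass.
  split=> //; first by rewrite /sleft /= page_left_pass.
  by rewrite pass_neg /sright /= page_left_pass page_right_pass page_left_neg.
- apply: subsumes2 => σ σ1 τ [_ co] /= [f fA ->]; case: τ => [|s τ] // [-> _ [_ ->]].
  have E : pass o 1 (pass (~~ o) 1 f) = f by have := pass_neg (~~ o) f; rewrite negbK.
  exists [:: (o, pass (~~ o) 1 f), (~~ o, pass (~~ o) 1 f) & σ].
    by exists (pass (~~ o) 1 f); rewrite ?page_left_pass.
  by rewrite E page_left_pass.
Qed.

End LocalMoves.

(** * Diagrams with kink marks *)

Local Open Scope nat_scope.

Definition bare c (e : event c) : piece :=
  match e with Min o _ => PMin o | Max => PMax | Cross a => PCross a end.
Definition tile_of c (e : slice c) : tile := (e.1, bare e.2).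

(** Marks are given by the levels and the positions of their strands. *)
Definition marks_at (ms : seq (nat * nat)) (l : nat) : seq tile :=
  [seq (p.2, PKink) | p <- ms & p.1 == l].

Fixpoint tiles c (ms : seq (nat * nat)) (l : nat) (w : word c) : seq tile :=
  marks_at ms l ++ if w is e :: w' then tile_of e :: tiles ms l.+1 w' else [::].

(** The word without the marks on its topmost level, where the next part of a
    diagram begins. *)
Fixpoint tiles_below c (ms : seq (nat * nat)) (l : nat) (w : word c) : seq tile :=
  if w is e :: w' then marks_at ms l ++ tile_of e :: tiles_below ms l.+1 w' else [::].

Section Tiles.

Variable c : nat.
Implicit Types (u v w : word c) (ms : seq (nat * nat)).

Lemma tiles_cat ms l u v :
  tiles ms l (u ++ v) = tiles_below ms l u ++ tiles ms (l + size u) v.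
Proof.
elim: u l => [|e u IH] l /=; first by rewrite addn0.
by rewrite IH -catA /= addSnnS.
Qed.

Lemma marks_at_cat ms ms' l : marks_at (ms ++ ms') l = marks_at ms l ++ marks_at ms' l.
Proof. by rewrite /marks_at filter_cat map_cat. Qed.

Lemma marks_at_cons p ms l :
  marks_at (p :: ms) l = (if p.1 == l then [:: (p.2, PKink)] else [::]) ++ marks_at ms l.
Proof. by rewrite /marks_at /=; case: ifP. Qed.

Lemma marks_at_out ms l : all (fun p => p.1 != l) ms -> marks_at ms l = [::].
Proof.
rewrite /marks_at => /allP h; rewrite (_ : filter _ ms = [::]) //.
by apply/eqP; rewrite -(negbK (_ == _)) -has_filter; apply/hasPn => p /h.
Qed.

Lemma marks_at_same l js : marks_at [seq (l, j) | j <- js] l = [seq (j, PKink) | j <- js].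
Proof. by elim: js => //= j js IH; rewrite /marks_at /= eqxx /= -IH. Qed.

Lemma tiles_below_out ms ms' l w : all (fun p => l + size w <= p.1) ms' ->
  tiles_below (ms ++ ms') l w = tiles_below ms l w.
Proof.
elim: w l => //= e w IH l h; rewrite IH; last by rewrite addSnnS.
rewrite marks_at_cat (@marks_at_out ms') ?cats0 //.
apply: sub_all h => p; rewrite addnS; apply: contraTneq => ->.
by rewrite -ltnNge ltnS leq_addr.
Qed.

Lemma tiles_out ms ms' l w : all (fun p => p.1 < l) ms ->
  tiles (ms ++ ms') l w = tiles ms' l w.
Proof.
elim: w l => [|e w IH] l h /=; rewrite marks_at_cat (@marks_at_out ms) //.
  by apply: sub_all h => p /ltn_eqF ->.
- by rewrite IH //; apply: sub_all h => p /ltnW.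
by apply: sub_all h => p /ltn_eqF ->.
Qed.

Lemma tiles_here l js ms w :
  tiles ([seq (l, j) | j <- js] ++ ms) l w = [seq (j, PKink) | j <- js] ++ tiles ms l w.
Proof.
have out : all (fun p => p.1 < l.+1) [seq (l, j) | j <- js].
  by rewrite all_map; apply/allP => j _ /=.
by case: w => [|e w] /=; rewrite marks_at_cat marks_at_same ?(tiles_out _ _ out) -?catA.
Qed.

Lemma tiles_below_outl ms ms' l w : all (fun p => l + size w <= p.1) ms' ->
  tiles_below (ms' ++ ms) l w = tiles_below ms l w.
Proof.
elim: w l => //= e w IH l h; rewrite IH; last by rewrite addSnnS.
rewrite marks_at_cat (@marks_at_out ms') //.
apply: sub_all h => p; rewrite addnS; apply: contraTneq => ->.
by rewrite -ltnNge ltnS leq_addr.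
Qed.

Lemma tiles_insert js ms u v :
  tiles ([seq (size u, j) | j <- js] ++ ms) 0 (u ++ v)
  = tiles_below ms 0 u ++ [seq (j, PKink) | j <- js] ++ tiles ms (size u) v.
Proof.
rewrite tiles_cat add0n tiles_here tiles_below_outl // all_map.
by apply/allP => j _ /=.
Qed.

(** If no mark lies inside the part w, then that part occurs unchanged in the
    word. *)
Lemma tiles_split msA msB u w v : all (fun p => p.1 <= size u) msA ->
    all (fun p => size u + size w <= p.1) msB ->
  tiles (msA ++ msB) 0 (u ++ w ++ v)
  = tiles_below msA 0 u ++ marks_at msA (size u) ++ map (@tile_of c) w
    ++ tiles msB (size u + size w) v.
Proof.
move=> hA hB; rewrite tiles_cat add0n; congr (_ ++ _).
  apply: tiles_below_out; apply: sub_all hB => p; apply: leq_trans.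
  by rewrite add0n leq_addr.
have key l z : all (fun p => p.1 <= l) msA -> all (fun p => l + size z <= p.1) msB ->
    tiles (msA ++ msB) l (z ++ v)
    = marks_at msA l ++ map (@tile_of c) z ++ tiles msB (l + size z) v.
  elim: z l => [|e z IH] l a b; rewrite ?addn0 /= in b *.
    case: v => [|e v] /=; rewrite marks_at_cat -catA //.
    by rewrite tiles_out.
  rewrite marks_at_cat -catA; congr (_ ++ _).
  rewrite (@marks_at_out msB) /=; last first.
    apply: sub_all b => p; apply: contraTneq => ->.
    by rewrite -ltnNge addnS ltnS leq_addr.
  rewrite IH; last 2 first.
  - by apply: sub_all a => p /leqW.
  - by rewrite addSnnS.
  rewrite (@marks_at_out msA) ?addSnnS //.
  by apply: sub_all a => p h; rewrite neq_ltn ltnS h.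
exact: key.
Qed.

Lemma tiles_shift ms l l' w :
  tiles [seq (l' + (p.1 - l), p.2) | p <- ms & l <= p.1] l' w = tiles [seq p <- ms | l <= p.1] l w.
Proof.
have E k : marks_at [seq (l' + (p.1 - l), p.2) | p <- ms & l <= p.1] (l' + k)
           = marks_at [seq p <- ms | l <= p.1] (l + k).
  elim: ms => //= p ms IH; case: ifP => // lp; rewrite !marks_at_cons IH /= eqn_add2l.
  by rewrite -(eqn_add2l l) subnKC.
have {}E k : tiles [seq (l' + (p.1 - l), p.2) | p <- ms & l <= p.1] (l' + k) w
           = tiles [seq p <- ms | l <= p.1] (l + k) w.
  by elim: w k => [|e w IH] k /=; rewrite E // -!addnS IH.
by have := E 0; rewrite !addn0.
Qed.

End Tiles.

Section Marks.

Variables (X : virtual_birack) (S : shadow X) (G : shadow_module S).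
Local Notation equi := (@equi X S G).
Local Notation local_equiv := (@local_equiv X S G).
Implicit Types (w V W : seq tile).

Lemma equi_refl w : equi w w.
Proof.
suff : equi (w ++ [::] ++ [::]) (w ++ [::] ++ [::]) by rewrite !cats0.
apply: equi_local => A; split; try exact: rigid_nil.
  by move=> σ ss _ c; exists ss.
by move=> σ ss _ c; exists ss.
Qed.

Lemma equi_any V w w' W : (forall ds, local_equiv ds w w') -> equi (V ++ w ++ W) (V ++ w' ++ W).
Proof. by move=> h; apply: equi_local. Qed.

Lemma event_out A i p (σ τ : state G) : size σ < i -> event_rel A i p σ τ -> False.
Proof.
elim: i A σ τ => [|i IH] A [|s σ] [|s' τ] //=.
by rewrite ltnS => lt [_ _]; apply: IH.
Qed.

(** Beyond the last strand there are no chains at all, so a replacement may be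
    shifted without any condition on the number of strands. *)
Lemma local_shift_any n t t' w w' : (forall ds, local_equiv ds (t :: w) (t' :: w')) ->
  forall ds, local_equiv ds (shift n (t :: w)) (shift n (t' :: w')).
Proof.
move=> h ds; have [le|lt] := leqP n (size ds).
  have := @local_equiv_shift _ _ _ (take n ds) _ _ _ (h (drop n ds)).
  by rewrite cat_take_drop size_takel.
have no z y A (σ : state G) ss : ok A ds σ -> chain A (shift n (z :: y)) σ ss -> False.
  case: ss => [|τ ss] // [e _] [h' _]; apply: (event_out _ h') => /=.
  by rewrite -(size_map fst) -/(dirs σ) e (leq_trans lt) // leq_addr.
by move=> A; split=> [σ ss ss' o c|σ ss ss' o c|σ ss o c|σ ss o c]; case: (no _ _ _ _ _ o c).
Qed.

Lemma swap_marks i j V W :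
  equi (V ++ [:: (i, PKink); (j, PKink)] ++ W) (V ++ [:: (j, PKink); (i, PKink)] ++ W).
Proof.
wlog lt : i j / i < j => [H|].
  by case: (ltngtP i j) => [/H //|/H /equi_sym //|->]; apply: equi_refl.
apply: equi_any => ds; apply: local_equiv_sym.
have /(local_shift_any i)/(_ ds) := @local_exchange X S G PKink PKink (j - i.+1).
by rewrite /shift /= addn0 addnA addn1 subnKC.
Qed.

Local Notation K := (map (fun i : nat => (i, PKink))).

Lemma move_mark i js V W :
  equi (V ++ (i, PKink) :: K js ++ W) (V ++ K js ++ (i, PKink) :: W).
Proof.
elim: js V => [|j js IH] V /=; first exact: equi_refl.
apply: equi_trans (swap_marks i j V (K js ++ W)) _.
by have := IH (rcons V (j, PKink)); rewrite !cat_rcons.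
Qed.

(** Marks on one level may be exchanged like distant events, and marks on the
    same strand are equal. *)
Lemma perm_marks js js' V W : perm_eq js js' -> equi (V ++ K js ++ W) (V ++ K js' ++ W).
Proof.
elim: js js' V => [|j js IH] js' V.
  by move=> /perm_size; case: js' => // _; apply: equi_refl.
move=> p; have jin : j \in js' by rewrite -(perm_mem p) mem_head.
move: p; case/path.splitPr: js' / jin => a b p.
have {}p : perm_eq js (a ++ b) by move: p; rewrite perm_sym -cat1s perm_catCA /= perm_cons perm_sym.
apply: (@equi_trans _ _ _ _ (V ++ (j, PKink) :: K (a ++ b) ++ W)).
  by have := IH _ (rcons V (j, PKink)) p; rewrite !cat_rcons.
by rewrite !map_cat /= -!catA; apply: move_mark.
Qed.

Variable c : nat.
Implicit Types (u v : word c) (ms : seq (nat * nat)).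

Lemma perm_tiles ms ms' v : perm_eq ms ms' -> equi (tiles ms 0 v) (tiles ms' 0 v).
Proof.
move=> p; suff H V l : equi (V ++ tiles ms l v) (V ++ tiles ms' l v) by apply: (H [::]).
have E l' V' W' : equi (V' ++ marks_at ms l' ++ W') (V' ++ marks_at ms' l' ++ W').
  have e ns : marks_at ns l' = K [seq p.2 | p <- ns & p.1 == l'].
    by rewrite /marks_at -map_comp.
  by rewrite !e; apply: perm_marks; apply/perm_map/perm_filter.
elim: v V l => [|e v IH] V l /=; first exact: E.
apply: equi_trans (E _ _ _) _; rewrite !catA -!cat_rcons; exact: IH.
Qed.

Lemma slide_marks_at i ms l V W w w' :
  (forall ds, local_equiv ds ((i, PKink) :: w) w') ->
  equi (V ++ (i, PKink) :: marks_at ms l ++ w ++ W) (V ++ marks_at ms l ++ w' ++ W).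
Proof.
move=> h; have e : marks_at ms l = K [seq p.2 | p <- ms & p.1 == l].
  by rewrite /marks_at -map_comp.
apply: (@equi_trans _ _ _ _ (V ++ marks_at ms l ++ (i, PKink) :: w ++ W)).
  by rewrite e; apply: move_mark.
by have := equi_any (V ++ marks_at ms l) W h; rewrite -!catA.
Qed.

Lemma tiles_below_rcons ms l u e :
  tiles_below ms l (rcons u e) = tiles_below ms l u ++ marks_at ms (l + size u) ++ [:: tile_of e].
Proof.
by elim: u l => [|e' u IH] l /=; rewrite ?addn0 ?cats0 // IH -!catA /= addSnnS.
Qed.

Lemma slide_up u e v i j ms :
  (forall ds, local_equiv ds [:: (i, PKink); tile_of e] [:: tile_of e; (j, PKink)]) ->
  equi (tiles ((size u, i) :: ms) 0 (u ++ e :: v))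
       (tiles (((size u).+1, j) :: ms) 0 (u ++ e :: v)).
Proof.
move=> h; have := tiles_insert [:: i] ms u (e :: v); rewrite /= => ->.
have := tiles_insert [:: j] ms (rcons u e) v; rewrite size_rcons cat_rcons /= => ->.
rewrite tiles_below_rcons add0n -!catA /=.
exact: (slide_marks_at ms (size u) _ _ h).
Qed.

Lemma slide_max u e v i j ms :
  (forall ds, local_equiv ds [:: (i, PKink); tile_of e] [:: (j, PKink); tile_of e]) ->
  equi (tiles ((size u, i) :: ms) 0 (u ++ e :: v))
       (tiles ((size u, j) :: ms) 0 (u ++ e :: v)).
Proof.
move=> h; have := tiles_insert [:: i] ms u (e :: v); rewrite /= => ->.
have := tiles_insert [:: j] ms u (e :: v); rewrite /= => ->.
have E ns : marks_at ns (size u) = map (fun i => (i, PKink)) [seq p.2 | p <- ns & p.1 == size u].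
  by rewrite /marks_at -map_comp.
apply: equi_trans (slide_marks_at ms (size u) _ _ h) _; rewrite E.
exact/equi_sym/move_mark.
Qed.

Lemma slide_min u e v i j ms :
  (forall ds, local_equiv ds [:: tile_of e; (i, PKink)] [:: tile_of e; (j, PKink)]) ->
  equi (tiles (((size u).+1, i) :: ms) 0 (u ++ e :: v))
       (tiles (((size u).+1, j) :: ms) 0 (u ++ e :: v)).
Proof.
move=> h; have := tiles_insert [:: i] ms (rcons u e) v; rewrite size_rcons cat_rcons /= => ->.
have := tiles_insert [:: j] ms (rcons u e) v; rewrite size_rcons cat_rcons /= => ->.
rewrite tiles_below_rcons.
have := equi_any (tiles_below ms 0 u ++ marks_at ms (0 + size u)) (tiles ms (size u).+1 v) h.
by rewrite -!catA.
Qed.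

End Marks.

(** * Sliding marks along components *)

Section Sliding.

Variables (X : virtual_birack) (S : shadow X) (G : shadow_module S).
Local Notation equi := (@equi X S G).
Local Notation local_equiv := (@local_equiv X S G).

Lemma local_mark_before i k p ds : i < k ->
  local_equiv ds [:: (i, PKink); (k, p)] [:: (k, p); (i, PKink)].
Proof.
move=> lt; apply: local_equiv_sym.
have /(local_shift_any i)/(_ ds) := @local_exchange X S G PKink p (k - i.+1).
by rewrite /shift /= addn0 addnA addn1 subnKC.
Qed.

Lemma local_mark_after k p j ds :
  local_equiv ds [:: (k + (inputs p + j), PKink); (k, p)]
                 [:: (k, p); (k + (outputs p + j), PKink)].
Proof.
have /(local_shift_any k)/(_ ds) := @local_exchange X S G p PKink j.
by rewrite /shift /= addn0.
Qed.

Variable c : nat.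
Implicit Types (w u v : word c) (ms : seq (nat * nat)).

Lemma onth_split (T : Type) (s : seq T) l x : onth s l = Some x ->
  exists s1 s2, s = s1 ++ x :: s2 /\ size s1 = l.
Proof.
elim: s l => [|y s IH] [|l] //= => [[->]|/IH[u [v [-> <-]]]]; first by exists [::], s.
by exists (y :: u), v.
Qed.

(** A mark moves along an arc, past the events that do not touch it and around
    the extrema, and through the crossings. *)
Lemma slide_step w (p q : point w) ms : arc_step p q || through_step p q ->
  equi (tiles (point_at p :: ms) 0 w) (tiles (point_at q :: ms) 0 w).
Proof.
rewrite /arc_step /through_step; case: (point_at p) (point_at q) => [l i] [l' j].
have up l0 e k k' : onth w l0 = Some e ->
    (forall ds, local_equiv ds [:: (k, PKink); tile_of e] [:: tile_of e; (k', PKink)]) ->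
    equi (tiles ((l0, k) :: ms) 0 w) (tiles ((l0.+1, k') :: ms) 0 w).
  by move=> E h; have [u [v [-> <-]]] := onth_split E; apply: slide_up.
case/orP=> [/or3P[] |].
- case/andP=> /eqP-> {l'}; case E : (onth w l) => [[k [o m||d]]|] //.
  + move=> /eqP-> {j}; case: ltnP => [lt|le]; apply: (up _ _ _ _ E) => ds.
      exact: local_mark_before.
    have := local_mark_after k (PMin o) (i - k) ds.
    by rewrite /= add0n addnCA !subnKC // add2n.
  + move=> /eqP-> {i}; case: ltnP => [lt|le]; apply: (up _ _ _ _ E) => ds.
      exact: local_mark_before.
    have := local_mark_after k PMax (j - k) ds.
    by rewrite /= add0n addnCA !subnKC // add2n.
  + case/and3P=> /eqP-> ik ik1; apply: (up _ _ _ _ E) => ds.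
    case: (ltnP i k) => [|le]; first exact: local_mark_before.
    have lt : k.+1 < i.
      by rewrite ltn_neqAle eq_sym ik1 ltn_neqAle eq_sym ik.
    have := local_mark_after k (PCross d) (i - k.+2) ds.
    by rewrite /= addnA addn2 subnKC.
- case/and3P=> /eqP-> /eqP->; case E : (onth w l) => [[k [o m||d]]|] // /eqP->.
  have [u [v [-> <-]]] := onth_split E; apply: slide_max.
  by have := local_shift_any k (@local_mark_max X S G); rewrite /shift /= addn0 addn1.
- case/and4P=> /eqP-> /eqP-> l0.
  case E : (onth w l.-1) => [[k [o m||d]]|] // /eqP->.
  have [u [v [-> el]]] := onth_split E; rewrite -(prednK l0) -el; apply: slide_min.
  by have := local_shift_any k (@local_mark_min X S G o); rewrite /shift /= addn0 addn1.
case/andP=> /eqP->; case E : (onth w l) => [[k [o m||d]]|] //.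
case/orP=> /andP[/eqP-> /eqP->]; apply: (up _ _ _ _ E).
  by have := local_shift_any k (@local_mark_cross1 X S G d); rewrite /shift /= addn0 addn1.
by have := local_shift_any k (@local_mark_cross2 X S G d); rewrite /shift /= addn0 addn1.
Qed.

(** By definition, the steps along arcs and through crossings connect any two
    points of a component. *)
Lemma slide_component w (p q : point w) ms : same_component p q ->
  equi (tiles (point_at p :: ms) 0 w) (tiles (point_at q :: ms) 0 w).
Proof.
case/connectP=> s + -> {q}; elim: s p => [|r s IH] p /=; first by move=> _; apply: equi_refl.
case/andP=> st /IH; apply: equi_trans.
by case/orP: st => /slide_step; [apply | move=> h; apply: equi_sym].
Qed.

(** Positions off the diagram have no component. *)
Definition component w (p : nat * nat) : option 'I_c := omap snd (onth (row w p.1) p.2).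

Fixpoint fits_word (R : strand_row c) w : bool :=
  if w is e :: w' then fits R e && fits_word (after R e) w' else true.

Definition rows_after (R : strand_row c) w := foldl (@after c) R w.

Lemma fits_word_cat R u v :
  fits_word R (u ++ v) = fits_word R u && fits_word (rows_after R u) v.
Proof. by elim: u R => //= e u IH R; rewrite IH andbA. Qed.

Lemma link_diagram_fits w : link_diagram w -> fits_word [::] w.
Proof.
case=> H _ _ _; have {}H l e : onth w l = Some e -> fits (rows_after [::] (take l w)) e.
  exact: H.
elim: w [::] H => //= e w IH R H; rewrite (H 0 e) //=.
by apply: IH => l e' E; apply: (H l.+1).
Qed.

Lemma component_point w p k : row w (size w) = [::] -> component w p = Some k ->
  exists2 q : point w, point_at q = p & (strand q).2 = k.
Proof.
case: p => l i rw; rewrite /component /=; case E: (onth _ i) => [s|] //= [<-].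
have ll : l < (size w).+1.
  rewrite ltnNge; apply/negP => lt; move: E.
  suff -> : row w l = [::] by rewrite onth0n.
  by rewrite -[RHS]rw /row !take_oversize // ltnW.
have ii : i < size (row w l) by rewrite -onthTE E.
exists (Tagged (fun m : 'I_(size w).+1 => 'I_(size (row w m))) (i := Ordinal ll) (Ordinal ii)) => //.
rewrite /strand /= (tnth_nth s) /=; congr snd; exact: onth_nth E.
Qed.

Definition marks_ok w ms := all (fun p => component w p != None) ms.
Definition total w k ms := count (fun p => component w p == Some k) ms.

Lemma after_cons x (R : strand_row c) i (e : event c) :
  after (x :: R) (i.+1, e) = x :: after R (i, e).
Proof. by []. Qed.

Lemma fits_cons x (R : strand_row c) i (e : event c) :
  fits (x :: R) (i.+1, e) = fits R (i, e).
Proof. by case: e. Qed.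

Lemma dirs_after_fits (R : strand_row c) e : fits R e ->
  dirs_after (map fst R) e.1 (bare e.2) = map fst (after R e).
Proof.
case: e => i ev; elim: i R => [|i IH] R.
  case: ev => [o k||d] //=; rewrite /fits /after /= ?take0 ?drop0 //.
    by case: R => [|[b k] [|[b' k'] R]].
  by case: R => [|[b k] [|[b' k'] R]].
case: R => [|x R]; first by case: ev {IH}.
by rewrite fits_cons after_cons => /IH /= ->.
Qed.

Lemma dirs_after_marks i ds : dirs_after ds i PKink = ds.
Proof. by elim: i ds => [|i IH] [|b ds] //=; rewrite IH. Qed.

Local Notation dirs_along := (foldl (fun ds (t : tile) => dirs_after ds t.1 t.2)).

Lemma dirs_along_marks ms l ds : dirs_along ds (marks_at ms l) = ds.
Proof.
rewrite /marks_at; elim: (filter _ ms) => //= p s IH.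
by rewrite dirs_after_marks.
Qed.

Lemma dirs_along_tiles ms l (R : strand_row c) u : fits_word R u ->
  dirs_along (map fst R) (tiles_below ms l u) = map fst (rows_after R u).
Proof.
elim: u R l => //= e u IH R l /andP[fe fu].
by rewrite foldl_cat dirs_along_marks /= dirs_after_fits // IH.
Qed.

Variable w : word c.
Hypothesis wok : link_diagram w.

Lemma slide_mark p q k ms : component w p = Some k -> component w q = Some k ->
  equi (tiles (p :: ms) 0 w) (tiles (q :: ms) 0 w).
Proof.
have [_ ew _ co] := wok => hp hq.
have [p' <- kp] := component_point ew hp; have [q' <- kq] := component_point ew hq.
by apply: slide_component; apply/co; rewrite kp kq.
Qed.

Lemma slide_marks p k s ms : component w p = Some k ->
  all (fun q => component w q == Some k) s ->
  equi (tiles (s ++ ms) 0 w) (tiles (nseq (size s) p ++ ms) 0 w).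
Proof.
move=> hp; elim: s ms => [|q s IH] ms /=; first by move=> _; apply: equi_refl.
case/andP=> /eqP hq /IH h; apply: equi_trans (slide_mark _ hq hp) _.
have pc t : perm_eq (p :: t ++ ms) (t ++ p :: ms).
  by rewrite -cat1s -[p :: ms]cat1s perm_catCA.
apply: equi_trans (perm_tiles G w (pc s)) _; apply: equi_trans (h _) _.
by apply: perm_tiles; rewrite perm_sym.
Qed.

Lemma remove_rank_marks p ms : component w p != None ->
  equi (tiles (nseq (birack_rank X) p ++ ms) 0 w) (tiles ms 0 w).
Proof.
case: p => l i; rewrite /component /=; case E : (onth _ i) => [s|] // _.
have ll : l <= size w.
  rewrite leqNgt; apply/negP => lt; move: E.
  have [_ ew _ _] := wok; suff -> : row w l = [::] by rewrite onth0n.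
  by rewrite -[RHS]ew /row !take_oversize // ltnW.
have := link_diagram_fits wok; rewrite -{1}(cat_take_drop l w) fits_word_cat => /andP[fu _].
have el : size (take l w) = l by rewrite size_takel.
have := tiles_insert (nseq (birack_rank X) i) ms (take l w) (drop l w).
rewrite cat_take_drop !map_nseq el => ->.
have -> : tiles ms 0 w = tiles_below ms 0 (take l w) ++ [::] ++ tiles ms l (drop l w).
  by rewrite -{1}(cat_take_drop l w) tiles_cat el.
apply: equi_local.
have ed : dirs_along [::] (tiles_below ms 0 (take l w)) = map fst (row w l).
  exact: (dirs_along_tiles ms 0 fu).
rewrite ed.
have [a [b [er ea]]] := onth_split E; rewrite er map_cat /= -ea -(size_map fst).
have := local_equiv_shift (map fst a) (local_marks_rank G s.1 (map fst b)).
by rewrite /shift map_nseq /= addn0.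
Qed.

Lemma total_cat k a b : total w k (a ++ b) = total w k a + total w k b.
Proof. exact: count_cat. Qed.

(** All marks of a component are gathered on one strand, where they cancel N at
    a time. *)
Lemma remove_marks ms ms' : marks_ok w ms ->
    (forall k, birack_rank X %| total w k ms) ->
  equi (tiles (ms ++ ms') 0 w) (tiles ms' 0 w).
Proof.
have [n] := ubnP (size ms); elim: n ms => // n IH [|p ms] lt; first by move=> *; apply: equi_refl.
move=> ok0 tot; have := ok0; rewrite /marks_ok /=; case E : (component w p) => [k|] //= _.
set ms1 := p :: ms in lt ok0 tot; set N := birack_rank X in tot *.
pose s := [seq q <- ms1 | component w q == Some k].
have sN : N <= size s.
  rewrite size_filter; apply: dvdn_leq (tot k).
  by rewrite /total /= E eqxx.
(* The marks that remain when N of those on the component k are set apart. *)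
pose t := drop N s ++ [seq q <- ms1 | component w q != Some k].
have pm : perm_eq ms1 (take N s ++ t).
  by rewrite /t catA cat_take_drop perm_sym; apply/permPl/perm_filterC.
have st : all (fun q => component w q == Some k) (take N s).
  by apply/allP => q /mem_take; rewrite mem_filter => /andP[].
have e1 : equi (tiles (ms1 ++ ms') 0 w) (tiles (take N s ++ t ++ ms') 0 w).
  by apply: perm_tiles; rewrite catA perm_cat2r.
apply: equi_trans e1 _; apply: equi_trans (slide_marks _ E st) _.
rewrite size_takel //; apply: equi_trans (remove_rank_marks _ _) _; first by rewrite E.
have nt : size t < n.
  have := perm_size pm; rewrite size_cat size_takel // => e.
  have := lt; rewrite e ltnS; apply: leq_trans.
  by rewrite -[X in X < _]add0n ltn_add2r birack_rank_gt0.
apply: IH => // [|j].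
  by have := ok0; rewrite /marks_ok (perm_all _ pm) all_cat => /andP[].
have := tot j; rewrite /total (permP pm) count_cat dvdn_addr //.
have [->|ne] := eqVneq j k.
  by rewrite (@eq_in_count _ _ predT) ?count_predT ?size_takel // => q /(allP st) ->.
rewrite (@eq_in_count _ _ pred0) ?count_pred0 // => q /(allP st)/eqP -> /=.
by apply/eqP => -[] /eqP; rewrite eq_sym (negPf ne).
Qed.

(** Adding N copies of the second family to the first changes nothing, and all
    but one of these copies cancel the first family. *)
Lemma marks_by_component ms ms' : marks_ok w ms -> marks_ok w ms' ->
    (forall k, total w k ms = total w k ms' %[mod birack_rank X]) ->
  equi (tiles ms 0 w) (tiles ms' 0 w).
Proof.
move=> ok1 ok2 tot; set N := birack_rank X in tot *.
(* A family of marks on the same components whose totals are n times those of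
   ms'. *)
pose copies n := flatten (nseq n ms').
have okc n : marks_ok w (copies n).
  by elim: n => //= n; rewrite /marks_ok all_cat => ->; rewrite andbT.
have totc k n : total w k (copies n) = n * total w k ms'.
  by elim: n => //= n IH; rewrite total_cat IH mulSn.
have N0 : 0 < N by apply: birack_rank_gt0.
have e1 : equi (tiles (ms ++ copies N.-1 ++ ms') 0 w) (tiles ms' 0 w).
  rewrite catA; apply: remove_marks => [|k]; first by rewrite /marks_ok all_cat; apply/andP; split=> //; apply: okc.
  rewrite total_cat totc /dvdn -modnDml tot modnDml -{1}[total _ _ _]mul1n -mulnDl.
  by rewrite add1n prednK // modnMr.
apply: equi_trans e1; apply: equi_sym.
apply: equi_trans (_ : equi _ (tiles (copies N ++ ms) 0 w)) _.
  have -> : copies N = ms' ++ copies N.-1 by rewrite -{1}(prednK N0).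
  apply: perm_tiles; rewrite perm_catC.
  by rewrite perm_cat2r perm_catC.
by apply: remove_marks => [|k]; [apply: okc | rewrite totc dvdn_mulr].
Qed.

End Sliding.

(** * What a move does to rows and writhes *)

Section Exchange.

Variables (X : virtual_birack) (S : shadow X) (G : shadow_module S).
Local Notation local_equiv := (@local_equiv X S G).
Local Notation N := (birack_rank X).
Variable c : nat.
Implicit Types (w u v : word c) (R : strand_row c) (k : 'I_c).

Fixpoint piece_writhe k R w : int :=
  (if w is e :: w' then local_writhe k R e + piece_writhe k (after R e) w' else 0)%R.

Lemma writheE w k : writhe w k = piece_writhe k [::] w.
Proof.
rewrite /writhe /row; elim: w [::] => [|e w IH] R; first by rewrite big_ord0.
rewrite big_ord_recl /= -IH; congr (_ + _)%R.
apply: eq_bigr => l _; congr (local_writhe _ _ _).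
by rewrite !(tnth_nth e).
Qed.

Lemma piece_writhe_cat k R u v :
  (piece_writhe k R (u ++ v) = piece_writhe k R u + piece_writhe k (rows_after R u) v)%R.
Proof. by elim: u R => [|e u IH] R /=; rewrite ?add0r // IH addrA. Qed.

Definition components R : seq 'I_c := map snd R.

(** What has to be known of a move that replaces w by w' between the strands R
    and that leaves marks behind on the strands js. Every component inside w
    reaches its boundary, so that marks can be slid out of w. *)
Record exchangeable R w w' (js : seq nat) : Prop := {
  ex_rows : rows_after R w = rows_after R w';
  ex_writhe : forall k, (piece_writhe k R w = piece_writhe k R w'
     + (count (fun j => onth (components R) j == Some k) js)%:Z %[mod N])%Z;
  ex_inside : forall k l, k \in components (rows_after R (take l w)) ->
    (k \in components R) || (k \in components (rows_after R w));
  ex_local : local_equiv (map fst R) (map (@tile_of c) w)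
    ([seq (j, PKink) | j <- js] ++ map (@tile_of c) w');
  ex_marks : all (fun j => j < size R) js }.

Definition shift_word n w : word c := [seq (n + e.1, e.2) | e <- w].

Lemma rows_after_shift1 x R w :
  rows_after (x :: R) (shift_word 1 w) = x :: rows_after R w.
Proof. by elim: w R => //= -[i e] w IH R; rewrite -IH. Qed.

Lemma piece_writhe_shift1 k x R w :
  piece_writhe k (x :: R) (shift_word 1 w) = piece_writhe k R w.
Proof. by elim: w R => //= -[i e] w IH R; rewrite -IH. Qed.

Lemma exchangeable_shift1 x R w w' js : exchangeable R w w' js ->
  exchangeable (x :: R) (shift_word 1 w) (shift_word 1 w') (map succn js).
Proof.
case=> h1 h2 h3 h5 h6; split.
- by rewrite !rows_after_shift1 h1.
- by move=> k; rewrite !piece_writhe_shift1 h2 count_map.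
- move=> k l; rewrite -map_take -/(shift_word 1 _) !rows_after_shift1 !inE.
  by case/orP=> [->|/h3 /orP[] ->] //; rewrite ?orbT.
- have := local_equiv_shift1 x.1 h5; rewrite /shift map_cat -!map_comp.
  by [].
- by rewrite all_map; apply: sub_all h6.
Qed.

Lemma exchangeable_shift a R w w' js : exchangeable R w w' js ->
  exchangeable (a ++ R) (shift_word (size a) w) (shift_word (size a) w')
    (map (addn (size a)) js).
Proof.
have sh0 u : shift_word 0 u = u by rewrite -[RHS]map_id; apply: eq_map => -[].
have shS n u : shift_word n.+1 u = shift_word 1 (shift_word n u).
  by rewrite /shift_word -map_comp.
elim: a => [|x a IH] h /=; first by rewrite !sh0 map_id.
by have := exchangeable_shift1 x (IH h); rewrite (shS _ w) (shS _ w') -map_comp.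
Qed.

Lemma fits_word_shift a R w :
  fits_word (a ++ R) (shift_word (size a) w) = fits_word R w.
Proof.
elim: a => [|x a IH] /=.
  by congr fits_word; rewrite -[RHS]map_id; apply: eq_map => -[].
rewrite -IH (_ : shift_word (size a).+1 w = shift_word 1 (shift_word (size a) w)); last first.
  by rewrite /shift_word -map_comp.
elim: {w IH} (shift_word _ w) (a ++ R) => //= -[i e] w IH R'.
by rewrite fits_cons after_cons IH.
Qed.

Lemma fits_bound R i (e : event c) : fits R (i, e) -> i <= size R.
Proof.
case: e => // [|d]; rewrite /fits /=; have [//|lt] := leqP i (size R);
  by rewrite drop_oversize // ltnW.
Qed.

Lemma exchangeable_at i R w w' :
  (forall R', fits_word R' w -> fits_word R' w' -> exists js, exchangeable R' w w' js) ->
  i <= size R -> fits_word R (shift_word i w) -> fits_word R (shift_word i w') ->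
  exists js, exchangeable R (shift_word i w) (shift_word i w') js.
Proof.
move=> H le; have e : shift_word i = shift_word (size (take i R)) by rewrite size_takel.
rewrite -{1 2 3}(cat_take_drop i R) e !fits_word_shift => f f'.
have [js h] := H _ f f'.
by exists (map (addn (size (take i R))) js); apply: exchangeable_shift.
Qed.

Lemma after_min R o k : after R (0, Min o k) = [:: (o, k), (~~ o, k) & R].
Proof. by rewrite /after /= take0 drop0. Qed.

Lemma local_writhe_cons k x R i (e : event c) :
  local_writhe k (x :: R) (i.+1, e) = local_writhe k R (i, e).
Proof. by []. Qed.

Lemma local_writhe_min k R i o m : local_writhe k R (i, Min o m) = 0%R.
Proof. by []. Qed.

Lemma local_writhe_max k R i : local_writhe k R (i, Max) = 0%R.
Proof. by []. Qed.

Lemma mod_eq (m n : int) : m = n -> (m = n %[mod N])%Z.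
Proof. by move=> ->. Qed.

Local Ltac compute_rows :=
  rewrite /rows_after /= /after /= ?take0 ?drop0 /=.

Local Ltac inside_components :=
  by move=> k [|[|[|l]]]; rewrite /rows_after /= ?(after_min, after_cons) /= /after /=
       ?take0 ?drop0 /= ?inE; do ?case: (_ == _); do ?case: (_ \in _).

(** The second event takes place on the right of the first one and may be any
    event there. *)
Lemma exchangeable_exchange (e e' : event c) j R :
    fits_word R [:: (ins e + j, e'); (0, e)] -> fits_word R [:: (0, e); (outs e + j, e')] ->
  exchangeable R [:: (ins e + j, e'); (0, e)] [:: (0, e); (outs e + j, e')] [::].
Proof.
move=> f f'; have loc := @local_exchange X S G (bare e) (bare e') j (map fst R).
case: e f f' loc => [o k0||d]; rewrite [ins _]/= [outs _]/= ?add0n ?add2n => f f' loc.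
- split.
  + by rewrite /rows_after /= !after_min !after_cons.
  + move=> k; apply: mod_eq; rewrite /= !after_min !local_writhe_cons.
    by rewrite !local_writhe_min !addr0 add0r.
  + inside_components.
  + exact: loc.
  + by [].
- case: R f f' loc => [|x [|y R]] f f' loc.
  + by move: f'; rewrite /= /fits.
  + by move: f'; rewrite /= /fits /=; case: x {f loc}.
  split.
  + by rewrite /rows_after /= !after_cons.
  + by move=> k; apply: mod_eq; rewrite /= !after_cons !local_writhe_cons !local_writhe_max !addr0 add0r.
  + inside_components.
  + exact: loc.
  + by [].
- case: R f f' loc => [|x [|y R]] f f' loc.
  + by move: f'; rewrite /= /fits.
  + by move: f'; rewrite /= /fits.
  split.
  + by rewrite /rows_after /= !after_cons.
  + move=> k; apply: mod_eq; rewrite /= !after_cons !local_writhe_cons !addr0 addrC.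
    by congr (_ + _)%R.
  + inside_components.
  + exact: loc.
  + by [].
Qed.

Lemma exchangeable_zigzagL o m R : fits_word R [:: (1, Min o m); (0, Max)] ->
  exchangeable R [:: (1, Min o m); (0, Max)] [::] [::].
Proof.
case: R => [|[b m'] R] //; rewrite /= !after_cons after_min /fits /= andbT.
case/andP=> /eqP eo /eqP em; subst m'.
have eb : b = ~~ o by rewrite eo negbK.
subst b; split.
- by compute_rows.
- by move=> k; apply: mod_eq; compute_rows; rewrite !(local_writhe_cons, local_writhe_min, local_writhe_max).
- inside_components.
- exact: (local_zigzagL G o (map fst R)).
- by [].
Qed.

Lemma exchangeable_zigzagR o m R : fits_word R [:: (0, Min o m); (1, Max)] ->
  exchangeable R [:: (0, Min o m); (1, Max)] [::] [::].
Proof.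
case: R => [|[b m'] R] //; rewrite /= /after /= ?take0 ?drop0 /fits /= andbT.
rewrite negbK; case/andP=> /eqP eo /eqP em; subst m' b; split.
- by compute_rows.
- by move=> k; apply: mod_eq; compute_rows; rewrite !(local_writhe_cons, local_writhe_min, local_writhe_max).
- inside_components.
- exact: (local_zigzagR G o (map fst R)).
- by [].
Qed.

Lemma exchangeable_slide_min o m a R : fits_word R [:: (0, Min o m); (1, Cross a)] ->
  exchangeable R [:: (0, Min o m); (1, Cross a)] [:: (1, Min o m); (0, Cross (mirror a))] [::].
Proof.
case: R => [|[b m'] R] // _; split.
- by compute_rows.
- move=> k; apply: mod_eq; compute_rows; rewrite ?local_writhe_cons.
  rewrite !local_writhe_min !addr0 !add0r /local_writhe /= andbC; case: ifP => // _.
  by case: a o b => [] [] [].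
- inside_components.
- exact: (local_slide_min G o a (map fst ((b, m') :: R))).
- by [].
Qed.

Lemma exchangeable_slide_max a R : fits_word R [:: (1, Cross a); (0, Max)] ->
  exchangeable R [:: (1, Cross a); (0, Max)] [:: (0, Cross (mirror a)); (1, Max)] [::].
Proof.
case: R => [|[b1 m1] [|[b2 m2] [|[b3 m3] R]]] //=; rewrite /fits //= andbT.
case/andP=> /eqP eb /eqP em; subst b3 m3; split.
- by [].
- move=> k; apply: mod_eq; rewrite /= ?after_cons ?local_writhe_cons.
  rewrite !local_writhe_max !addr0 /local_writhe /= andbC; case: ifP => // _.
  by case: a b1 b2 => [] [] [].
- inside_components.
- exact: (local_slide_max G a (map fst [:: (b1, m1), (b2, m2), (~~ b1, m1) & R])).
- by [].
Qed.

Lemma exchangeable_twist a R : fits_word R [:: (0, Cross a); (0, Cross (mirror a))] ->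
  exchangeable R [:: (0, Cross a); (0, Cross (mirror a))] [::] [::].
Proof.
case: R => [|[b1 m1] [|[b2 m2] R]] //= _; split.
- by [].
- move=> k; apply: mod_eq; rewrite /= /local_writhe /= [(m2 == k) && _]andbC.
  by case: ifP => // _; case: a b1 b2 => [] [] [].
- inside_components.
- exact: (local_twist G a b1 b2 (map fst R)).
- by [].
Qed.

Lemma exchangeable_triangle a b d R : triangle_ok a b d ->
    fits_word R [:: (0, Cross a); (1, Cross b); (0, Cross d)] ->
  exchangeable R [:: (0, Cross a); (1, Cross b); (0, Cross d)]
                 [:: (1, Cross d); (0, Cross b); (1, Cross a)] [::].
Proof.
move=> tok; case: R => [|[b1 m1] [|[b2 m2] [|[b3 m3] R]]] //= _; split.
- by [].
- move=> k; apply: mod_eq; rewrite /= !after_cons !local_writhe_cons !addr0 /local_writhe /=.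
  by rewrite addrCA [RHS]addrC -addrA.
- inside_components.
- exact: (local_triangle G (map fst [:: (b1, m1), (b2, m2), (b3, m3) & R]) tok).
- by [].
Qed.

(** A negative kink amounts to N - 1 marks and has sign -1; a virtual kink
    amounts to none. *)
Lemma kink_weight_sign a o :
  (match crossing_type_of a o o with
   | Positive => 1 | Negative => -1 | VirtualCrossing => 0 end
   = (kink_weight X a)%:Z %[mod N])%Z.
Proof.
case: a => /=; rewrite ?eqxx //.
apply/eqP; rewrite eqz_mod_dvd -opprD -intS prednK ?birack_rank_gt0 //.
by rewrite -mulN1r dvdz_mull.
Qed.

Lemma exchangeable_kinkR a o m R :
    fits_word R [:: (1, Min o m); (0, Cross a); (1, Max)] ->
  exchangeable R [:: (1, Min o m); (0, Cross a); (1, Max)] [::] (nseq (kink_weight X a) 0).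
Proof.
case: R => [|[b m'] R] //; rewrite /= !after_cons after_min /fits /= andbT.
case/andP=> /eqP eo /eqP em; subst m'.
have eb : b = o by rewrite -[b]negbK -eo negbK.
subst b; split.
- by compute_rows.
- move=> k; compute_rows; rewrite local_writhe_cons local_writhe_min.
  rewrite local_writhe_max !addr0 !add0r /local_writhe /= count_nseq /= andbb.
  rewrite (_ : (Some m == Some k) = (m == k)) //; case: ifP => _; last by rewrite mul0n.
  by rewrite mul1n; apply: kink_weight_sign.
- inside_components.
- by rewrite map_nseq /= cats0; apply: (local_kinkR G a o (map fst R)).
- by rewrite all_nseq orbT.
Qed.

Lemma exchangeable_kinkL a o m R :
    fits_word R [:: (0, Min o m); (1, Cross a); (0, Max)] ->
  exchangeable R [:: (0, Min o m); (1, Cross a); (0, Max)] [::] (nseq (kink_weight X a) 0).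
Proof.
case: R => [|[b m'] R] //; rewrite /= /after /= ?take0 ?drop0 /fits /= andbT.
case/andP=> /eqP eo /eqP em; subst m' b.
split.
- by compute_rows.
- move=> k; compute_rows; rewrite local_writhe_cons local_writhe_min.
  rewrite local_writhe_max !addr0 !add0r /local_writhe /= count_nseq /= andbb.
  rewrite (_ : (Some m == Some k) = (m == k)) //; case: ifP => _; last by rewrite mul0n.
  by rewrite mul1n; apply: kink_weight_sign.
- inside_components.
- by rewrite map_nseq /= cats0; apply: (local_kinkL G a o (map fst R)).
- by rewrite all_nseq orbT.
Qed.

Lemma move_exchangeable w w' R : planar_move w w' \/ reidemeister_move w w' ->
  fits_word R w -> fits_word R w' -> exists js, exchangeable R w w' js.
Proof.
have at0 i u u' js : (forall R', fits_word R' u -> fits_word R' u' -> exchangeable R' u u' js) ->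
    i <= size R -> fits_word R (shift_word i u) -> fits_word R (shift_word i u') ->
    exists js, exchangeable R (shift_word i u) (shift_word i u') js.
  by move=> H; apply: exchangeable_at => R' f f'; exists js; apply: H.
have bound i e u : fits_word R ((i, e) :: u) -> i <= size R.
  by case/andP=> /fits_bound.
case=> [[i j e e' le|i o k|i o k|i o k a|i a]|[a u u' [i o k|i o k]|i a|i a b d tok]] f f'.
- have [m ej] : exists m, j = i + ins e + m by exists (j - (i + ins e)); rewrite subnKC.
  have := at0 i _ _ [::] (@exchangeable_exchange e e' m) (bound _ _ _ f').
  rewrite /shift_word /= addn0 addnA -ej (_ : i + (outs e + m) = j - ins e + outs e); last first.
    by rewrite ej addnAC addnK -addnA [m + _]addnC.
  by apply.
- have := at0 i _ _ [::] (fun R' f _ => @exchangeable_zigzagL o k R' f).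
  rewrite /shift_word /= addn0 addn1; apply=> //; exact: ltnW (bound _ _ _ f).
- have := at0 i _ _ [::] (fun R' f _ => @exchangeable_zigzagR o k R' f).
  rewrite /shift_word /= addn0 addn1; apply=> //; exact: (bound _ _ _ f).
- have := at0 i _ _ [::] (fun R' f _ => @exchangeable_slide_min o k a R' f).
  rewrite /shift_word /= addn0 addn1; apply=> //; exact: (bound _ _ _ f).
- have := at0 i _ _ [::] (fun R' f _ => @exchangeable_slide_max a R' f).
  rewrite /shift_word /= addn0 addn1; apply=> //; exact: ltnW (bound _ _ _ f).
- have := at0 i _ _ _ (fun R' f _ => @exchangeable_kinkR a o k R' f).
  rewrite /shift_word /= addn0 addn1; apply=> //; exact: ltnW (bound _ _ _ f).
- have := at0 i _ _ _ (fun R' f _ => @exchangeable_kinkL a o k R' f).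
  rewrite /shift_word /= addn0 addn1; apply=> //; exact: (bound _ _ _ f).
- have := at0 i _ _ [::] (fun R' f _ => @exchangeable_twist a R' f).
  rewrite /shift_word /= addn0; apply=> //; exact: (bound _ _ _ f).
- have := at0 i _ _ [::] (fun R' f _ => @exchangeable_triangle a b d R' tok f).
  rewrite /shift_word /= addn0 addn1; apply=> //; exact: (bound _ _ _ f).
Qed.

End Exchange.

(** * Invariance under the moves *)

Section Invariance.

Variables (X : virtual_birack) (S : shadow X) (G : shadow_module S).
Local Notation equi := (@equi X S G).
Local Notation N := (birack_rank X).
Variable c : nat.
Implicit Types (u v w : word c) (ms : seq (nat * nat)) (D : diagram c) (k : 'I_c).

Lemma componentE w p : component w p = onth (components (row w p.1)) p.2.
Proof. by rewrite /component /components onth_map; case: onth. Qed.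

Lemma component_mem w l k : k \in components (row w l) -> exists i, component w (l, i) = Some k.
Proof. by move/onthP=> [i e]; exists i; rewrite componentE. Qed.

Lemma component_in w l i k : component w (l, i) = Some k -> k \in components (row w l).
Proof. by rewrite componentE => e; apply/onthP; exists i. Qed.

Lemma row_below u z l : l <= size u -> row (u ++ z) l = rows_after [::] (take l u).
Proof. by move=> le; rewrite /row takel_cat. Qed.

Lemma row_above u z l : row (u ++ z) (size u + l) = rows_after (rows_after [::] u) (take l z).
Proof.
by rewrite /row take_cat ltnNge leq_addr /= addKn /rows_after foldl_cat.
Qed.

Lemma row_piece u w v l : l <= size w ->
  row (u ++ w ++ v) (size u + l) = rows_after (rows_after [::] u) (take l w).
Proof. by move=> le; rewrite row_above takel_cat. Qed.

Lemma row_over u w v l : row (u ++ w ++ v) (size u + size w + l)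
  = rows_after (rows_after (rows_after [::] u) w) (take l v).
Proof. by rewrite catA -size_cat row_above /rows_after foldl_cat. Qed.

Section Piece.

Variables (D D' : diagram c) (u v w w' : word c) (js : seq nat).
Hypotheses (eD : slices D = u ++ w ++ v) (eD' : slices D' = u ++ w' ++ v).
Let R := rows_after [::] u.
Hypothesis ex : exchangeable G R w w' js.

(** A component that enters the replaced part also meets its boundary. *)
Lemma outside p k : component D p = Some k ->
  exists2 q, component D q = Some k & (q.1 <= size u) || (size u + size w <= q.1).
Proof.
case: p => l i E; have [le|lt] := leqP l (size u); first by exists (l, i) => //=; rewrite le.
have [le|lt'] := leqP (size u + size w) l; first by exists (l, i) => //=; rewrite le orbT.
have le2 : l - size u <= size w by rewrite leq_subLR ltnW.
have := component_in E; rewrite {1}eD -[l in row _ l](subnKC (ltnW lt)) row_piece //.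
case/(ex_inside ex)/orP => h.
  have [j e] : exists j, component D (size u, j) = Some k.
    by apply: component_mem; rewrite eD row_below ?take_size.
  by exists (size u, j); rewrite /= ?leqnn.
have [j e] : exists j, component D (size u + size w, j) = Some k.
  by apply: component_mem; rewrite eD row_piece // take_size.
by exists (size u + size w, j); rewrite /= ?leqnn ?orbT.
Qed.

Lemma marks_outside ms : marks_ok D ms -> exists A B,
  [/\ all (fun p => p.1 <= size u) A, all (fun p => size u + size w <= p.1) B,
      marks_ok D (A ++ B) & forall k, total D k (A ++ B) = total D k ms].
Proof.
elim: ms => [|p ms IH] /=; first by exists [::], [::].
rewrite {1}/marks_ok /=; case E : (component D p) => [k|] //= /IH[A [B [hA hB ok tot]]].
have [q eq /orP[le|le]] := outside E.
  exists (q :: A), B; split=> //=; first by rewrite le.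
    by rewrite /marks_ok /= eq.
  by move=> j; have := tot j; rewrite /total /= eq => ->.
exists A, (q :: B); split=> //=; first by rewrite le.
  by move: ok; rewrite /marks_ok !all_cat /= eq.
by move=> j; have := tot j; rewrite /total !count_cat /= eq => <-; rewrite addnCA.
Qed.

Definition move_up (p : nat * nat) := (size u + size w' + (p.1 - (size u + size w)), p.2).

Lemma component_up p : size u + size w <= p.1 -> component D' (move_up p) = component D p.
Proof.
move=> le; rewrite !componentE /= eD eD' -{2}(subnKC le) !row_over.
by rewrite -(ex_rows ex).
Qed.

Lemma component_down p : p.1 <= size u -> component D' p = component D p.
Proof. by move=> le; rewrite !componentE eD eD' !row_below. Qed.

Lemma component_left j : component D' (size u, j) = onth (components R) j.
Proof. by rewrite componentE eD' row_below // take_size. Qed.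

Lemma writhe_move k :
  (writhe D k = writhe D' k + (count (fun j => onth (components R) j == Some k) js)%:Z %[mod N])%Z.
Proof.
rewrite !writheE eD eD' !piece_writhe_cat -/R -(ex_rows ex).
apply/eqP; have /eqP := ex_writhe ex k; rewrite !eqz_mod_dvd.
by congr (_ %| _)%Z; ring.
Qed.

(** Slide the marks of D out of the replaced part and then replace it. The
    marks that appear account for the change of the writhe, so that the marks
    obtained on D' and the given ones have the same totals. *)
Lemma equi_move ms ms' : marks_ok D ms -> marks_ok D' ms' ->
    (forall k, ((total D k ms)%:Z + writhe D k
                = (total D' k ms')%:Z + writhe D' k %[mod N])%Z) ->
  equi (tiles ms 0 D) (tiles ms' 0 D').
Proof.
move=> ok ok' cong; have [A [B [hA hB okAB totAB]]] := marks_outside ok.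
have e1 : equi (tiles ms 0 D) (tiles (A ++ B) 0 D).
  by apply: (marks_by_component G (slices_ok D)) => // k; rewrite totAB.
apply: equi_trans e1 _.
(* The marks on D' after the replacement: those below, those that appear, and
   those above, which move along with their level. *)
pose A' := A ++ [seq (size u, j) | j <- js]; pose B' := map move_up B.
have hA' : all (fun p => p.1 <= size u) A'.
  by rewrite all_cat hA all_map; apply/allP => j _ /=.
have hB' : all (fun p => size u + size w' <= p.1) B'.
  by rewrite all_map; apply/allP => p _; rewrite /= leq_addr.
have e2 : equi (tiles (A ++ B) 0 D) (tiles (A' ++ B') 0 D').
  rewrite eD eD' !tiles_split //.
  rewrite tiles_below_out; last by rewrite all_map; apply/allP => j _ /=.
  rewrite marks_at_cat marks_at_same.
  have := tiles_shift B (size u + size w) (size u + size w') v.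
  rewrite (all_filterP hB) -/(map move_up B) -/B' => ->.
  have fu : fits_word [::] u.
    by have := link_diagram_fits (slices_ok D); rewrite eD fits_word_cat => /andP[].
  have L := @equi_local X S G (tiles_below A 0 u ++ marks_at A (size u)) (map (@tile_of c) w)
    ([seq (j, PKink) | j <- js] ++ map (@tile_of c) w') (tiles B (size u + size w) v).
  rewrite -!catA in L; rewrite -catA; apply: L.
  rewrite foldl_cat -[X in foldl _ X (tiles_below _ _ _)]/(map fst ([::] : strand_row c)).
  rewrite dirs_along_tiles // dirs_along_marks; exact: ex_local ex.
apply: equi_trans e2 _; apply: (marks_by_component G (slices_ok D')) => // [|k].
  move: okAB; rewrite /marks_ok !all_cat => /andP[okA okB].
  apply/andP; split; first (apply/andP; split).
  - by apply/allP => p pA; rewrite component_down ?(allP hA) // (allP okA).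
  - rewrite all_map; apply/allP => j /(allP (ex_marks ex)) lt /=.
    by rewrite component_left /components onth_map; move: lt; rewrite -onthTE; case: onth.
  - rewrite all_map; apply/allP => p pB /=.
    by rewrite component_up ?(allP hB) // (allP okB).
have tot' : total D' k (A' ++ B')
    = total D k ms + count (fun j => onth (components R) j == Some k) js.
  rewrite -totAB /total !count_cat !count_map addnAC; congr (_ + _ + _).
  - by apply: eq_in_count => p pA; rewrite component_down ?(allP hA).
  - by apply: eq_in_count => p pB; rewrite /= component_up ?(allP hB).
  - by apply: eq_count => j /=; rewrite component_left.
apply/eqP; rewrite -eqz_nat -!modz_nat tot' PoszD eqz_mod_dvd.
have /eqP := cong k; have /eqP := writhe_move k; rewrite !eqz_mod_dvd => d1 d2.
have := rpredB d2 d1; congr (_ %| _)%Z; ring.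
Qed.

End Piece.

Lemma moves_equi (P : word c -> word c -> Prop) D D' ms ms' :
    (forall w w', P w w' -> planar_move w w' \/ reidemeister_move w w') ->
    applied P D D' -> marks_ok D ms -> marks_ok D' ms' ->
    (forall k, ((total D k ms)%:Z + writhe D k
                = (total D' k ms')%:Z + writhe D' k %[mod N])%Z) ->
  equi (tiles ms 0 D) (tiles ms' 0 D').
Proof.
move=> H [u [v [w [w' [m eD eD']]]]].
have f : fits_word (rows_after [::] u) w.
  by have := link_diagram_fits (slices_ok D); rewrite eD !fits_word_cat => /and3P[].
have f' : fits_word (rows_after [::] u) w'.
  by have := link_diagram_fits (slices_ok D'); rewrite eD' !fits_word_cat => /and3P[].
have [js ex] := move_exchangeable G (H _ _ m) f f'.
by move=> ok ok' cong; apply: (equi_move eD eD' ex ok ok' cong).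
Qed.

Lemma component_point_at D (p : Defs.point D) :
  component D (point_at p) = Some (strand p).2.
Proof.
case: p => l i; rewrite /component /strand /=.
case E : (onth (row D l) i) => [s|]; last by have := ltn_ord i; rewrite -onthTE E.
rewrite /= (tnth_nth s) /=; congr Some; congr snd; apply/esym; exact: onth_nth E.
Qed.

(** Any numbers of marks can be realised, as every component has a strand. *)
Lemma marks_exist D (n : 'I_c -> nat) :
  exists2 ms, marks_ok D ms & forall k, total D k ms = n k.
Proof.
have [_ _ pts _] := slices_ok D.
pose b k : nat * nat := point_at (sval (cid (pts k))).
have bE k : component D (b k) = Some k.
  by have := component_point_at (sval (cid (pts k))); rewrite (svalP (cid (pts k))).
exists (flatten [seq nseq (n k) (b k) | k <- enum 'I_c]) => [|k].
  apply/allP => p /flatten_mapP[k _]; rewrite mem_nseq => /andP[_ /eqP ->].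
  by rewrite bE.
rewrite /total count_flatten -map_comp sumnE big_map big_enum (bigD1 k) //=.
rewrite count_nseq bE eqxx mul1n big1 ?addn0 // => j jk.
by rewrite count_nseq bE (_ : (Some j == Some k) = (j == k)) // (negPf jk).
Qed.

End Invariance.

Section Composition.

Variables (X : virtual_birack) (S : shadow X) (G : shadow_module S).
Local Notation N := (birack_rank X).

(** Marks and writhe of a component enter only through their sum modulo the
    rank. *)
Definition framed_equi c c' (g : 'I_c -> 'I_c') (D : diagram c) (D' : diagram c') : Prop :=
  forall ms ms', marks_ok D ms -> marks_ok D' ms' ->
    (forall k, ((total D k ms)%:Z + writhe D k
                = (total D' (g k) ms')%:Z + writhe D' (g k) %[mod N])%Z) ->
  equi G (tiles ms 0 D) (tiles ms' 0 D').

Lemma framed_equi_refl c (D : diagram c) : framed_equi id D D.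
Proof.
move=> ms ms' ok ok' cong; apply: (marks_by_component G (slices_ok D)) => // k.
apply/eqP; rewrite -eqz_nat -!modz_nat eqz_mod_dvd.
by have /eqP := cong k; rewrite eqz_mod_dvd; congr (_ %| _)%Z; rewrite /=; ring.
Qed.

(** On the intermediate diagram, marks are chosen that make up for the
    difference of the writhes. *)
Lemma framed_equi_trans c c' c'' (g : 'I_c -> 'I_c') (g' : 'I_c' -> 'I_c'')
    (D : diagram c) (D' : diagram c') (D'' : diagram c'') : bijective g ->
  framed_equi g D D' -> framed_equi g' D' D'' -> framed_equi (g' \o g) D D''.
Proof.
move=> [f fK gK] H H' ms ms'' ok ok'' cong.
(* What is missing on the component k of D', as a natural number. *)
pose n k := `|(((total D (f k) ms)%:Z + writhe D (f k) - writhe D' k) %% N)%Z|%N.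
have [ms' ok' tot] := marks_exist D' n.
have nE k : ((n k)%:Z = (total D (f k) ms)%:Z + writhe D (f k) - writhe D' k %[mod N])%Z.
  rewrite /n gez0_abs ?modz_ge0 ?modz_mod //.
  by rewrite eqz_nat -lt0n birack_rank_gt0.
apply: equi_trans (H ms ms' ok ok' _) (H' ms' ms'' ok' ok'' _) => k.
  apply/eqP; have /eqP := nE (g k); rewrite tot fK !eqz_mod_dvd => d.
  by have := rpredB (dvdz0 N) d; congr (_ %| _)%Z; ring.
apply/eqP; have /eqP := nE k; have /eqP := cong (f k); rewrite tot /= gK !eqz_mod_dvd => d d'.
by have := rpredD d d'; congr (_ %| _)%Z; ring.
Qed.

Lemma framed_equi_sym c c' (g : 'I_c -> 'I_c') f (D : diagram c) (D' : diagram c') :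
  cancel g f -> framed_equi g D D' -> framed_equi f D' D.
Proof.
move=> gK H ms' ms ok' ok cong; apply/equi_sym/H => // k.
by rewrite (cong (g k)) gK.
Qed.

Lemma moves_framed_equi c (P : word c -> word c -> Prop) (D D' : diagram c) :
    (forall w w', P w w' -> planar_move w w' \/ reidemeister_move w w') ->
  clos_refl_sym_trans _ (applied P) D D' -> framed_equi id D D'.
Proof.
move=> H; elim=> {D D'} [D D' st|D|D D' _ IH|D D' D'' _ IH _ IH'].
- by move=> ms ms'; apply: moves_equi H st.
- exact: framed_equi_refl.
- exact: framed_equi_sym IH.
- by apply: (@framed_equi_trans _ _ _ id id _ D') => //; exists id.
Qed.

Section Renumber.

Variables (c c' : nat) (g : 'I_c -> 'I_c').
Hypothesis g_inj : injective g.
Implicit Types (w : word c) (R : strand_row c).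

Definition renumber_row R : strand_row c' := [seq (s.1, g s.2) | s <- R].

Lemma tiles_renumber ms l w : tiles ms l (renumber g w) = tiles ms l w.
Proof.
by elim: w l => //= -[i e] w IH l; rewrite IH; case: e.
Qed.

Lemma after_renumber R e :
  after (renumber_row R) (e.1, renumber_event g e.2) = renumber_row (after R e).
Proof.
case: e => i e; rewrite /after /renumber_row /= map_cat map_take -map_drop; congr (_ ++ _).
by case: e => [o k||d] //=; case: (drop i R) => [|x [|y z]].
Qed.

Lemma rows_after_renumber R w :
  rows_after (renumber_row R) (renumber g w) = renumber_row (rows_after R w).
Proof. by elim: w R => //= e w IH R; rewrite after_renumber IH. Qed.

Lemma component_renumber w p : component (renumber g w) p = omap g (component w p).
Proof.
rewrite /component /row /renumber -map_take -/(renumber g _).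
have := rows_after_renumber [::] (take p.1 w); rewrite /rows_after /= => ->.
by rewrite /renumber_row onth_map; case: onth.
Qed.

Lemma piece_writhe_renumber k R w :
  piece_writhe (g k) (renumber_row R) (renumber g w) = piece_writhe k R w.
Proof.
elim: w R => //= e w IH R; rewrite after_renumber IH; congr (_ + _)%R.
case: e => i e; rewrite /local_writhe /= -map_drop.
by case: e => [o m||d] //=; case: (drop i R) => [|[b x] [|[b' y] z]] //=; rewrite !(inj_eq g_inj).
Qed.

Lemma framed_equi_renumber (D : diagram c) (D' : diagram c') :
  slices D' = renumber g D -> framed_equi g D D'.
Proof.
move=> eD ms ms' ok ok' cong.
have tot k : total D' (g k) ms' = total D k ms'.
  apply: eq_count => p; rewrite eD component_renumber; case: component => //= j.
  by rewrite (_ : (Some (g j) == Some (g k)) = (g j == g k)) // (inj_eq g_inj).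
have wr k : writhe D' (g k) = writhe D k.
  by rewrite !writheE eD -(piece_writhe_renumber k [::]).
rewrite eD tiles_renumber; apply: (marks_by_component G (slices_ok D)) => // [|k].
  by apply: sub_all ok' => p; rewrite eD component_renumber; case: component.
apply/eqP; rewrite -eqz_nat -!modz_nat eqz_mod_dvd.
by have /eqP := cong k; rewrite eqz_mod_dvd tot wr; congr (_ %| _)%Z; ring.
Qed.

End Renumber.

(** When the writhes agree modulo the rank, no marks are needed on either
    diagram. *)
Lemma isotopic_framings_equi c c' (D : diagram c) (D' : diagram c')
    (E : writhe_vector X c -> diagram c) (E' : writhe_vector X c' -> diagram c')
    (g : 'I_c -> 'I_c') (f : 'I_c' -> 'I_c) (D1 : diagram c') :
    cancel g f -> cancel f g -> slices D1 = renumber g D -> numbered_isotopic D1 D' ->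
    framings D E -> framings D' E' ->
  forall u, equi G (map (@tile_of c) (slices (E u)))
                   (map (@tile_of c') (slices (E' [ffun k => u (f k)]))).
Proof.
move=> gK fK eD1 iso fE fE' u; set u' := [ffun k => u (f k)].
have [kE wE] := fE u; have [kE' wE'] := fE' u'.
have kinks c0 (w w' : word c0) :
    planar_move w w' \/ (exists2 a, ~~ is_virtual a & kink_move a w w') ->
    planar_move w w' \/ reidemeister_move w w'.
  by case=> [|[a _ m]]; [left | right; apply: MoveI m].
have h1 : framed_equi id (E u) D.
  by apply: (@framed_equi_sym _ _ id) => //; apply: moves_framed_equi kE; apply: kinks.
have h2 : framed_equi g D D1 by apply: framed_equi_renumber => //; apply: can_inj gK.
have h3 : framed_equi id D1 D' by apply: moves_framed_equi iso.
have h4 : framed_equi id D' (E' u') by apply: moves_framed_equi kE'; apply: kinks.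
have bg : bijective g by exists f.
have bi n : bijective (@id 'I_n) by exists id.
have h : framed_equi g (E u) (E' u').
  by have := framed_equi_trans bg (framed_equi_trans (bi _) h1 h2)
    (framed_equi_trans (bi _) h3 h4).
have nomarks c0 (w : word c0) l : tiles [::] l w = map (@tile_of c0) w.
  by elim: w l => //= e w IH l; rewrite IH.
have := h [::] [::] isT isT; rewrite !nomarks; apply=> k.
by rewrite /total /= !add0r wE wE' ffunE gK.
Qed.

End Composition.

(** * Regions and points of a diagram *)

Section Gaps.

Variables (X : virtual_birack) (S : shadow X) (G : shadow_module S).
Local Notation edge := (edge G).
Local Notation state := (state G).
Implicit Types (s : strand_state G) (σ τ a : state) (ss : seq state).

(** A is the leftmost region. *)
Fixpoint gap_region (A : S) σ i : S :=
  match i, σ with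
  | i'.+1, s :: σ' => gap_region (sright s) σ' i'
  | _, _ => A
  end.

Lemma gap_regionS A σ i s : onth σ i = Some s -> gap_region A σ i.+1 = sright s.
Proof. by elim: σ A i => [|t σ IH] A [|i] //= => [[->]|/IH ->]; first case: σ {IH}. Qed.

Lemma coherentP A σ : coherent A σ <->
  forall i s, onth σ i = Some s -> sleft s = gap_region A σ i.
Proof.
elim: σ A => [|t σ IH] A /=; first by split=> // _ [].
split=> [[tA /IH h] [|i] s /=|h]; [by case=> <- | exact: h |].
by split; [apply: (h 0) | apply/IH => i s e; apply: (h i.+1)].
Qed.

Lemma gap_region_cat A a σ j :
  gap_region A (a ++ σ) (size a + j) = gap_region (gap_region A a (size a)) σ j.
Proof. by elim: a A => //= s a IH A; rewrite IH. Qed.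

Lemma gap_region_catl A a σ i : i <= size a -> gap_region A (a ++ σ) i = gap_region A a i.
Proof. by elim: a A i => [|s a IH] A [|i] //= le; [case: σ | rewrite IH]. Qed.

Lemma event_split A i p σ τ : event_rel A i p σ τ -> exists a σ' τ',
  [/\ σ = a ++ σ', τ = a ++ τ', size a = i & event_at_0 (gap_region A σ i) p σ' τ'].
Proof.
elim: i A σ τ => [|i IH] A σ τ; first by exists [::], σ, τ; case: σ H.
case: σ τ => [|s σ] [|t τ] //= [-> _ /IH[a [σ' [τ' [-> -> <- e]]]]].
by exists (s :: a), σ', τ'.
Qed.

Lemma event_join A p a σ τ : coherent A (a ++ σ) ->
  event_at_0 (gap_region A (a ++ σ) (size a)) p σ τ -> event_rel A (size a) p (a ++ σ) (a ++ τ).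
Proof.
elim: a A => [|s a IH] A /=; first by case: σ.
by move=> [sA /IH h] /h.
Qed.

Lemma chain_nth A (w : seq tile) σ ss t0 l : chain A w σ ss -> l < size w ->
  event_rel A (nth t0 w l).1 (nth t0 w l).2 (nth [::] (σ :: ss) l) (nth [::] ss l).
Proof.
elim: w σ ss l => [|t w IH] σ [|τ ss] [|l] //= [h c] // lt.
exact: IH c lt.
Qed.

Lemma nth_chain A (w : seq tile) σ ss t0 : size ss = size w ->
  (forall l, l < size w ->
     event_rel A (nth t0 w l).1 (nth t0 w l).2 (nth [::] (σ :: ss) l) (nth [::] ss l)) ->
  chain A w σ ss.
Proof.
elim: w σ ss => [|t w IH] σ [|τ ss] //= [e] h; split; first exact: (h 0).
by apply: IH => // l; apply: (h l.+1).
Qed.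

Lemma chain_take A (w : seq tile) σ ss l : chain A w σ ss -> chain A (take l w) σ (take l ss).
Proof. by elim: w σ ss l => [|t w IH] σ [|τ ss] [|l] //= [h /IH c]. Qed.

Lemma last_take_nth σ ss l : l <= size ss -> last σ (take l ss) = nth [::] (σ :: ss) l.
Proof. by elim: ss σ l => [|τ ss IH] σ [|l] //= /IH. Qed.

(** The conditions on the labels and beads of a crossing, once both strands
    point upward and A is the region on its right. *)
Definition crossing_condition (k : crossing_type) (A : S) (ll lr ul ur : X * G) : Prop :=
  match k with
  | Positive => (ul.1, ur.1) = (up lr.1 ll.1, dn ll.1 lr.1)
      /\ (ul.2 = (sm_act GenT A ll.1 lr.1 lr.2 + sm_act GenS A ll.1 lr.1 ll.2)%R
          /\ ur.2 = sm_act GenR A ll.1 lr.1 ll.2)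
  | Negative => (ll.1, lr.1) = (up ur.1 ul.1, dn ul.1 ur.1)
      /\ (ll.2 = (sm_act GenT A ul.1 ur.1 ur.2 + sm_act GenS A ul.1 ur.1 ul.2)%R
          /\ lr.2 = sm_act GenR A ul.1 ur.1 ul.2)
  | VirtualCrossing => (ul.1, ur.1) = (vup lr.1 ll.1, vdn ll.1 lr.1)
      /\ (ul.2 = sm_act GenV A ll.1 lr.1 lr.2 /\ sm_act GenV A ll.1 lr.1 ur.2 = ll.2)
  end.

(** The crossing relation also asks that the four edges agree on the regions
    around it; apart from this it is the condition on labels and beads. *)
Lemma crossing_conditionP d b b' (e1 e2 e3 e4 : edge) (L B R T : S) :
  [/\ page_left b e1 = L, page_right b e1 = B, page_left b' e2 = B & page_right b' e2 = R] ->
  [/\ page_left b' e3 = L, page_right b' e3 = T, page_left b e4 = T & page_right b e4 = R] ->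
  let: (ll, lr, ul, ur) := rotate_upward b b' (edge_label e1, bead e1) (edge_label e2, bead e2)
         (edge_label e3, bead e3) (edge_label e4, bead e4) in
  crossing d b b' e1 e2 e3 e4 <->
  crossing_condition (crossing_type_of d b b')
    (if b then if b' then R else B else if b' then T else L) ll lr ul ur.
Proof.
have pos (p1 p2 p3 p4 : edge) A : right_region p1 = left_region p2 ->
    right_region p4 = right_region p2 -> right_region p3 = left_region p4 ->
    right_region p2 = A ->
    positive_crossing p1 p2 p3 p4 <->
    crossing_condition Positive A (edge_label p1, bead p1) (edge_label p2, bead p2)
      (edge_label p3, bead p3) (edge_label p4, bead p4).
  move=> h1 h2 h3 <- /=; split; first by case=> _ [-> ->] [-> ->].
  by case=> -[e1' e2'] [e3' e4'].
have vir (p1 p2 p3 p4 : edge) A : right_region p1 = left_region p2 ->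
    right_region p4 = right_region p2 -> right_region p3 = left_region p4 ->
    right_region p2 = A ->
    virtual_crossing p1 p2 p3 p4 <->
    crossing_condition VirtualCrossing A (edge_label p1, bead p1) (edge_label p2, bead p2)
      (edge_label p3, bead p3) (edge_label p4, bead p4).
  move=> h1 h2 h3 <- /=; split; first by case=> _ [-> ->] [-> ->].
  by case=> -[e1' e2'] [e3' e4'].
have virC (p1 p2 p3 p4 : edge) : virtual_crossing p1 p2 p3 p4 <-> virtual_crossing p3 p4 p1 p2.
  by split; apply: virtual_crossingC.
case: b; case: b' => -[/= l1 r1 l2 r2] [/= l3 r3 l4 r4]; case: d; rewrite /crossing /=;
  do ?[apply: pos; congruence | apply: vir; congruence | rewrite virC; apply: vir; congruence].
Qed.

End Gaps.

Section Accessors.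

Variable c : nat.
Variable w : word c.

Definition point_of (l i : nat) : option (Defs.point w) :=
  if insub l is Some l' then
    omap (fun i' => Tagged (fun m : 'I_(size w).+1 => 'I_(size (row w m))) (i := l') i') (insub i)
  else None.

Definition gap_of (l i : nat) : option (gap w) :=
  if insub l is Some l' then
    omap (fun i' => Tagged (fun m : 'I_(size w).+1 => 'I_(size (row w m)).+1) (i := l') i')
      (insub i)
  else None.

Lemma point_ofK p : point_of (point_at p).1 (point_at p).2 = Some p.
Proof. by case: p => l i; rewrite /point_of /point_at /= !valK. Qed.

Lemma gap_ofK a : gap_of (gap_at a).1 (gap_at a).2 = Some a.
Proof. by case: a => l i; rewrite /gap_of /gap_at /= !valK. Qed.

Lemma point_ofE l i : l <= size w -> i < size (row w l) ->
  exists2 p, point_of l i = Some p & point_at p = (l, i).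
Proof.
move=> hl hi; rewrite -ltnS in hl; pose l' := Ordinal hl; pose i' : 'I_(size (row w l')) := Ordinal hi.
pose p : Defs.point w := Tagged (fun m : 'I_(size w).+1 => 'I_(size (row w m))) (i := l') i'.
by exists p => //; apply: (point_ofK p).
Qed.

Lemma gap_ofE l i : l <= size w -> i <= size (row w l) ->
  exists2 a, gap_of l i = Some a & gap_at a = (l, i).
Proof.
move=> hl hi; rewrite -ltnS in hl; rewrite -ltnS in hi.
pose l' := Ordinal hl; pose i' : 'I_(size (row w l')).+1 := Ordinal hi.
pose a : gap w := Tagged (fun m : 'I_(size w).+1 => 'I_(size (row w m)).+1) (i := l') i'.
by exists a => //; apply: (gap_ofK a).
Qed.

Lemma point_bounds (p : Defs.point w) :
  (point_at p).1 <= size w /\ (point_at p).2 < size (row w (point_at p).1).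
Proof. by case: p => l i /=; rewrite -ltnS !ltn_ord. Qed.

Lemma gap_bounds (a : gap w) :
  (gap_at a).1 <= size w /\ (gap_at a).2 <= size (row w (gap_at a).1).
Proof. by case: a => l i /=; rewrite -ltnS -[_ <= size (row w l)]ltnS !ltn_ord. Qed.

Lemma point_of_out l i : size (row w l) <= i -> point_of l i = None.
Proof.
move=> le; rewrite /point_of; case: insubP => // l' _ el; rewrite insubN //.
by rewrite -leqNgt el.
Qed.

Lemma onth_strand (p : Defs.point w) s :
  onth (row w (point_at p).1) (point_at p).2 = Some s -> strand p = s.
Proof.
by case: p => l i /= e; rewrite /strand /= (tnth_nth s); apply: onth_nth e.
Qed.

Lemma row_strand (p : Defs.point w) :
  onth (row w (point_at p).1) (point_at p).2 = Some (strand p).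
Proof.
case E : (onth _ _) => [s|]; first by rewrite (onth_strand E).
by have [_] := point_bounds p; rewrite -onthTE E.
Qed.

Lemma arc_of_step (p q : Defs.point w) : arc_step p q -> arc_of p = arc_of q.
Proof.
move=> st; apply/val_inj/eqP; rewrite /= root_connect; last exact: sym_step_connect.
by apply: connect1; apply/orP; left.
Qed.

Lemma region_of_step (a b : gap w) : gap_step a b -> region_of a = region_of b.
Proof.
move=> st; apply/val_inj/eqP; rewrite /= root_connect; last exact: sym_step_connect.
by apply: connect1; apply/orP; left.
Qed.

Lemma class_fun (T : finType) (Y : Type) (e : rel T) (F : T -> Y) x :
  (forall x y, e x y -> F x = F y) -> F (val (class_of e x)) = F x.
Proof.
move=> H; have := connect_root (sym_step e) x; rewrite /=.
case/connectP=> s + ->; elim: s x => //= y s IH x /andP[st /IH ->].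
by case/orP: st => /H.
Qed.

Lemma arc_of_val (a : semiarc w) : arc_of (val a) = a.
Proof.
apply: val_inj => /=; case: a => x /= /eqP; apply.
Qed.

Lemma region_of_val (a : region w) : region_of (val a) = a.
Proof.
apply: val_inj => /=; case: a => x /= /eqP; apply.
Qed.

End Accessors.

(** * Labelings with beads as closed chains *)

Lemma onth_take (T : Type) (s : seq T) k i : onth (take k s) i = if i < k then onth s i else None.
Proof. by elim: s k i => [|x s IH] [|k] [|i] //=; rewrite ?if_same // IH. Qed.

Lemma onth_drop (T : Type) (s : seq T) k i : onth (drop k s) i = onth s (k + i).
Proof. by elim: s k => [|x s IH] [|k] //=; rewrite ?onth0n // IH. Qed.

Lemma drop_onth (T : Type) (s : seq T) k x : onth s k = Some x -> drop k s = x :: drop k.+1 s.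
Proof. by elim: s k => [|y s IH] [|k] //=; [case=> -> ; rewrite drop0 | move=> /IH]. Qed.

Lemma eq_onth (T : Type) (s t : seq T) : (forall i, onth s i = onth t i) -> s = t.
Proof.
elim: s t => [|x s IH] [|y t] // h; [by have := h 0 | by have := h 0 | ].
by have [->] := h 0; congr (_ :: _); apply: IH => i; apply: (h i.+1).
Qed.

(** The strands on the left of an event are common to both levels, and those on
    its right are only renumbered. *)
Lemma fits_split c (R : strand_row c) k (ev : event c) : fits R (k, ev) ->
  exists a z z', [/\ R = a ++ z, after R (k, ev) = a ++ z', size a = k &
    match ev with
    | Min o m => z' = [:: (o, m), (~~ o, m) & z]
    | Max => exists b m, z = [:: (b, m), (~~ b, m) & z']
    | Cross _ => exists s1 s2 y, z = [:: s1, s2 & y] /\ z' = [:: s2, s1 & y]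
    end].
Proof.
move=> f; have le := fits_bound f; exists (take k R), (drop k R).
move: f; rewrite /fits /after /=; case: ev => [o m||d].
- by move=> _; exists [:: (o, m), (~~ o, m) & drop k R]; rewrite cat_take_drop size_takel.
- case E : (drop k R) => [|[b m] [|[b' m'] y]] //= /andP[/eqP eb /eqP em].
  subst b' m'; exists y; split; rewrite -?E ?cat_take_drop ?size_takel //.
  by exists b, m.
- case E : (drop k R) => [|s1 [|s2 y]] //= _; exists [:: s2, s1 & y].
  split; rewrite -?E ?cat_take_drop ?size_takel //.
  by exists s1, s2, y.
Qed.

Section Data.

Variables (X : virtual_birack) (S : shadow X) (G : shadow_module S) (c : nat).
Variable w : word c.
Hypothesis wok : link_diagram w.
Local Notation edge := (edge G).
Local Notation state := (state G).
Local Notation point := (Defs.point w).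
Implicit Types (f : labeling S w) (h : {ffun semiarc w -> G}) (p q : point).

Lemma row_step l e : onth w l = Some e ->
  row w l.+1 = after (row w l) e /\ fits (row w l) e.
Proof.
move=> E; split; last by case: wok => H _ _ _; apply: H.
have ll : l < size w by rewrite -onthTE E.
by rewrite /row (take_nth e ll) foldl_rcons (onth_nth _ _ _ _ E).
Qed.

Lemma row_size0 : row w (size w) = [::]. Proof. by case: wok. Qed.

(** The gap on the right of a strand, seen along its direction. *)
Definition right_gap p : gap w :=
  let: existT l i := p in
  Tagged (fun m : 'I_(size w).+1 => 'I_(size (row w m)).+1)
    (if (strand p).1 then lift ord0 i else widen_ord (leqnSn _) i).

Definition left_gap p : gap w :=
  let: existT l i := p in
  Tagged (fun m : 'I_(size w).+1 => 'I_(size (row w m)).+1)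
    (if (strand p).1 then widen_ord (leqnSn _) i else lift ord0 i).

Lemma right_gap_at p : gap_at (right_gap p) =
  ((point_at p).1, if (strand p).1 then (point_at p).2.+1 else (point_at p).2).
Proof. by case: p => l i; rewrite /gap_at /=; case: ifP. Qed.

Lemma left_gap_at p : gap_at (left_gap p) =
  ((point_at p).1, if (strand p).1 then (point_at p).2 else (point_at p).2.+1).
Proof. by case: p => l i; rewrite /gap_at /=; case: ifP. Qed.

Lemma gap_at_inj : injective (@gap_at c w).
Proof. by move=> a b e; apply: Some_inj; rewrite -!gap_ofK e. Qed.

Lemma point_at_inj : injective (@point_at c w).
Proof. by move=> a b e; apply: Some_inj; rewrite -!point_ofK e. Qed.

Definition data f h p : strand_state G :=
  ((strand p).1, ((region_label f (right_gap p), arc_label f p), h (arc_of p))).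

Lemma shadow_labelingP f : shadow_labeling f <->
  forall p, region_label f (left_gap p) = sh_act (region_label f (right_gap p)) (arc_label f p).
Proof.
split=> [H p|H p a b ea eb].
  have := H p; case up : (strand p).1 => Hp.
    by apply: Hp; rewrite ?left_gap_at ?right_gap_at up; case: (point_at p).
  by apply: Hp; rewrite ?left_gap_at ?right_gap_at up; case: (point_at p).
have := H p; case up : (strand p).1.
  by rewrite -(_ : a = left_gap p) -1?(_ : b = right_gap p) //; apply: gap_at_inj;
    rewrite ?left_gap_at ?right_gap_at up ?ea ?eb; case: (point_at p).
by rewrite -(_ : a = right_gap p) -1?(_ : b = left_gap p) //; apply: gap_at_inj;
    rewrite ?left_gap_at ?right_gap_at up ?ea ?eb; case: (point_at p).
Qed.

Lemma data_left f h p a : shadow_labeling f ->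
  gap_at a = point_at p -> sleft (data f h p) = region_label f a.
Proof.
move=> /shadow_labelingP H ea; rewrite /sleft /= /page_left; case up : (strand p).1.
  rewrite /left_region /= -H; congr (region_label f); apply: gap_at_inj.
  by rewrite left_gap_at up ea; case: (point_at p).
congr (region_label f); apply: gap_at_inj.
by rewrite right_gap_at up ea; case: (point_at p).
Qed.

Lemma data_right f h p a : shadow_labeling f ->
  gap_at a = ((point_at p).1, (point_at p).2.+1) -> sright (data f h p) = region_label f a.
Proof.
move=> /shadow_labelingP H ea; rewrite /sright /= /page_right; case up : (strand p).1.
  by congr (region_label f); apply: gap_at_inj; rewrite right_gap_at up ea.
rewrite /left_region /= -H; congr (region_label f); apply: gap_at_inj.
by rewrite left_gap_at up ea.
Qed.

(** The states of the chain are what the labeling with its beads puts on the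
    strands of each level. *)
Record reads (A : S) (ss : seq state) f h : Prop := {
  reads_size : size ss = size w;
  reads_data : forall l i, l <= size w ->
    onth (nth [::] ([::] :: ss) l) i = omap (data f h) (point_of w l i);
  reads_region : forall a : gap w,
    region_label f a = gap_region A (nth [::] ([::] :: ss) (gap_at a).1) (gap_at a).2 }.

Definition valid f h := [/\ birack_labeling f, shadow_labeling f & bead_relations f h].

Lemma birack_and_beads f h : birack_labeling f /\ bead_relations f h <->
  forall k ll lr ul ur A, crossing_at k ll lr ul ur A ->
    crossing_condition k (region_label f A) (arc_label f ll, h (arc_of ll))
      (arc_label f lr, h (arc_of lr)) (arc_label f ul, h (arc_of ul))
      (arc_label f ur, h (arc_of ur)).
Proof.
split=> [[H1 H2] k ll lr ul ur A cr|H].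
  by have := H1 _ _ _ _ _ _ cr; have := H2 _ _ _ _ _ _ cr; case: k cr.
split=> k ll lr ul ur A cr; have := H _ _ _ _ _ _ cr; by case: k cr => _ [].
Qed.

(** The gaps in the four corners of a crossing; the two outer ones continue
    from one level to the next. *)
Lemma crossing_strands l i x (bl br tl tr : point) : onth w l = Some (i, Cross x) ->
  point_at bl = (l, i) -> point_at br = (l, i.+1) ->
  point_at tl = (l.+1, i) -> point_at tr = (l.+1, i.+1) ->
  [/\ strand tl = strand br, strand tr = strand bl & exists L B R T : gap w,
    [/\ gap_at L = (l, i), gap_at B = (l, i.+1), gap_at R = (l, i.+2) & gap_at T = (l.+1, i.+1)]
    /\ exists L' R' : gap w, [/\ gap_at L' = (l.+1, i), gap_at R' = (l.+1, i.+2),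
      region_of L = region_of L' & region_of R = region_of R']].
Proof.
move=> E ebl ebr etl etr; have [er /fits_split[a [z [z' [e1 e2 sa [s1 [s2 [y [ez ez']]]]]]]]] := row_step E.
have ll : l < size w by rewrite -onthTE E.
have st p k s : point_at p = k -> onth (row w k.1) k.2 = Some s -> strand p = s.
  by move=> <-; apply: onth_strand.
have r1 j s : onth z j = Some s -> onth (row w l) (i + j) = Some s.
  by move=> h; rewrite e1 onth_cat -sa ltnNge leq_addr /= addKn.
have r2 j s : onth z' j = Some s -> onth (row w l.+1) (i + j) = Some s.
  by move=> h; rewrite er e2 onth_cat -sa ltnNge leq_addr /= addKn.
have s_bl : strand bl = s1 by apply: (st _ _ _ ebl); rewrite -[i]addn0; apply: r1; rewrite ez.
have s_br : strand br = s2 by apply: (st _ _ _ ebr); rewrite -addn1; apply: r1; rewrite ez.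
have s_tl : strand tl = s2 by apply: (st _ _ _ etl); have := r2 0 s2; rewrite addn0; apply; rewrite ez'.
have s_tr : strand tr = s1 by apply: (st _ _ _ etr); have := r2 1 s1; rewrite addn1; apply; rewrite ez'.
split; [by rewrite s_tl s_br | by rewrite s_tr s_bl | ].
have sz : i.+2 <= size (row w l) by rewrite e1 size_cat sa ez /= !addnS !ltnS leq_addr.
have sz' : i.+2 <= size (row w l.+1) by rewrite er e2 size_cat sa ez' /= !addnS !ltnS leq_addr.
have [L _ eL] := gap_ofE (ltnW ll) (ltnW (ltnW sz)).
have [B _ eB] := gap_ofE (ltnW ll) (ltnW sz).
have [R _ eR] := gap_ofE (ltnW ll) sz.
have [T _ eT] := gap_ofE ll (ltnW sz').
have [L' _ eL'] := gap_ofE ll (ltnW (ltnW sz')).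
have [R' _ eR'] := gap_ofE ll sz'.
exists L, B, R, T; split=> //; exists L', R'; split=> //; apply: region_of_step.
  by rewrite /gap_step eL eL' E !eqxx /= neq_ltn leqnn.
by rewrite /gap_step eR eR' E !eqxx /= neq_ltn leqnn orbT.
Qed.

(** The crossing condition is stated at the gap on the right of the rotated
    picture, which is one of the four corners. *)
Lemma crossing_data f h l i x (bl br tl tr : point) A : shadow_labeling f ->
  onth w l = Some (i, Cross x) ->
  point_at bl = (l, i) -> point_at br = (l, i.+1) ->
  point_at tl = (l.+1, i) -> point_at tr = (l.+1, i.+1) ->
  let b := (strand bl).1 in let b' := (strand br).1 in
  gap_at A = right_of_crossing b b' l i ->
  let: (ll, lr, ul, ur) := rotate_upward b b' bl br tl tr in
  crossing x b b' (data f h bl).2 (data f h br).2 (data f h tl).2 (data f h tr).2 <->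
  crossing_condition (crossing_type_of x b b') (region_label f A)
    (arc_label f ll, h (arc_of ll)) (arc_label f lr, h (arc_of lr))
    (arc_label f ul, h (arc_of ul)) (arc_label f ur, h (arc_of ur)).
Proof.
move=> sf E ebl ebr etl etr b b' eA.
have [stl str [L [B [R [T [[eL eB eR eT] [L' [R' [eL' eR' rL rR]]]]]]]]] :=
  crossing_strands E ebl ebr etl etr.
have lab (a a' : gap w) : region_of a = region_of a' -> region_label f a = region_label f a'.
  by rewrite /region_label => ->.
have d1 : page_left b (data f h bl).2 = region_label f L.
  by apply: (data_left h sf); rewrite eL ebl.
have d2 : page_right b (data f h bl).2 = region_label f B.
  by apply: (data_right h sf); rewrite eB ebl.
have d3 : page_left b' (data f h br).2 = region_label f B.
  by apply: (data_left h sf); rewrite eB ebr.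
have d4 : page_right b' (data f h br).2 = region_label f R.
  by apply: (data_right h sf); rewrite eR ebr.
have d5 : page_left b' (data f h tl).2 = region_label f L.
  by rewrite (lab _ _ rL) /b' -stl; apply: (data_left h sf); rewrite eL' etl.
have d6 : page_right b' (data f h tl).2 = region_label f T.
  by rewrite /b' -stl; apply: (data_right h sf); rewrite eT etl.
have d7 : page_left b (data f h tr).2 = region_label f T.
  by rewrite /b -str; apply: (data_left h sf); rewrite eT etr.
have d8 : page_right b (data f h tr).2 = region_label f R.
  by rewrite (lab _ _ rR) /b -str; apply: (data_right h sf); rewrite eR' etr.
have := crossing_conditionP x (And4 d1 d2 d3 d4) (And4 d5 d6 d7 d8).
have -> : (if b then if b' then region_label f R else region_label f B
   else if b' then region_label f T else region_label f L) = region_label f A.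
  move: eA; case: (b); case: (b') => /= eA; congr (region_label f); apply: gap_at_inj;
    by rewrite eA.
by case: (b); case: (b').
Qed.

End Data.

Lemma onth_pmap_iota (T : Type) (g : nat -> option T) n :
  (forall i, g i = (i < n) :> bool) ->
  forall i, onth (pmap g (iota 0 n)) i = g i.
Proof.
move=> H; have none i : n <= i -> g i = None.
  by have := H i; rewrite ltnNge; case: (g i) => // a; case: leqP.
suff E m k i : m + k = n -> onth (pmap g (iota m k)) i = g (m + i).
  by move=> i; rewrite E.
elim: k m i => [|k IH] m i e /=; first by rewrite onth0n none // -e addn0 leq_addr.
have := H m; rewrite -e addnS ltnS leq_addr /oapp.
case E : (g m) => [x|] //= _; case: i => [|i] /=; first by rewrite addn0.
by rewrite IH ?addSnnS.
Qed.

(** The strands that an event does not touch, with their positions below and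
    above it. *)
Definition carried c (k : nat) (ev : event c) (i j : nat) : bool :=
  match ev with
  | Min _ _ => j == (if i < k then i else i.+2)
  | Max => i == (if j < k then j else j.+2)
  | Cross _ => [&& j == i, i != k & i != k.+1]
  end.

(** The gaps that an event does not end or create, with their positions below
    and above it. *)
Definition carried_gap c (k : nat) (ev : event c) (i j : nat) : bool :=
  match ev with
  | Min _ _ => ((i <= k) && (j == i)) || ((k <= i) && (j == i.+2))
  | Max => ((j <= k) && (i == j)) || ((k <= j) && (i == j.+2))
  | Cross _ => (j == i) && (i != k.+1)
  end.

Section Levels.

Variables (X : virtual_birack) (S : shadow X) (G : shadow_module S) (c : nat).
Variable w : word c.
Hypothesis wok : link_diagram w.
Local Notation edge := (edge G).
Local Notation state := (state G).
Local Notation point := (Defs.point w).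
Implicit Types (f : labeling S w) (h : {ffun semiarc w -> G}) (p q : point).

Lemma carried_row l k ev i j : onth w l = Some (k, ev) -> carried k ev i j ->
  onth (row w l) i = onth (row w l.+1) j.
Proof.
move=> E; have [-> /fits_split[a [z [z' [-> -> sa h]]]]] := row_step wok E.
rewrite !onth_cat sa; case: ev {E} h => [o m -> /eqP->|[b [m ->]] /eqP->|d].
- case: (ltnP i k) => [->|lt] //.
  have -> : i.+2 < k = false by lia.
  by have -> : i.+2 - k = (i - k).+2 by lia.
- case: (ltnP j k) => [->|lt] //.
  have -> : j.+2 < k = false by lia.
  by have -> : j.+2 - k = (j - k).+2 by lia.
case=> s1 [s2 [y [-> ->]]] /and3P[/eqP-> i1 i2]; case: ltnP => // le.
by have -> : i - k = (i - k.+2).+2 by lia.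
Qed.

Lemma carried_step l k ev p q : onth w l = Some (k, ev) ->
  point_at p = (l, (point_at p).2) -> point_at q = (l.+1, (point_at q).2) ->
  carried k ev (point_at p).2 (point_at q).2 ->
  arc_of p = arc_of q /\ region_of (right_gap p) = region_of (right_gap q).
Proof.
move=> E ep eq ca; have e : strand p = strand q.
  apply: onth_strand; rewrite ep /= (carried_row E ca).
  by have := row_strand q; rewrite {1}eq.
split; first by apply: arc_of_step; rewrite /arc_step ep eq eqxx E /= -/(carried k ev _ _) ca.
apply: region_of_step; rewrite /gap_step !right_gap_at ep eq e.
move: ca; move: (point_at p).2 (point_at q).2 (strand q).1 => i j b.
rewrite /= eqxx E /=; case: b; case: (ev) => [o m||d] /=; try (case: ifP => ?); lia.
Qed.

Definition data_at f h l i := omap (data f h) (point_of w l i).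

(** The arc and the region on the right of an untouched strand continue
    upward. *)
Lemma data_at_carried f h l k ev i j : onth w l = Some (k, ev) -> carried k ev i j ->
  data_at f h l i = data_at f h l.+1 j.
Proof.
move=> E ca; have er := carried_row E ca; have ll : l < size w by rewrite -onthTE E.
rewrite /data_at; case: (ltnP i (size (row w l))) => hi.
  have hj : j < size (row w l.+1) by rewrite -onthTE -er onthTE.
  have [p -> ep] := point_ofE (ltnW ll) hi; have [q -> eq] := point_ofE ll hj.
  have [] := @carried_step l k ev p q E; rewrite ?ep ?eq //= => e1 e2.
  have es : strand p = strand q.
    by apply: onth_strand; rewrite ep /= er; have := row_strand q; rewrite eq.
  by rewrite /= /data /arc_label /region_label e1 e2 es.
have hj : size (row w l.+1) <= j by rewrite -onthNE -er onthNE.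
by rewrite !point_of_out.
Qed.

Lemma gap_carried l k ev (a b : gap w) : onth w l = Some (k, ev) ->
  gap_at a = (l, (gap_at a).2) -> gap_at b = (l.+1, (gap_at b).2) ->
  carried_gap k ev (gap_at a).2 (gap_at b).2 -> region_of a = region_of b.
Proof. by move=> E ea eb ca; apply: region_of_step; rewrite /gap_step ea eb eqxx E. Qed.

Definition state_at f h l : state := pmap (data_at f h l) (iota 0 (size (row w l))).

Lemma onth_state_at f h l i : l <= size w -> onth (state_at f h l) i = data_at f h l i.
Proof.
move=> ll; apply: onth_pmap_iota => {}i; rewrite /data_at; case: ltnP => hi.
  by have [p ->] := point_ofE ll hi.
by rewrite point_of_out.
Qed.

(** The gaps on the left of all strands belong to the unbounded region. *)
Lemma outer_region (a b : gap w) : (gap_at a).2 = 0 -> (gap_at b).2 = 0 -> region_of a = region_of b.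
Proof.
suff H a' : (gap_at a').2 = 0 -> exists2 a0 : gap w, gap_at a0 = (0, 0) & region_of a' = region_of a0.
  move=> /H[a0 e ->] /H[b0 e' ->]; congr region_of; apply: gap_at_inj; by rewrite e.
case E : (gap_at a') => [l i] /= i0; move: E; rewrite {}i0.
have [] := gap_bounds a'; move=> + _ E; rewrite E /=; elim: l a' E => [|l IH] a' E ll; first by exists a'.
have [b1 _ eb] := gap_ofE (ltnW ll) (leq0n (size (row w l))).
have [a0 e0 eb0] := IH b1 eb (ltnW ll); exists a0 => //; rewrite -eb0.
case El : (onth w l) => [[k ev]|]; last by move: ll; rewrite -onthTE El.
by apply/esym/(gap_carried El); rewrite ?eb ?E //; case: (ev).
Qed.

(** Going from the left to the right across a level, each strand determines the
    next region. *)
Lemma region_at f h A (a : gap w) : shadow_labeling f ->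
  (forall b : gap w, gap_at b = (0, 0) -> region_label f b = A) ->
  region_label f a = gap_region A (state_at f h (gap_at a).1) (gap_at a).2.
Proof.
move=> sf hA; have [ll hi] := gap_bounds a; case E : (gap_at a) => [l [|i]] /=.
  have -> (s : state) : gap_region A s 0 = A by case: s.
  have [b _ eb] := gap_ofE (leq0n (size w)) (leq0n (size (row w 0))).
  by rewrite -(hA b eb) /region_label (@outer_region a b) ?E ?eb.
rewrite E /= in ll hi; have [p hp ep] := point_ofE ll hi.
rewrite (@gap_regionS _ _ _ A _ i (data f h p)); last by rewrite onth_state_at // /data_at hp.
by rewrite (@data_right _ _ _ _ _ _ _ _ a) // ep.
Qed.

(** The states are the data on the successive levels. *)
Lemma reads_ex f h : shadow_labeling f -> exists A ss, reads A ss f h.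
Proof.
move=> sf; have [b _ eb] := gap_ofE (leq0n (size w)) (leq0n (size (row w 0))).
exists (region_label f b), [seq state_at f h l | l <- iota 1 (size w)].
have E l : l <= size w ->
    nth [::] ([::] :: [seq state_at f h l | l <- iota 1 (size w)]) l = state_at f h l.
  case: l => [|l] ll; first by rewrite /state_at /row take0.
  by rewrite /= (nth_map 0) ?size_iota // nth_iota.
split; first by rewrite size_map size_iota.
  by move=> l i ll; rewrite E // onth_state_at.
move=> a; have [ll _] := gap_bounds a; rewrite E // -region_at // => b' eb'.
by congr (region_label f); apply: gap_at_inj; rewrite eb'.
Qed.

End Levels.

Lemma event_relE (X : virtual_birack) (S : shadow X) (G : shadow_module S) A k p (σ τ : state G) :
  coherent A σ -> k <= size σ ->
  event_rel A k p σ τ <->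
  take k τ = take k σ /\ event_at_0 (gap_region A σ k) p (drop k σ) (drop k τ).
Proof.
move=> co lk; split=> [/event_split[a [σ' [τ' [e1 e2 e3 H]]]]|[et H]].
  by move: H; rewrite e1 e2 -e3 !take_size_cat // !drop_size_cat.
rewrite -[σ in event_rel _ _ _ σ](cat_take_drop k) -[τ](cat_take_drop k) et.
rewrite -{1}(size_takel lk); apply: event_join; rewrite ?cat_take_drop // size_takel //.
Qed.

Section ReadCrossings.

Variables (X : virtual_birack) (S : shadow X) (G : shadow_module S) (c : nat).
Variable w : word c.
Hypothesis wok : link_diagram w.
Local Notation edge := (edge G).
Local Notation state := (state G).
Local Notation point := (Defs.point w).
Implicit Types (f : labeling S w) (h : {ffun semiarc w -> G}) (p q : point).

Section Reads.

Variables (A : S) (ss : seq state) (f : labeling S w) (h : {ffun semiarc w -> G}).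
Hypotheses (rd : reads A ss f h) (sf : shadow_labeling f).
Local Notation st := (nth [::] ([::] :: ss)).

Lemma reads_size_row l : l <= size w -> size (st l) = size (row w l).
Proof.
move=> ll; apply/eqP; rewrite eqn_leq; apply/andP.
have E i : onth (st l) i = onth (row w l) i :> bool.
  rewrite (reads_data rd) //; case: (ltnP i (size (row w l))) => hi.
    by have [p -> _] := point_ofE ll hi; rewrite onthTE hi.
  by rewrite point_of_out // onthTE ltnNge hi.
by split; rewrite leqNgt -onthTE; [rewrite E | rewrite -E]; rewrite onthTE ltnn.
Qed.

Lemma reads_coherent l : l <= size w -> coherent A (st l).
Proof.
move=> ll; apply/coherentP => i s; rewrite (reads_data rd) //.
case: (ltnP i (size (row w l))) => hi; last by rewrite point_of_out.
have [p -> ep] := point_ofE ll hi => -[<-].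
have [a _ ea] := gap_ofE ll (ltnW hi).
by rewrite (@data_left _ _ _ _ _ _ _ _ a) // ?ea ?ep // (reads_region rd) ea.
Qed.

(** Minima, maxima and untouched strands impose nothing, because the semiarcs
    and regions of the diagram already identify what they identify; only
    crossings give conditions. *)
Lemma event_at_level l k ev : onth w l = Some (k, ev) ->
  event_rel A k (bare ev) (st l) (st l.+1) <->
  forall x bl br tl tr, ev = Cross x ->
    point_at bl = (l, k) -> point_at br = (l, k.+1) ->
    point_at tl = (l.+1, k) -> point_at tr = (l.+1, k.+1) ->
    crossing x (strand bl).1 (strand br).1
      (data f h bl).2 (data f h br).2 (data f h tl).2 (data f h tr).2.
Proof.
move=> E; have lw : l < size w by rewrite -onthTE E.
have [er fi] := row_step wok E; have [a [z [z' [e1 e2 sa hz]]]] := fits_split fi.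
have lk : k <= size (st l) by rewrite (reads_size_row (ltnW lw)) -sa e1 size_cat leq_addr.
have D i : onth (st l) i = data_at f h l i by rewrite (reads_data rd _ (ltnW lw)).
have D' i : onth (st l.+1) i = data_at f h l.+1 i by rewrite (reads_data rd).
have ca i j : carried k ev i j -> onth (st l) i = onth (st l.+1) j.
  by move=> h'; rewrite D D' (data_at_carried wok f h E h').
rewrite event_relE //; last by apply: reads_coherent; apply: ltnW.
have -> : take k (st l.+1) = take k (st l).
  apply: eq_onth => i; rewrite !onth_take; case: ifP => // ik; apply/esym/ca.
  by case: (ev) => [o m||d] /=; rewrite ?ik // eqxx; lia.
have pt i (s : bool * 'I_c) : onth z i = Some s -> exists p,
    [/\ point_at p = (l, k + i), strand p = s & onth (st l) (k + i) = Some (data f h p)].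
  move=> hs; have hr : onth (row w l) (k + i) = Some s.
    by rewrite e1 onth_cat sa ltnNge leq_addr addKn.
  have hi : k + i < size (row w l) by rewrite -onthTE hr.
  have [p h1 h2] := point_ofE (ltnW lw) hi; exists p; rewrite D /data_at h1; split=> //.
  by apply: onth_strand; rewrite h2.
have pt' i (s : bool * 'I_c) : onth z' i = Some s -> exists p,
    [/\ point_at p = (l.+1, k + i), strand p = s & onth (st l.+1) (k + i) = Some (data f h p)].
  move=> hs; have hr : onth (row w l.+1) (k + i) = Some s.
    by rewrite er e2 onth_cat sa ltnNge leq_addr addKn.
  have hi : k + i < size (row w l.+1) by rewrite -onthTE hr.
  have [p h1 h2] := point_ofE lw hi; exists p; rewrite D' /data_at h1; split=> //.
  by apply: onth_strand; rewrite h2.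
have lkr : k <= size (row w l) by rewrite e1 size_cat sa leq_addr.
have lkr' : k <= size (row w l.+1) by rewrite er e2 size_cat sa leq_addr.
have [g _ eg] := gap_ofE (ltnW lw) lkr; have [g' _ eg'] := gap_ofE lw lkr'.
have rg : region_of g = region_of g'.
  by apply: (gap_carried E); rewrite ?eg ?eg' //=; case: (ev) => [o m||d] /=; lia.
have -> : gap_region A (st l) k = region_label f g by rewrite (reads_region rd) eg.
clear lkr lkr' er fi e1 e2.
case: ev E hz ca => [o m||x] E hz ca /=.
- have [p [ep sp hp]] : exists p, [/\ point_at p = (l.+1, k + 0), strand p = (o, m)
      & onth (st l.+1) (k + 0) = Some (data f h p)] by apply: pt'; rewrite hz.
  have [q [eq sq hq]] : exists p, [/\ point_at p = (l.+1, k + 1), strand p = (~~ o, m)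
      & onth (st l.+1) (k + 1) = Some (data f h p)] by apply: pt'; rewrite hz.
  rewrite addn0 in ep hp; rewrite addn1 in eq hq.
  split=> // _; split=> //; exists (data f h p).2.
    have := @data_left _ _ _ _ _ f h p g' sf; rewrite eg' ep => /(_ erefl).
    by rewrite /sleft /= sp /= /region_label rg.
  have dpq : (data f h q).2 = (data f h p).2.
    have ea : arc_of p = arc_of q.
      by apply: arc_of_step; rewrite /arc_step ep eq !eqxx /= E eqxx !orbT.
    rewrite /data /arc_label /= -ea; congr ((_, _), _).
    have [g2 _ eg2] : exists2 g2, gap_of w l.+1 k.+2 = Some g2 & gap_at g2 = (l.+1, k.+2).
      by apply: gap_ofE => //; have [_] := point_bounds q; rewrite eq.
    have r2 : region_of g = region_of g2.
      by apply: (gap_carried E); rewrite ?eg ?eg2 //=; lia.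
    rewrite /region_label; congr (f.2 _).
    case: (o) sp sq => sp sq.
      by congr region_of; apply: gap_at_inj; rewrite !right_gap_at ep eq sp sq.
    have -> : right_gap q = g2 by apply: gap_at_inj; rewrite right_gap_at sq eq eg2.
    have -> : right_gap p = g' by apply: gap_at_inj; rewrite right_gap_at sp ep eg'.
    by rewrite -r2 rg.
  rewrite (drop_onth hp) (drop_onth hq) -{2}dpq; congr [:: _, _ & _].
  - by rewrite /data sp.
  - by rewrite /data sq.
  apply: eq_onth => i; rewrite !onth_drop; apply/esym/ca => /=.
  by case: ifP; lia.
- have [b [m ez]] := hz.
  have [p [ep sp hp]] : exists p, [/\ point_at p = (l, k + 0), strand p = (b, m)
      & onth (st l) (k + 0) = Some (data f h p)] by apply: pt; rewrite ez.
  have [q [eq sq hq]] : exists p, [/\ point_at p = (l, k + 1), strand p = (~~ b, m)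
      & onth (st l) (k + 1) = Some (data f h p)] by apply: pt; rewrite ez.
  rewrite addn0 in ep hp; rewrite addn1 in eq hq.
  split=> // _; split=> //.
  have dpq : (data f h q).2 = (data f h p).2.
    have ea : arc_of p = arc_of q.
      by apply: arc_of_step; rewrite /arc_step ep eq !eqxx /= E eqxx !orbT.
    rewrite /data /arc_label /= -ea; congr ((_, _), _).
    have [g2 _ eg2] : exists2 g2, gap_of w l k.+2 = Some g2 & gap_at g2 = (l, k.+2).
      by apply: gap_ofE; [apply: ltnW | have [_] := point_bounds q; rewrite eq].
    have r2 : region_of g2 = region_of g'.
      by apply: (gap_carried E); rewrite ?eg' ?eg2 //=; lia.
    rewrite /region_label; congr (f.2 _).
    case: (b) sp sq => sp sq.
      by congr region_of; apply: gap_at_inj; rewrite !right_gap_at ep eq sp sq.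
    have -> : right_gap q = g2 by apply: gap_at_inj; rewrite right_gap_at sq eq eg2.
    have -> : right_gap p = g by apply: gap_at_inj; rewrite right_gap_at sp ep eg.
    by rewrite r2 rg.
  rewrite (drop_onth hp) (drop_onth hq) [data f h p]surjective_pairing
    [data f h q]surjective_pairing dpq; split=> //; last 1 first.
  + apply: eq_onth => i; rewrite !onth_drop; apply/esym/ca => /=.
    by case: ifP; lia.
  + have := @data_left _ _ _ _ _ f h p g sf; rewrite eg ep => /(_ erefl).
    by rewrite /sleft.
  + by rewrite /= sp sq.
have [s1 [s2 [y [ez ez']]]] := hz.
have [bl [ebl sbl hbl]] : exists p, [/\ point_at p = (l, k + 0), strand p = s1
    & onth (st l) (k + 0) = Some (data f h p)] by apply: pt; rewrite ez.
have [br [ebr sbr hbr]] : exists p, [/\ point_at p = (l, k + 1), strand p = s2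
    & onth (st l) (k + 1) = Some (data f h p)] by apply: pt; rewrite ez.
have [tl [etl stl htl]] : exists p, [/\ point_at p = (l.+1, k + 0), strand p = s2
    & onth (st l.+1) (k + 0) = Some (data f h p)] by apply: pt'; rewrite ez'.
have [tr [etr str htr]] : exists p, [/\ point_at p = (l.+1, k + 1), strand p = s1
    & onth (st l.+1) (k + 1) = Some (data f h p)] by apply: pt'; rewrite ez'.
rewrite !addn0 in ebl hbl etl htl; rewrite !addn1 in ebr hbr etr htr.
rewrite (drop_onth hbl) (drop_onth hbr) (drop_onth htl) (drop_onth htr).
rewrite [in X in X <-> _]/data; split.
  move=> [_ [_ _ _ _ cr]] x' bl' br' tl' tr' [<-].
  rewrite -ebl -ebr -etl -etr => /point_at_inj-> /point_at_inj-> /point_at_inj-> /point_at_inj->.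
  exact: cr.
move=> H; split=> //; split; [ | by rewrite stl sbr | by rewrite str sbl | | exact: H].
  have := @data_left _ _ _ _ _ f h bl g sf; rewrite eg ebl => /(_ erefl).
  by rewrite /sleft.
apply: eq_onth => i; rewrite !onth_drop; apply/esym/ca => /=; lia.
Qed.

Lemma reads_closed_chain :
  closed_chain A (map (@tile_of c) w) ss <-> birack_labeling f /\ bead_relations f h.
Proof.
rewrite birack_and_beads; split=> [[ch _]|H].
  move=> k ll lr ul ur a [l [i [x [bl [br [tl [tr /= [E [ebl ebr etl etr] -> e5 ea]]]]]]]].
  have lw : l < size (map (@tile_of c) w) by rewrite size_map -onthTE E.
  have := chain_nth (0, PMax) ch lw; rewrite size_map in lw.
  rewrite (nth_map (i, Cross x)) // (onth_nth _ _ _ _ E) => /(event_at_level E).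
  move=> /(_ x bl br tl tr erefl ebl ebr etl etr).
  have := crossing_data wok h sf E ebl ebr etl etr ea; rewrite -e5.
  by move=> h1 /h1.
have sz := reads_size rd; split.
  apply: (@nth_chain _ _ _ _ _ _ _ (0, PMax)); first by rewrite size_map.
  move=> l; rewrite size_map => lw.
  have [[k ev] E] : exists e, onth w l = Some e.
    by case E : (onth w l) => [e|]; [exists e | move: lw; rewrite -onthTE E].
  rewrite (nth_map (k, ev)) // (onth_nth _ _ _ _ E); apply/(event_at_level E).
  move=> x bl br tl tr ex ebl ebr etl etr; rewrite {}ex in E.
  have [_ _ [L [B [R [T [[eL eB eR eT] _]]]]]] := crossing_strands wok E ebl ebr etl etr.
  have [a ea] : exists a : gap w, gap_at a = right_of_crossing (strand bl).1 (strand br).1 l k.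
    by case: (strand bl).1; case: (strand br).1; [exists R | exists B | exists T | exists L].
  have := crossing_data wok h sf E ebl ebr etl etr ea.
  have cr : crossing_at (crossing_type_of x (strand bl).1 (strand br).1)
     (rotate_upward (strand bl).1 (strand br).1 bl br tl tr).1.1.1
     (rotate_upward (strand bl).1 (strand br).1 bl br tl tr).1.1.2
     (rotate_upward (strand bl).1 (strand br).1 bl br tl tr).1.2
     (rotate_upward (strand bl).1 (strand br).1 bl br tl tr).2 a.
    exists l, k, x, bl, br, tl, tr; split=> //.
    by case: rotate_upward => -[[]].
  have := H _ _ _ _ _ _ cr; case: rotate_upward => -[[ll lr] ul] ur /= h1 h2.
  by apply/h2.
have := reads_size_row (leqnn _); rewrite row_size0 // -sz -last_take_nth // take_size.
by move/size0nil.
Qed.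

End Reads.

End ReadCrossings.

Section Steps.

Variables (X : virtual_birack) (S : shadow X) (G : shadow_module S).
Implicit Types (σ τ : state G).

(** Conversely, the events identify the regions of gaps that the steps of the
    diagram connect. *)
Lemma event_gap c (ev : event c) A k σ τ i j : event_rel A k (bare ev) σ τ ->
  carried_gap k ev i j -> gap_region A σ i = gap_region A τ j.
Proof.
case/event_split=> a [σ' [τ' [-> -> <- H]]].
have at_k ρ : gap_region A (a ++ ρ) (size a) = gap_region A a (size a) by rewrite gap_region_catl.
rewrite at_k in H.
have low i' : i' <= size a -> gap_region A (a ++ σ') i' = gap_region A (a ++ τ') i'.
  by move=> le; rewrite !gap_region_catl.
have high i' : size a <= i' -> i' = size a + (i' - size a) by move=> /subnKC.
case: ev H => [o m||d] /=.
- move=> [e ee ->] /orP[] /andP[le /eqP->]; first by rewrite !gap_region_catl.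
  rewrite (high _ le) -!addnS !gap_region_cat /= /sright /= page_right_neg.
  by rewrite ee.
- case: σ' {low} => [|[b1 e1] [|[b2 e2] σ']] // [eL -> -> ->].
  case/orP=> /andP[le /eqP->]; first by rewrite !gap_region_catl.
  by rewrite (high _ le) -!addnS !gap_region_cat /= /sright /= page_right_neg eL.
case: σ' low => [|[b1 e1] [|[b2 e2] σ']] low //.
case: τ' low => [|[b3 e3] [|[b4 e4] τ']] low //.
move=> [_ _ eb et /crossing_pages[_ _ _ p4]] /andP[/eqP-> ne]; subst b4 τ'.
case: (leqP i (size a)) => [/low //|lt].
have -> : i = size a + (i - (size a).+2).+2 by lia.
by rewrite !gap_region_cat /= /sright /= p4.
Qed.

Lemma event_carried c (ev : event c) A k σ τ i j : event_rel A k (bare ev) σ τ ->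
  carried k ev i j -> onth σ i = onth τ j.
Proof.
case/event_split=> a [σ' [τ' [-> -> <- H]]]; rewrite !onth_cat.
case: ev H => [o m||d] /=.
- move=> [e _ ->] /eqP->; case: (ltnP i (size a)) => [->|lt] //.
  have -> : i.+2 < size a = false by lia.
  by have -> : i.+2 - size a = (i - size a).+2 by lia.
- case: σ' => [|[b1 e1] [|[b2 e2] σ']] // [_ _ _ ->] /eqP->.
  case: (ltnP j (size a)) => [->|lt] //.
  have -> : j.+2 < size a = false by lia.
  by have -> : j.+2 - size a = (j - size a).+2 by lia.
case: σ' => [|[b1 e1] [|[b2 e2] σ']] //; case: τ' => [|[b3 e3] [|[b4 e4] τ']] //.
move=> [_ _ _ -> _] /and3P[/eqP-> i1 i2]; case: ltnP => // le.
by have -> : i - size a = (i - (size a).+2).+2 by lia.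
Qed.

End Steps.

Section ReadChains.

Variables (X : virtual_birack) (S : shadow X) (G : shadow_module S) (c : nat).
Variable w : word c.
Hypothesis wok : link_diagram w.
Local Notation edge := (edge G).
Local Notation state := (state G).
Local Notation point := (Defs.point w).
Implicit Types (f : labeling S w) (h : {ffun semiarc w -> G}) (p q : point).

Lemma dirs_rows l : l <= size w ->
  foldl (fun ds t => dirs_after ds t.1 t.2) [::] (take l (map (@tile_of c) w)) = map fst (row w l).
Proof.
elim: l => [|l IH] ll; first by rewrite /row !take0.
have [e E] : exists e, onth w l = Some e.
  by case E : (onth w l) => [e|]; [exists e | move: ll; rewrite -onthTE E].
have [-> fi] := row_step wok E.
rewrite (take_nth (tile_of e)) ?size_map // foldl_rcons IH ?(ltnW ll) //.
rewrite (nth_map e) // (onth_nth _ _ _ _ E).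
by rewrite dirs_after_fits.
Qed.

(** The edges of a closed chain are constant along arcs and its regions along
    gap steps, so they define labels and beads on semiarcs and regions. *)
Lemma closed_chain_reads A (ss : seq state) : closed_chain A (map (@tile_of c) w) ss ->
  exists f h, reads A ss f h /\ shadow_labeling f.
Proof.
move=> [ch _]; have sz : size ss = size w by rewrite (chain_size ch) size_map.
pose st := nth [::] ([::] :: ss).
have lst l : l <= size w -> st l = last [::] (take l ss).
  by move=> ll; rewrite last_take_nth ?sz.
have co l : l <= size w -> coherent A (st l).
  by move=> ll; rewrite lst //; apply: (chain_coherent (chain_take l ch)).
have dr l : l <= size w -> map fst (st l) = map fst (row w l).
  by move=> ll; rewrite lst // -dirs_rows // -(chain_dirs (chain_take l ch)).
have sr l : l <= size w -> size (st l) = size (row w l).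
  by move=> /dr/(congr1 size); rewrite !size_map.
have ev l k e : onth w l = Some (k, e) -> event_rel A k (bare e) (st l) (st l.+1).
  move=> E; have lw : l < size w by rewrite -onthTE E.
  have := @chain_nth _ _ _ _ _ _ _ (0, PMax) l ch; rewrite size_map => /(_ lw).
  by rewrite (nth_map (k, e)) // (onth_nth _ _ _ _ E).
(* F gives the edges of the points; the chain has one for each of them because
   its rows have the directions of the rows of w, hence their sizes. *)
have /choice[F FP] : forall p, exists s, onth (st (point_at p).1) (point_at p).2 = Some s.
  move=> p; have [ll hi] := point_bounds p.
  case E : (onth _ _) => [s|]; first by exists s.
  by move: hi; rewrite -sr // -onthTE E.
have Fdir p : (F p).1 = (strand p).1.
  have [ll hi] := point_bounds p.
  have := congr1 (fun s => onth s (point_at p).2) (dr _ ll).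
  by rewrite !onth_map FP row_strand => -[].
have Farc p q : arc_step p q -> (F p).2 = (F q).2.
  rewrite /arc_step; case ep : (point_at p) => [l i]; case eq : (point_at q) => [l' j].
  have Fp := FP p; have Fq := FP q; rewrite ep /= in Fp; rewrite eq /= in Fq.
  case/or3P.
  - case/andP=> /eqP el; case E : (onth w l) => [[k e]|] // ca; rewrite {}el in Fq.
    have : carried k e i j by case: (e) ca.
    by move=> /(event_carried (ev _ _ _ E)); rewrite Fp Fq => -[->].
  - case/and3P=> /eqP el /eqP ej; case E : (onth w l) => [[k [||]]|] // /eqP ek.
    rewrite {}el {}ej {}ek in Fp Fq *.
    have /event_split[a [σ [τ [e1 e2 sa /=]]]] := ev _ _ _ E.
    move: Fp Fq; rewrite e1 !onth_cat sa ltnn subnn ltnNge leqnSn /= subSnn.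
    by case: σ {e1} => [|[b1 e1] [|[b2 e3] σ]] //= [<-] [<-] [].
  - case/and4P=> /eqP el /eqP ej l0; case E : (onth w l.-1) => [[k [o m||]]|] // /eqP ek.
    rewrite {}el {}ej {}ek in Fp Fq *.
    have /event_split[a [σ [τ [e1 e2 sa /=]]]] := ev _ _ _ E.
    rewrite prednK // in e2; move: Fp Fq; rewrite e2 !onth_cat sa ltnn subnn ltnNge leqnSn /= subSnn.
    by move=> + + [e3 _ et]; rewrite et /= => -[<-] [<-].
pose R (a : gap w) := gap_region A (st (gap_at a).1) (gap_at a).2.
have Rgap a b : gap_step a b -> R a = R b.
  rewrite /gap_step /R; case ea : (gap_at a) => [l i]; case eb : (gap_at b) => [l' j] /=.
  case/andP=> /eqP->; case E : (onth w l) => [[k e]|] // ca.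
  by apply: (event_gap (ev _ _ _ E)); case: (e) ca.
have FL p (a : gap w) : gap_at a = point_at p -> sleft (F p) = R a.
  move=> ea; have [ll _] := point_bounds p.
  by rewrite /R ea; have /coherentP := co _ ll; apply; apply: FP.
have FR p (a : gap w) : gap_at a = ((point_at p).1, (point_at p).2.+1) -> sright (F p) = R a.
  by move=> ea; rewrite /R ea /= (gap_regionS _ (FP p)).
have Fright p : right_region (F p).2 = R (right_gap p).
  have ea := right_gap_at p; case up : (strand p).1 ea => ea.
    by rewrite -(FR p) // /sright Fdir up.
  by rewrite -(FL p) ?ea; [rewrite /sleft Fdir up | case: point_at].
have Fleft p : left_region (F p).2 = R (left_gap p).
  have ea := left_gap_at p; case up : (strand p).1 ea => ea.
    by rewrite -(FL p) ?ea; [rewrite /sleft Fdir up | case: point_at].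
  by rewrite -(FR p) // /sright Fdir up.
pose f : labeling S w := ([ffun a : semiarc w => edge_label (F (val a)).2],
  [ffun r : region w => R (val r)]).
pose h := [ffun a : semiarc w => bead (F (val a)).2].
have fl p : arc_label f p = edge_label (F p).2.
  rewrite /arc_label ffunE; apply: (@class_fun _ _ _ (fun p => edge_label (F p).2)).
  by move=> x y /Farc ->.
have hb p : h (arc_of p) = bead (F p).2.
  rewrite ffunE; apply: (@class_fun _ _ _ (fun p => bead (F p).2)).
  by move=> x y /Farc ->.
have fr a : region_label f a = R a.
  by rewrite /region_label ffunE; apply: (class_fun _ Rgap).
exists f, h; split; last by apply/shadow_labelingP => p; rewrite !fr fl -Fleft -Fright.
split=> // l i ll; case: (ltnP i (size (row w l))) => hi.
  have [p -> ep] := point_ofE ll hi; have := FP p; rewrite ep /= => ->.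
  rewrite /data fl hb fr -Fright -Fdir; case: (F p) => b [[B x] g] //.
by rewrite point_of_out //= onth_default // -/st sr.
Qed.

(** Every level is read off from the data, and the leftmost region from the
    lowest gap. *)
Lemma reads_fun A ss A' ss' f h : reads A ss f h -> reads A' ss' f h -> A = A' /\ ss = ss'.
Proof.
move=> r r'; split.
  have [b _ eb] := gap_ofE (leq0n (size w)) (leq0n (size (row w 0))).
  by have := reads_region r b; rewrite (reads_region r') eb.
apply: (@eq_from_nth _ [::]); first by rewrite (reads_size r) (reads_size r').
move=> l; rewrite (reads_size r) => ll; apply: eq_onth => i.
by have := reads_data r i ll; rewrite -(reads_data r' i ll).
Qed.

Lemma reads_inj A ss f h f' h' : reads A ss f h -> reads A ss f' h' -> f = f' /\ h = h'.
Proof.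
move=> r r'; have D p : data f h p = data f' h' p.
  have [ll _] := point_bounds p; apply: Some_inj.
  by have := reads_data r (point_at p).2 ll; rewrite (reads_data r') // point_ofK.
have F r1 : f.2 r1 = f'.2 r1.
  by have := reads_region r (val r1); rewrite -(reads_region r') /region_label region_of_val.
split; last by apply/ffunP => a; have [_ _] := D (val a); rewrite arc_of_val.
case: f f' D F {r r'} => [f1 f2] [f1' f2'] /= D F; congr (_, _); apply/ffunP => // a.
by have [_ + _] := D (val a); rewrite /arc_label arc_of_val.
Qed.

Lemma reads_keys A ss tt f h h' : reads A ss f h -> reads A tt f h' -> map keys ss = map keys tt.
Proof.
move=> r r'; apply: (@eq_from_nth _ [::]); first by rewrite !size_map (reads_size r) (reads_size r').
move=> l; rewrite size_map => ll; have sr := reads_size r; have sr' := reads_size r'.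
rewrite !(nth_map [::]) ?sr' -?sr //; apply: eq_onth => i; rewrite !onth_map.
have lw : l < size w by rewrite -sr.
by have := reads_data r i lw; have := reads_data r' i lw => /= -> ->; case: point_of.
Qed.

Lemma reads_lift u A ss tt f h h' : reads A ss f h -> reads A tt f h' ->
  reads A (lift_chain u ss tt) f [ffun a => u (h a) (h' a)].
Proof.
move=> r r'; have sr := reads_size r; have sr' := reads_size r'.
have E l : l <= size w -> nth [::] ([::] :: lift_chain u ss tt) l =
    lift_state u (nth [::] ([::] :: ss) l) (nth [::] ([::] :: tt) l).
  case: l => [|l] //= ll; rewrite (nth_map ([::], [::])) ?size_zip ?sr ?sr' ?minnn //.
  by rewrite nth_zip ?sr.
have ez (σ τ : state) i : size σ = size τ -> onth (lift_state u σ τ) i =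
    if onth σ i is Some s then if onth τ i is Some t then Some (lift_strand u s t) else None
    else None.
  by elim: σ τ i => [|s σ IH] [|t τ] [|i] //= [/IH].
have szE l : l <= size w -> size (nth [::] ([::] :: ss) l) = size (nth [::] ([::] :: tt) l).
  by move=> ll; rewrite (reads_size_row r ll) (reads_size_row r' ll).
split; first by rewrite size_map size_zip sr sr' minnn.
  move=> l i ll; rewrite E // ez ?szE // (reads_data r) // (reads_data r') //.
  by case: point_of => //= p; rewrite /data /lift_strand /lift_edge /= ffunE.
move=> a; have [ll _] := gap_bounds a; rewrite E // (reads_region r).
have := szE _ ll; move: (nth _ _ _) (nth _ _ _) (gap_at a).2 => σ τ.
elim: σ {r r' sr sr' E szE ll a} A τ => [|s σ IH] A [|t τ] [|i] //= [e].
by rewrite (IH _ τ) // lift_cons /= /sright page_right_lift.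
Qed.

(** Erasing the beads turns two chains with the same keys into the same
    chain. *)
Lemma keys_reads A ss tt f h f' h' : reads A ss f h -> reads A tt f' h' ->
  map keys ss = map keys tt -> f = f'.
Proof.
move=> r r' k; have z := reads_lift (@zero_op X S G) r r.
have := reads_lift (@zero_op X S G) r' r'; rewrite -(lift_zero_chain k) => z'.
suff e : [ffun a => zero_op (h' a) (h' a)] = [ffun a => zero_op (h a) (h a)].
  by rewrite e in z'; have [] := reads_inj z z'.
by apply/ffunP => a; rewrite !ffunE.
Qed.

End ReadChains.

(** * Counting labelings by their modules *)

Section ModuleIso.

Variables (X : virtual_birack) (S : shadow X).
Implicit Types (M N P : shadow_module S).

Lemma module_iso_sym M N : module_iso M N -> module_iso N M.
Proof.
case=> phi [[psi phiK psiK] phiB phiA]; exists psi; split; first by exists phi.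
  by move=> x y; apply: (can_inj phiK); rewrite psiK phiB !psiK.
by move=> o A x y m; apply: (can_inj phiK); rewrite psiK phiA psiK.
Qed.

Lemma module_iso_trans M N P : module_iso M N -> module_iso N P -> module_iso M P.
Proof.
case=> phi [b1 phiB phiA] [psi [b2 psiB psiA]]; exists (psi \o phi); split.
- exact: bij_comp.
- by move=> x y; rewrite /= phiB psiB.
- by move=> o A x y m; rewrite /= phiA psiA.
Qed.

(** Both numbers are zero for infinite modules. *)
Lemma card_module_iso M N : module_iso M N -> card_module M = card_module N.
Proof.
move=> iso; rewrite /card_module.
have E : ([set: N] #= [set: M])%card.
  case: iso => phi [[psi phiK psiK] _ _]; have <- : (phi @` [set: M] = [set: N])%classic.
    by rewrite predeqE => y; split=> // _; exists (psi y); rewrite ?psiK.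
  by apply: inj_card_eq => x y _ _; apply: (can_inj phiK).
have [fM|infM] := pselect (finite_set [set: M]).
  have fN : finite_set [set: N] by rewrite (eq_finite_set E).
  by apply/esym/fcard_eq.
have infN : ~ finite_set [set: N] by rewrite (eq_finite_set E).
by rewrite /fset_set; case: pselect => // _; case: pselect => // _; rewrite !cardfs0.
Qed.

End ModuleIso.

Section Matching.

Variables (X : virtual_birack) (S : shadow X) (G : shadow_module S).

Definition matched c c' (w : word c) (w' : word c') A
    (F : seq (state G) -> seq (state G) -> Prop)
    (f : labeling S w) (h : {ffun semiarc w -> G})
    (f' : labeling S w') (h' : {ffun semiarc w' -> G}) : Prop :=
  shadow_labeling f /\ shadow_labeling f' /\
  exists ss ss', [/\ F ss ss', reads A ss f h & reads A ss' f' h'].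

Lemma matched_sym c c' (w : word c) (w' : word c') A F
    (f : labeling S w) h (f' : labeling S w') h' :
  matched A F f h f' h' -> matched A (fun ss ss' => F ss' ss) f' h' f h.
Proof. by case=> sf [sf' [ss [ss' [? ? ?]]]]; split=> //; split=> //; exists ss', ss. Qed.

Section Pair.

Variables (c c' : nat) (w : word c) (w' : word c').
Hypotheses (wok : link_diagram w) (wok' : link_diagram w').
Variables (A : S) (F : seq (state G) -> seq (state G) -> Prop).
Hypothesis eqF : equivalence A (map (@tile_of c) w) (map (@tile_of c') w') F.

Local Notation lab := (labeling S w).
Local Notation lab' := (labeling S w').
Local Notation beads := {ffun semiarc w -> G}.
Local Notation beads' := {ffun semiarc w' -> G}.

Lemma matched_valid (f : lab) (h : beads) (f' : lab') (h' : beads') :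
  matched A F f h f' h' -> valid f h /\ valid f' h'.
Proof.
case=> sf [sf' [ss [ss' [Fs r r']]]]; have [c1 c2] := equiv_closed eqF Fs.
have [b1 d1] := (reads_closed_chain wok r sf).1 c1.
by have [b2 d2] := (reads_closed_chain wok' r' sf').1 c2.
Qed.

Lemma matched_total (f : lab) (h : beads) : valid f h ->
  (forall a, gap_at a = (0, 0) -> region_label f a = A) ->
  exists (f' : lab') (h' : beads'), matched A F f h f' h'.
Proof.
case=> b sf d out; have [A1 [ss r]] := reads_ex h sf.
have eA : A1 = A.
  have [a _ ea] := gap_ofE (leq0n (size w)) (leq0n (size (row w 0))).
  by rewrite -(out a ea) (reads_region r) ea.
rewrite {}eA in r; have [ss' Fs] := equiv_total eqF ((reads_closed_chain wok r sf).2 (conj b d)).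
have [_ c2] := equiv_closed eqF Fs; have [f' [h' [r' sf']]] := closed_chain_reads wok' c2.
by exists f', h'; split=> //; split=> //; exists ss, ss'.
Qed.

Lemma matched_outer (f : lab) (h : beads) (f' : lab') (h' : beads') :
  matched A F f h f' h' ->
  forall a, gap_at a = (0, 0) -> region_label f a = A.
Proof. by case=> _ [_ [ss [ss' [_ r _]]]] a ea; rewrite (reads_region r) ea. Qed.

(** Which labeling is matched does not depend on the beads. *)
Lemma matched_labeling (f : lab) (h g : beads) (f' f2' : lab') (h' g' : beads') :
  matched A F f h f' h' ->
  matched A F f g f2' g' -> f' = f2'.
Proof.
case=> _ [_ [ss [ss' [Fs r r']]]] [_ [_ [tt [tt' [Ft q q']]]]].
by apply: (keys_reads r' q'); apply/(equiv_keys eqF Fs Ft)/(reads_keys r q).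
Qed.

Lemma matched_beads (f : lab) (h : beads) (f' : lab') (h' g' : beads') :
  matched A F f h f' h' -> matched A F f h f' g' -> h' = g'.
Proof.
case=> _ [_ [ss [ss' [Fs r r']]]] [_ [_ [tt [tt' [Ft q q']]]]].
have [_ e] := reads_fun r q; rewrite -e in Ft.
by rewrite -(equiv_fun eqF Fs Ft) in q'; have [] := reads_inj r' q'.
Qed.

Lemma matched_lift u (f : lab) (h g : beads) (f' : lab') (h' g' : beads') :
  compatible u ->
  matched A F f h f' h' -> matched A F f g f' g' ->
  matched A F f [ffun a => u (h a) (g a)] f' [ffun a => u (h' a) (g' a)].
Proof.
move=> cu [sf [sf' [ss [ss' [Fs r r']]]]] [_ [_ [tt [tt' [Ft q q']]]]].
split=> //; split=> //; exists (lift_chain u ss tt), (lift_chain u ss' tt'); split.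
- by apply: (equiv_lift eqF) => //; apply: reads_keys r q.
- exact: reads_lift.
- exact: reads_lift.
Qed.

Lemma matched_ex (f : lab) (h : beads) (f' : lab') (h' : beads') (g : beads) :
  matched A F f h f' h' -> valid f g ->
  exists g' : beads', matched A F f g f' g'.
Proof.
move=> m v; have [f2 [g' m']] := matched_total v (matched_outer m).
by exists g'; rewrite (matched_labeling m m').
Qed.

End Pair.

Lemma sub_compatible : compatible (fun g h : G => g - h)%R.
Proof.
split=> [o A x y g h|g g' h h']; first by rewrite sm_act_additive.
by rewrite opprD addrACA.
Qed.

Lemma act_compatible o A x y : compatible (fun g _ : G => sm_act o A x y g).
Proof. by split=> *; [rewrite sm_act_comm | rewrite sm_actD]. Qed.

(** Differences of beads and the action of the algebra are pointwise
    operations, so the matching preserves them. *)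
Lemma matched_iso c c' (w : word c) (w' : word c') (wok : link_diagram w)
    (wok' : link_diagram w') A F
    (eqF : equivalence A (map (@tile_of c) w) (map (@tile_of c') w') F)
    (f : labeling S w) h (f' : labeling S w') h' :
  matched A F f h f' h' -> module_iso (hom_module G f) (hom_module G f').
Proof.
move=> m; have [[b sf _] [b' sf' _]] := matched_valid wok wok' eqF m.
have /choice[phi phiP] : forall g : hom G f, exists g' : hom G f',
    matched A F f (hom_val g) f' (hom_val g').
  case=> g gP /=; have /hom_predP dg := gP.
  have [g' m'] := matched_ex wok wok' eqF m (And3 b sf dg).
  have [_ [_ _ dg']] := matched_valid wok wok' eqF m'.
  by exists (Hom (introT (hom_predP _ _) dg')).
have eqF' := equivalence_sym eqF.
have /choice[psi psiP] : forall g' : hom G f', exists g : hom G f,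
    matched A F f (hom_val g) f' (hom_val g').
  case=> g' gP /=; have /hom_predP dg := gP.
  have [g /matched_sym m'] := matched_ex wok' wok eqF' (matched_sym m) (And3 b' sf' dg).
  have [[_ _ dg'] _] := matched_valid wok wok' eqF m'.
  by exists (Hom (introT (hom_predP _ _) dg')).
exists phi; split.
- exists psi => g; apply: val_inj.
    exact: (matched_beads eqF' (matched_sym (psiP _)) (matched_sym (phiP _))).
  exact: (matched_beads eqF (phiP _) (psiP _)).
- move=> g1 g2; apply: val_inj; apply: (matched_beads eqF (phiP _)).
  have := matched_lift eqF sub_compatible (phiP g1) (phiP g2).
  set a := [ffun a => _]; set a' := [ffun a => _].
  have -> : a = hom_val (g1 - g2)%R by apply/ffunP => x; rewrite ffunE hom_valB.
  by have -> : a' = hom_val (phi g1 - phi g2)%R by apply/ffunP => x; rewrite ffunE hom_valB.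
- move=> o B x y g; apply: val_inj; apply: (matched_beads eqF (phiP _)).
  exact: (matched_lift eqF (act_compatible o B x y) (phiP g) (phiP g)).
Qed.

Definition count_labelings c (w : word c) (Q : shadow_module S -> Prop) : nat :=
  #|[pred f : labeling S w | is_labeling f && `[< Q (hom_module G f) >]]|.

(** Every labeling admits the beads 0, through which it is matched with a
    labeling of the other diagram. *)
Lemma count_le c c' (w : word c) (w' : word c') Q :
  link_diagram w -> link_diagram w' -> equi G (map (@tile_of c) w) (map (@tile_of c') w') ->
  (forall M N : shadow_module S, module_iso M N -> Q M -> Q N) ->
  count_labelings w Q <= count_labelings w' Q.
Proof.
move=> wok wok' /choice[F eqF] isoQ.
rewrite /count_labelings -[X in X <= _]card_sig -[X in _ <= X]card_sig.
(* The choice is made on the subtype of labelings, as w' may have no labeling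
   at all. *)
have /choice[phi phiP] : forall x : {f : labeling S w | is_labeling f && `[< Q (hom_module G f) >]},
    exists x' : {f : labeling S w' | is_labeling f && `[< Q (hom_module G f) >]},
    exists A h h', matched A (F A) (val x) h (val x') h'.
  case=> f /= /andP[/asboolP[b sf] /asboolP Qf].
  have [a _ ea] := gap_ofE (leq0n (size w)) (leq0n (size (row w 0))).
  have v : valid f (0%R : hom G f).
    by split=> //; apply/hom_predP; case: (0%R : hom G f).
  have [|f' [h' m]] := matched_total wok wok' (eqF (region_label f a)) v.
    by move=> a' ea'; congr region_label; apply: gap_at_inj; rewrite ea ea'.
  have [_ [b' sf' _]] := matched_valid wok wok' (eqF _) m.
  have P : is_labeling f' && `[< Q (hom_module G f') >].
    apply/andP; split; apply/asboolP => //.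
    by apply: isoQ Qf; apply: matched_iso (eqF _) _ _ _ _ m.
  by exists (exist _ f' P), (region_label f a), (0%R : hom G f), h'.
(* Matched labelings have the same unbounded region, so the two labelings are
   matched with their image by the same bijection. *)
apply: (leq_card phi) => x y e; apply: val_inj.
have [A [h [h' m]]] := phiP x; have [B [g [g' m']]] := phiP y; rewrite -e in m'.
have [a _ ea] := gap_ofE (leq0n (size w')) (leq0n (size (row w' 0))).
have eAB : A = B.
  by rewrite -(matched_outer (matched_sym m) ea) (matched_outer (matched_sym m') ea).
rewrite -{}eAB in m'.
exact: (matched_labeling (equivalence_sym (eqF A)) (matched_sym m) (matched_sym m')).
Qed.

Lemma count_eq c c' (w : word c) (w' : word c') Q :
  link_diagram w -> link_diagram w' -> equi G (map (@tile_of c) w) (map (@tile_of c') w') ->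
  (forall M N : shadow_module S, module_iso M N -> Q M -> Q N) ->
  count_labelings w Q = count_labelings w' Q.
Proof.
move=> wok wok' e isoQ; apply/eqP; rewrite eqn_leq !count_le //; exact: equi_sym.
Qed.

End Matching.

Theorem theorem5 (X : virtual_birack) (S : shadow X) (G : shadow_module S)
    (c c' : nat) (D : diagram c) (D' : diagram c')
    (E : writhe_vector X c -> diagram c)
    (E' : writhe_vector X c' -> diagram c')
    (isoDD' : virtually_isotopic D D')
    (framE : framings D E) (framE' : framings D' E') :
  shadow_module_multiset G E = shadow_module_multiset G E' /\
  (finite_set [set: G]%classic ->
     shadow_module_polynomial G E = shadow_module_polynomial G E').
Proof.
have [g [D1 [[f gK fK] eD1 iso]]] := isoDD'.
pose t (u : writhe_vector X c) : writhe_vector X c' := [ffun k => u (f k)].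
have tK : bijective t.
  by exists (fun u : writhe_vector X c' => [ffun k => u (g k)] : writhe_vector X c) => u;
    apply/ffunP => k; rewrite !ffunE ?fK ?gK.
have eqE u : equi G (map (@tile_of c) (slices (E u))) (map (@tile_of c') (slices (E' (t u)))).
  exact: (isotopic_framings_equi G gK fK eD1 iso framE framE').
have count Q u : (forall M N : shadow_module S, module_iso M N -> Q M -> Q N) ->
    count_labelings G (E u) Q = count_labelings G (E' (t u)) Q.
  by move=> isoQ; apply: count_eq => //; apply: slices_ok.
split.
  apply: funext => M; rewrite /shadow_module_multiset [RHS](reindex t); last exact: onW_bij.
  apply: eq_bigr => u _; apply: (count (fun N => module_iso N M)) => N N' iN.
  exact: module_iso_trans (module_iso_sym iN).
move=> _; rewrite /shadow_module_polynomial [RHS](reindex t); last exact: onW_bij.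
apply: eq_bigr => u _; apply/polyP => n; rewrite !coef_sum.
(* The coefficient of degree n counts the labelings whose module has n
   elements. *)
have coefE c0 (w : word c0) : (\sum_(f : labeling S w | is_labeling f)
    ('X^(card_module (hom_module G f)) : {poly int})`_n)%R
    = (count_labelings G w (fun N => n = card_module N))%:R%R.
  rewrite /count_labelings -sum1_card natr_sum big_mkcond [RHS]big_mkcond.
  apply: eq_bigr => f0 _; rewrite inE coefXn; case: is_labeling => //=.
  by case: (n =P _) => e; case: asboolP.
by rewrite !coefE (count _ u) // => M N /card_module_iso ->.
Qed.
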